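(* Let $r\ge 4$ and let $f=f(x,\mu)$ be a real-valued $C^r$ function defined on a neighbourhood of $(0,0)\in\mathbb{R}\times\mathbb{R}$, regarded as a one-parameter family of maps $x\mapsto f(x,\mu)$. Suppose $$f(0,0)=0,\quad f_x(0,0)=1,\quad f_\mu(0,0)>0,\quad f_{xx}(0,0)<0.$$ Let $$g(y,\nu,a)=y+\nu-y^2+a y^3 .$$ There exist a neighbourhood $N$ of $x=0$ and $\mu_0>0$ such that if $\mu\in(-\mu_0,0)$ then $f(\cdot,\mu)$ has no fixed points in $N$, and if $\mu\in(0,\mu_0)$ then $f(\cdot,\mu)$ has two fixed points in $N$. Moreover, there exist a neighbourhood $M$ of $y=0$ and continuous functions $\nu(\mu)$ and $a(\mu)$ with $$\nu(0)=0,\qquad \lim_{\mu\to0^+}\nu'(\mu)=-\frac{f_\mu f_{xx}}{2}\Big|_{(0,0)},\qquad a(0)=\frac{2f_{xxx}}{3f_{xx}^2}\Big|_{(0,0)},$$ such that, with $\tilde g(y,\mu)=g(y,\nu(\mu),a(\mu))$: 1. if $\mu\in(-\mu_0,0)$ then $f|_N$ is $C^r$-conjugate to $\tilde g|_M$; 2. if $\mu=0$ then $f|_N$ is $C^1$-conjugate to $\tilde g|_M$; 3. if $\mu\in(0,\mu_0)$ then $f|_N$ and $\tilde g|_M$ are $C^{r-1}$-conjugate on the basins of attraction/repulsion of their corresponding fixed points (that is, for each fixed point of $f|_N$ there is a $C^{r-1}$-conjugacy from its basin of attraction or repulsion, according to its stability, to that of the corresponding fixed point of $\tilde g|_M$)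.
   Context: Subscripts denote partial derivatives. For fixed $\mu$, $f|_N$ denotes the map $x\mapsto f(x,\mu)$ restricted to $N$, and $\tilde g|_M$ the map $y\mapsto\tilde g(y,\mu)$ restricted to $M$. Two maps $F:U\to\mathbb{R}$ and $G:V\to\mathbb{R}$ are topologically conjugate if there is a homeomorphism $h:U\to V$ with $h\circ F=G\circ h$ (for restricted maps this relation is understood at points where both sides are defined, i.e. whose image remains in the domain). They are differentiably conjugate if $h$ is a diffeomorphism, and $C^s$-conjugate ($s\ge1$) if the diffeomorphism $h$ is of class $C^s$. If $x$ is a fixed point of $F$, then $h(x)$ is the corresponding fixed point of $G$. The basin of attraction of a stable fixed point in a neighbourhood is the set of points of the neighbourhood whose forward orbits stay in the neighbourhood and converge to the fixed point; the basin of repulsion of an unstable fixed point is the set of points of the neighbourhood whose backward orbits stay in the neighbourhood and converge to the fixed point (the maps are locally invertible). *)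

(* Defs.v *)
From Stdlib Require Import Reals.
From Coquelicot Require Import Coquelicot.
Open Scope R_scope.

(** A neighbourhood of [p] on the line on which restricted maps are considered:
    an open interval around [p]. *)
Definition interval_nbhd (p : R) (N : R -> Prop) : Prop :=
  exists a b : R, a < p < b /\ forall x : R, N x <-> a < x < b.

(** [f] is [C^r] on [U]: [ex_diff_n] at a point asks that all iterated partial
    derivatives of order at most [r] exist and are continuous there. *)
Definition Cn2_on (r : nat) (U : R * R -> Prop) (f : R -> R -> R) : Prop :=
  forall x mu : R, U (x, mu) -> ex_diff_n f r x mu.

(** Meant for open [U], so that the values of [h] outside [U] are irrelevant. *)
Definition Cn_on (s : nat) (U : R -> Prop) (h : R -> R) : Prop :=
  forall (x : R) (k : nat), U x -> (k <= s)%nat ->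
    ex_derive_n h k x /\ continuous (Derive_n h k) x.

Definition diffeo_on (s : nat) (U V : R -> Prop) (h : R -> R) : Prop :=
  exists k : R -> R,
    (forall x : R, U x -> V (h x) /\ k (h x) = x) /\
    (forall y : R, V y -> U (k y) /\ h (k y) = y) /\
    Cn_on s U h /\ Cn_on s V k.

(** [h] is a [C^s] conjugacy between [F] restricted to [U] and [G] restricted
    to [V].  The left-hand side of [h (F x) = G (h x)] is defined only when
    [F x] is still in [U]. *)
Definition conjugacy (s : nat) (F : R -> R) (U : R -> Prop)
    (G : R -> R) (V : R -> Prop) (h : R -> R) : Prop :=
  diffeo_on s U V h /\
  forall x : R, U x -> U (F x) -> h (F x) = G (h x).

Definition conjugate (s : nat) (F : R -> R) (U : R -> Prop)
    (G : R -> R) (V : R -> Prop) : Prop :=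
  exists h : R -> R, conjugacy s F U G V h.

Definition fixed_in (F : R -> R) (N : R -> Prop) (p : R) : Prop :=
  N p /\ F p = p.

(** Lyapunov stability; a fixed point is unstable when it is not stable. *)
Definition stable (F : R -> R) (p : R) : Prop :=
  forall eps : R, 0 < eps -> exists delta : R, 0 < delta /\
    forall (x : R) (n : nat),
      Rabs (x - p) < delta -> Rabs (Nat.iter n F x - p) < eps.

Definition basin_attraction (F : R -> R) (N : R -> Prop) (p x : R) : Prop :=
  (forall n : nat, N (Nat.iter n F x)) /\
  is_lim_seq (fun n : nat => Nat.iter n F x) (Finite p).

(** The sequence [u] is a backward orbit of [x]; it is unique when [F] is
    injective on [N]. *)
Definition basin_repulsion (F : R -> R) (N : R -> Prop) (p x : R) : Prop :=
  exists u : nat -> R,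
    u O = x /\
    (forall n : nat, N (u n) /\ F (u (S n)) = u n) /\
    is_lim_seq u (Finite p).

Definition g (y nu a : R) : R := y + nu - y ^ 2 + a * y ^ 3.

(* Main.v *)
Require Import Defs.
From Stdlib Require Import Reals Lra Lia Ranalysis5.
From Stdlib Require Import ClassicalEpsilon.
From Coquelicot Require Import Coquelicot.
Open Scope R_scope.

(** Write [e1 = f_x (x1, mu) - 1 > 0] and [e2 = f_x (x2, mu) - 1 < 0] for the
    excess multipliers at the two fixed points [x1 < x2] that exist when
    [mu > 0].  A differentiable conjugacy preserves multipliers, and this leaves
    no freedom in [nu] and [a] for [mu > 0]: they are the two numbers for which
    the fixed points of [g] have the multipliers [1 + e1] and [1 + e2].  Solving
    gives [a = (e1 + e2) / (e1^2 + e1 e2 + e2^2)] and [nu = e1^2 height (e2 / e1)]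
    with [height] an explicit function smooth near [-1] ([nf_fixed]).  The limits
    at [mu = 0] come from Taylor expansion.  With [w = x2 - x1], the equations
    [f x = x] at both ends give [e1 / w -> - f_xx / 2] and
    [(e1 + e2) / w^2 -> f_xxx / 6] ([taylor_pair], [pair_limits]), hence
    [e2 / e1 -> -1] and [a -> 2 f_xxx / (3 f_xx^2)]; implicit differentiation of
    [f x = x] gives [e_i e_i' -> - f_mu f_xx] ([multiplier_limits]), hence
    [nu' -> 2 (- f_mu f_xx) height (-1) = - f_mu f_xx / 2] ([nf_nu'_limit]).

    Conversely, equality of multipliers suffices on a basin.  A contraction
    [F] of class [C^(k+2)] with fixed point [p] is conjugate to multiplication by
    [F' p] through a map of the same class: looking for it as the primitive of
    [exp P], the equation becomes [P' = F''/F' + F' (P' o F)], solved by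
    iteration because [F' < 1] ([transfer_Cn], [linearize_local]).  Transport by
    the dynamics extends the linearisation to the whole basin ([conj_extend],
    [linearize_basin]), and two linearisations with the same multiplier compose
    to a conjugacy; scaling one of them prescribes the image of one point, which
    is used to send the end of [N] to the end of [M] ([basin_conjugacy],
    [attracting_conjugacy]).  The repelling point is handled through the inverse
    maps ([repelling_conjugacy]).

    At [mu = 0] the fixed point is parabolic.  In the coordinate [z = 1 / x] each
    side becomes a map [z + A + O(1/z)], whose derivative is [1 + O(1/z^2)], so
    that the logarithms of the derivatives are summable along orbits.  Their sum
    is the logarithm of an invariant density, whose primitive is an Abel function,
    that is a function [Phi] with [Phi (Z z) = Phi z + 1] ([nt_density],
    [nt_abel]).  Two Abel functions give a conjugacy on each side of the fixed
    point, with one free constant; its derivative at [0] equals the quotient of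
    the second derivatives whatever the constant ([half_conjugacy]), so that the
    two sides fit together to a [C^1] diffeomorphism with prescribed images of
    both ends ([parabolic_conjugacy]).

    For [mu < 0] there are no fixed points and all orbits move to the left.  An
    Abel function exists again, of the full class of [F], as a regularised sum of
    a step function along orbits ([abel], [Cn_abel]).  It gives conjugacies with
    one free constant, but two ends to match, so that the time an orbit needs to
    cross [N], measured by the Abel function, must be the same for [g] and [M]
    ([passage_conjugacy]).  The coefficient [a] is kept constant on this side and
    [nu] is chosen to equate the times: the time is continuous and strictly
    increasing in the parameter and tends to infinity at the bifurcation
    ([T_continuous], [T_strict], [T_unbounded]), so that [nu] exists, is
    continuous and tends to [0] ([match_increasing], [conjugacy_below]).

    Throughout, a map near the bifurcation is replaced by a diffeomorphism of the
    whole line that agrees with it on the neighbourhood and has no further fixed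
    points ([ext], [ext_global]); a conjugacy of the extensions that maps the ends
    of one neighbourhood to those of the other restricts to what is wanted
    ([restrict_conjugacy]). *)

(** * Calculus of functions of class [C^s] on an open set *)

Lemma Derive_n_Derive (h : R -> R) (n : nat) (x : R) :
  Derive_n h (S n) x = Derive_n (Derive h) n x.
Proof.
  change (Derive h) with (Derive_n h 1).
  rewrite Derive_n_comp. f_equal. lia.
Qed.

(** Peeling off the innermost derivative, instead of the outermost one as in
    the definition of [Derive_n], is what lets every closure property below be
    proved by induction on the class. *)
Lemma Cn_S (s : nat) (U : R -> Prop) (h : R -> R) :
  Cn_on (S s) U h <->
  (forall x, U x -> ex_derive h x) /\ Cn_on s U (Derive h).
Proof.
  split.
  - intros H; split.
    + intros x Hx. exact (proj1 (H x 1%nat Hx ltac:(lia))).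
    + intros x k Hx Hk. destruct (H x (S k) Hx ltac:(lia)) as [H1 H2]. split.
      * destruct k as [|k]; [exact I|].
        apply ex_derive_ext with (f := Derive_n h (S k)).
        { intros t. apply Derive_n_Derive. }
        exact H1.
      * apply continuous_ext with (f := Derive_n h (S k)).
        { intros t. apply Derive_n_Derive. }
        exact H2.
  - intros [H1 H2] x [|k] Hx Hk.
    + split; [exact I|]. exact (ex_derive_continuous h x (H1 x Hx)).
    + destruct (H2 x k Hx ltac:(lia)) as [H3 H4]. split.
      * destruct k as [|k]; [exact (H1 x Hx)|].
        apply ex_derive_ext with (f := Derive_n (Derive h) k).
        { intros t. symmetry. apply Derive_n_Derive. }
        exact H3.
      * apply continuous_ext with (f := Derive_n (Derive h) k).
        { intros t. symmetry. apply Derive_n_Derive. }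
        exact H4.
Qed.

Lemma Cn_Derive s U h : Cn_on (S s) U h -> Cn_on s U (Derive h).
Proof. intros H. now apply Cn_S. Qed.

Lemma Cn_continuous s U h x : Cn_on s U h -> U x -> continuous h x.
Proof. intros H Hx. exact (proj2 (H x 0%nat Hx ltac:(lia))). Qed.

Lemma Cn_0 U h : (forall x, U x -> continuous h x) -> Cn_on 0 U h.
Proof.
  intros H x k Hx Hk. replace k with 0%nat by lia. split; [exact I|exact (H x Hx)].
Qed.

Lemma Cn_le s t U h : (t <= s)%nat -> Cn_on s U h -> Cn_on t U h.
Proof. intros Hts H x k Hx Hk. apply H; [exact Hx|lia]. Qed.

Lemma Cn_subset s (U V : R -> Prop) h :
  (forall x, V x -> U x) -> Cn_on s U h -> Cn_on s V h.
Proof. intros HVU H x k Hx. apply H, HVU, Hx. Qed.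

Lemma Cn_local s (U : R -> Prop) h :
  (forall x, U x -> exists V : R -> Prop, V x /\ Cn_on s V h) -> Cn_on s U h.
Proof.
  intros H x k Hx Hk. destruct (H x Hx) as [V [HV HC]]. now apply HC.
Qed.

Lemma Cn_ext s (U : R -> Prop) f g :
  open U -> (forall x, U x -> f x = g x) -> Cn_on s U f -> Cn_on s U g.
Proof.
  intros HU Hfg H x k Hx Hk. destruct (H x k Hx Hk) as [H1 H2].
  assert (Hloc : forall y, U y -> locally y (fun t => Derive_n f k t = Derive_n g k t)).
  { intros y Hy. apply filter_imp with (2 := HU y Hy).
    intros z Hz. apply Derive_n_ext_loc.
    apply filter_imp with (2 := HU z Hz). exact Hfg. }
  split.
  - destruct k as [|k]; [exact I|].
    apply ex_derive_n_ext_loc with (f := f); [|exact H1].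
    apply filter_imp with (2 := HU x Hx). exact Hfg.
  - apply continuous_ext_loc with (g := Derive_n f k).
    + apply filter_imp with (2 := Hloc x Hx). intros z ->; reflexivity.
    + exact H2.
Qed.

Lemma Cn_derivable s U h x : Cn_on (S s) U h -> U x -> is_derive h x (Derive h x).
Proof. intros H Hx. apply Derive_correct. apply Cn_S in H. now apply H. Qed.

Lemma Cn_of_derive s (U : R -> Prop) h h' :
  open U -> (forall x, U x -> is_derive h x (h' x)) -> Cn_on s U h' ->
  Cn_on (S s) U h.
Proof.
  intros HU Hd H. apply Cn_S. split.
  - intros x Hx. exists (h' x). now apply Hd.
  - apply Cn_ext with (f := h'); try assumption.
    intros x Hx. symmetry. now apply is_derive_unique, Hd.
Qed.

Lemma open_itv (a b : R) : open (fun x => a < x < b).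
Proof.
  apply open_and; [apply open_gt|apply open_lt].
Qed.

Lemma is_derive_eq (f : R -> R) (x l l' : R) : is_derive f x l -> l = l' -> is_derive f x l'.
Proof. now intros H <-. Qed.

(* The rules below are restated on [R] so that derivatives come out in terms of
   the operations of [R], where [ring] and [field] see them. *)

Lemma derive_const (c x : R) : is_derive (fun _ => c) x 0.
Proof. exact (@is_derive_const R_AbsRing R_NormedModule c x). Qed.

Lemma derive_id (x : R) : is_derive (fun t => t) x 1.
Proof. exact (@is_derive_id R_AbsRing x). Qed.

Lemma derive_plus (f g : R -> R) (x df dg : R) : is_derive f x df -> is_derive g x dg ->
  is_derive (fun t => f t + g t) x (df + dg).
Proof. exact (is_derive_plus (V := R_NormedModule) f g x df dg). Qed.

Lemma derive_minus (f g : R -> R) (x df dg : R) : is_derive f x df -> is_derive g x dg ->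
  is_derive (fun t => f t - g t) x (df - dg).
Proof. exact (is_derive_minus (V := R_NormedModule) f g x df dg). Qed.

Lemma derive_opp (f : R -> R) (x df : R) : is_derive f x df -> is_derive (fun t => - f t) x (- df).
Proof. exact (is_derive_opp (V := R_NormedModule) f x df). Qed.

Lemma derive_mult (f g : R -> R) (x df dg : R) : is_derive f x df -> is_derive g x dg ->
  is_derive (fun t => f t * g t) x (df * g x + f x * dg).
Proof. intros Hf Hg. exact (is_derive_mult f g x df dg Hf Hg Rmult_comm). Qed.

Lemma derive_comp (f g : R -> R) (x df dg : R) : is_derive f (g x) df -> is_derive g x dg ->
  is_derive (fun t => f (g t)) x (dg * df).
Proof. exact (is_derive_comp f g x df dg). Qed.

Lemma cont_plus (f g : R -> R) (x : R) : continuous f x -> continuous g x ->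
  continuous (fun t => f t + g t) x.
Proof. exact (continuous_plus (V := R_NormedModule) f g x). Qed.

Lemma cont_minus (f g : R -> R) (x : R) : continuous f x -> continuous g x ->
  continuous (fun t => f t - g t) x.
Proof. exact (continuous_minus (V := R_NormedModule) f g x). Qed.

Lemma cont_opp (f : R -> R) x : continuous f x -> continuous (fun t => - f t) x.
Proof. exact (continuous_opp (V := R_NormedModule) f x). Qed.

Lemma cont_mult (f g : R -> R) (x : R) : continuous f x -> continuous g x ->
  continuous (fun t => f t * g t) x.
Proof. exact (continuous_mult (K := R_AbsRing) f g x). Qed.

Ltac min_bounds a b :=
  pose proof (Rmin_l a b); pose proof (Rmin_r a b);
  lazymatch b with Rmin ?c ?d => min_bounds c d | _ => idtac end.

Ltac solve_min :=
  lazymatch goal with |- context [Rmin ?a ?b] =>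
    assert (0 < Rmin a b) by (repeat apply Rmin_pos; first [lra | assumption | apply cond_pos]);
    min_bounds a b; lra
  end.

Lemma Cn_const s (U : R -> Prop) c : open U -> Cn_on s U (fun _ => c).
Proof.
  intros HU. revert c. induction s as [|s IH]; intros c.
  - apply Cn_0. intros; apply continuous_const.
  - apply Cn_of_derive with (h' := fun _ => 0); auto.
    intros x _. apply derive_const.
Qed.

Lemma Cn_id s (U : R -> Prop) : open U -> Cn_on s U (fun x => x).
Proof.
  intros HU. destruct s as [|s].
  - apply Cn_0. intros; apply continuous_id.
  - apply Cn_of_derive with (h' := fun _ => 1); auto.
    + intros x _. apply derive_id.
    + now apply Cn_const.
Qed.

Lemma Cn_plus s (U : R -> Prop) f g :
  open U -> Cn_on s U f -> Cn_on s U g -> Cn_on s U (fun x => f x + g x).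
Proof.
  intros HU. revert f g. induction s as [|s IH]; intros f g Hf Hg.
  - apply Cn_0. intros x Hx.
    apply cont_plus;
      [exact (Cn_continuous _ _ _ _ Hf Hx)|exact (Cn_continuous _ _ _ _ Hg Hx)].
  - apply Cn_of_derive with (h' := fun x => Derive f x + Derive g x); auto.
    + intros x Hx.
      apply derive_plus; eapply Cn_derivable; eauto.
    + apply IH; eapply Cn_Derive; eauto.
Qed.

Lemma Cn_mult s (U : R -> Prop) f g :
  open U -> Cn_on s U f -> Cn_on s U g -> Cn_on s U (fun x => f x * g x).
Proof.
  intros HU. revert f g. induction s as [|s IH]; intros f g Hf Hg.
  - apply Cn_0. intros x Hx.
    apply cont_mult;
      [exact (Cn_continuous _ _ _ _ Hf Hx)|exact (Cn_continuous _ _ _ _ Hg Hx)].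
  - pose proof (Cn_Derive _ _ _ Hf) as Hf'. pose proof (Cn_Derive _ _ _ Hg) as Hg'.
    pose proof (Cn_le _ s _ _ (Nat.le_succ_diag_r s) Hf) as Hf0.
    pose proof (Cn_le _ s _ _ (Nat.le_succ_diag_r s) Hg) as Hg0.
    apply Cn_of_derive with (h' := fun x => Derive f x * g x + f x * Derive g x); auto.
    + intros x Hx.
      apply (derive_mult f g); try (eapply Cn_derivable; eauto).
    + apply Cn_plus; auto.
Qed.

Lemma Cn_scal s (U : R -> Prop) c f :
  open U -> Cn_on s U f -> Cn_on s U (fun x => c * f x).
Proof. intros HU Hf. apply Cn_mult; auto. now apply Cn_const. Qed.

Lemma Cn_opp s (U : R -> Prop) f :
  open U -> Cn_on s U f -> Cn_on s U (fun x => - f x).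
Proof.
  intros HU Hf. apply Cn_ext with (f := fun x => (-1) * f x); auto.
  - intros; ring.
  - now apply Cn_scal.
Qed.

Lemma Cn_minus s (U : R -> Prop) f g :
  open U -> Cn_on s U f -> Cn_on s U g -> Cn_on s U (fun x => f x - g x).
Proof. intros HU Hf Hg. apply Cn_plus; auto. now apply Cn_opp. Qed.

Lemma Cn_comp s (U V : R -> Prop) f g :
  open U -> (forall x, U x -> V (f x)) -> Cn_on s V g -> Cn_on s U f ->
  Cn_on s U (fun x => g (f x)).
Proof.
  intros HU HUV. revert g. induction s as [|s IH]; intros g Hg Hf.
  - apply Cn_0. intros x Hx. apply continuous_comp.
    + exact (Cn_continuous _ _ _ _ Hf Hx).
    + exact (Cn_continuous _ _ _ _ Hg (HUV x Hx)).
  - apply Cn_of_derive with (h' := fun x => Derive f x * Derive g (f x)); auto.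
    + intros x Hx.
      apply (derive_comp g f); eapply Cn_derivable; eauto.
    + apply Cn_mult; auto; [eapply Cn_Derive; eassumption|].
      apply IH; [eapply Cn_Derive; eassumption | eapply Cn_le; [|eassumption]; lia].
Qed.

Lemma Cn_inv s (U : R -> Prop) f :
  open U -> (forall x, U x -> f x <> 0) -> Cn_on s U f -> Cn_on s U (fun x => / f x).
Proof.
  intros HU H0. induction s as [|s IH]; intros Hf.
  - apply Cn_0. intros x Hx.
    apply continuity_pt_filterlim, continuity_pt_inv; [|auto].
    apply continuity_pt_filterlim. exact (Cn_continuous _ _ _ _ Hf Hx).
  - apply Cn_of_derive with (h' := fun x => - Derive f x * (/ f x * / f x)); auto.
    + intros x Hx. eapply is_derive_eq.
      * apply is_derive_inv; [eapply Cn_derivable; eauto|auto].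
      * simpl. change (- Derive f x / (f x * (f x * 1)) = - Derive f x * (/ f x * / f x)).
        field. auto.
    + assert (Hi : Cn_on s U (fun x => / f x)).
      { apply IH. eapply Cn_le; [|eassumption]; lia. }
      apply Cn_mult; auto; [apply Cn_opp; auto; eapply Cn_Derive; eassumption|].
      now apply Cn_mult.
Qed.

Lemma Cn_div s (U : R -> Prop) f g :
  open U -> (forall x, U x -> g x <> 0) -> Cn_on s U f -> Cn_on s U g ->
  Cn_on s U (fun x => f x / g x).
Proof. intros. apply Cn_mult; auto. now apply Cn_inv. Qed.

Lemma Cn_exp s (U : R -> Prop) f :
  open U -> Cn_on s U f -> Cn_on s U (fun x => exp (f x)).
Proof.
  intros HU. induction s as [|s IH]; intros Hf.
  - apply Cn_0. intros x Hx. apply continuous_comp.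
    + exact (Cn_continuous _ _ _ _ Hf Hx).
    + apply continuous_exp.
  - apply Cn_of_derive with (h' := fun x => Derive f x * exp (f x)); auto.
    + intros x Hx. apply (derive_comp exp f).
      * apply is_derive_exp.
      * eapply Cn_derivable; eauto.
    + apply Cn_mult; auto; [eapply Cn_Derive; eassumption|].
      apply IH. eapply Cn_le; [|eassumption]; lia.
Qed.

Lemma Cn_pow s (U : R -> Prop) f n :
  open U -> Cn_on s U f -> Cn_on s U (fun x => f x ^ n).
Proof.
  intros HU Hf. induction n as [|n IH]; simpl.
  - now apply Cn_const.
  - now apply Cn_mult.
Qed.

Lemma continuous_eps (f : R -> R) x :
  continuous f x <->
  forall eps, 0 < eps -> exists d, 0 < d /\
    forall y, Rabs (y - x) < d -> Rabs (f y - f x) < eps.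
Proof.
  split.
  - intros H eps He.
    destruct (proj1 (filterlim_locally f (f x)) H (mkposreal eps He)) as [d Hd].
    exists d. split; [apply cond_pos|]. intros y Hy. apply (Hd y Hy).
  - intros H. apply filterlim_locally. intros eps.
    destruct (H eps (cond_pos eps)) as [d [Hd0 Hd]].
    exists (mkposreal d Hd0). intros y Hy. apply (Hd y Hy).
Qed.

Lemma open_eps (U : R -> Prop) x :
  open U -> U x -> exists d, 0 < d /\ forall y, Rabs (y - x) < d -> U y.
Proof.
  intros HU Hx. destruct (HU x Hx) as [d Hd]. exists d.
  split; [apply cond_pos|]. intros y Hy. apply Hd, Hy.
Qed.

Definition increasing_on (U : R -> Prop) (f : R -> R) :=
  forall x y, U x -> U y -> x < y -> f x < f y.

Lemma increasing_inv_continuous (U V : R -> Prop) (F K : R -> R) :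
  open U -> open V -> increasing_on U F ->
  (forall y, V y -> U (K y) /\ F (K y) = y) ->
  forall y, V y -> continuous K y.
Proof.
  intros HU HV Hinc HK y Hy. destruct (HK y Hy) as [HKy HFK].
  apply continuous_eps. intros eps He.
  destruct (open_eps U _ HU HKy) as [d0 [Hp0 HB]].
  set (d := Rmin eps (d0 / 2)).
  assert (Hd : 0 < d <= eps /\ d < d0).
  { unfold d. unfold Rmin; destruct Rle_dec; lra. }
  assert (HUm : U (K y - d)) by (apply HB; rewrite Rabs_left; lra).
  assert (HUp : U (K y + d)) by (apply HB; rewrite Rabs_right; lra).
  pose proof (Hinc _ _ HUm HKy ltac:(lra)) as H1.
  pose proof (Hinc _ _ HKy HUp ltac:(lra)) as H2.
  rewrite HFK in H1, H2.
  destruct (open_eps V _ HV Hy) as [d1 [Hp1 Hd1]].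
  set (d2 := Rmin d1 (Rmin (y - F (K y - d)) (F (K y + d) - y))).
  assert (Hd2 : 0 < d2 /\ d2 <= d1 /\ d2 <= y - F (K y - d) /\ d2 <= F (K y + d) - y).
  { unfold d2.
    unfold Rmin; repeat destruct Rle_dec; lra. }
  exists d2. split; [lra|]. intros z Hz.
  assert (HVz : V z) by (apply Hd1; lra).
  destruct (HK z HVz) as [HKz HFKz].
  apply Rabs_def2 in Hz.
  assert (K y - d < K z).
  { apply Rnot_le_lt. intros Hle. destruct (Rle_lt_or_eq_dec _ _ Hle) as [Hlt|Heq].
    - pose proof (Hinc _ _ HKz HUm Hlt). lra.
    - rewrite Heq in HFKz. lra. }
  assert (K z < K y + d).
  { apply Rnot_le_lt. intros Hle. destruct (Rle_lt_or_eq_dec _ _ Hle) as [Hlt|Heq].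
    - pose proof (Hinc _ _ HUp HKz Hlt). lra.
    - rewrite <- Heq in HFKz. lra. }
  apply Rabs_def1; lra.
Qed.

Lemma is_derive_inverse (V : R -> Prop) (F K : R -> R) y l :
  open V -> V y -> (forall z, V z -> F (K z) = z) ->
  continuous K y -> is_derive F (K y) l -> l <> 0 -> is_derive K y (/ l).
Proof.
  intros HV Hy HFK HK HF Hl.
  apply is_derive_Reals. apply is_derive_Reals in HF.
  intros eps He.
  assert (Hal : 0 < Rabs l) by now apply Rabs_pos_lt.
  set (e1 := Rmin (Rabs l / 2) (eps * (Rabs l * Rabs l) / 2)).
  assert (He1 : 0 < e1 /\ e1 <= Rabs l / 2 /\ e1 <= eps * (Rabs l * Rabs l) / 2).
  { unfold e1. assert (0 < eps * (Rabs l * Rabs l) / 2).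
    { apply Rmult_lt_0_compat; [|lra]. apply Rmult_lt_0_compat; [lra|].
      now apply Rmult_lt_0_compat. }
    unfold Rmin; destruct Rle_dec; lra. }
  destruct (HF e1 (proj1 He1)) as [d Hd].
  destruct (proj1 (continuous_eps K y) HK d (cond_pos d)) as [d1 [Hd1 HKd]].
  destruct (open_eps V y HV Hy) as [d2 [Hp2 Hd2]].
  assert (Hm : 0 < Rmin d1 d2) by (apply Rmin_pos; lra).
  exists (mkposreal _ Hm). simpl. intros h Hh0 Hh.
  destruct (Rmin_Rgt_l _ _ _ Hh) as [Hh1 Hh2].
  assert (HVh : V (y + h)).
  { apply Hd2. now replace (y + h - y) with h by ring. }
  set (w := K (y + h) - K y).
  assert (Hw : Rabs w < d).
  { apply HKd. now replace (y + h - y) with h by ring. }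
  assert (HF1 : F (K y + w) - F (K y) = h).
  { unfold w. replace (K y + (K (y + h) - K y)) with (K (y + h)) by ring.
    rewrite (HFK (y + h) HVh), (HFK y Hy). ring. }
  assert (Hw0 : w <> 0).
  { intros E. rewrite E, Rplus_0_r in HF1. lra. }
  specialize (Hd w Hw0 Hw). rewrite HF1 in Hd.
  set (qq := h / w) in *.
  assert (Hq : Rabs l / 2 <= Rabs qq).
  { pose proof (Rabs_triang_inv l qq).
    rewrite Rabs_minus_sym in Hd. lra. }
  assert (Hq0 : qq <> 0).
  { intros E. rewrite E, Rabs_R0 in Hq. lra. }
  replace (w / h - / l) with ((l - qq) * / (qq * l)).
  2:{ unfold qq. field. repeat split; auto. }
  rewrite Rabs_mult, Rabs_inv, Rabs_mult, Rabs_minus_sym.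
  apply Rmult_lt_reg_r with (Rabs qq * Rabs l).
  { apply Rmult_lt_0_compat; lra. }
  rewrite Rmult_assoc, Rinv_l, Rmult_1_r.
  2:{ apply Rgt_not_eq, Rmult_lt_0_compat; lra. }
  apply Rlt_le_trans with (1 := Hd).
  apply Rle_trans with (1 := proj2 (proj2 He1)).
  replace (eps * (Rabs l * Rabs l) / 2) with (eps * ((Rabs l / 2) * Rabs l)) by field.
  apply Rmult_le_compat_l; [lra|]. apply Rmult_le_compat_r; lra.
Qed.

(** [K' = 1 / F' o K], so that the class of [K] is raised one step at a time. *)
Lemma Cn_inverse s (U V : R -> Prop) (F K : R -> R) :
  open V -> (forall y, V y -> U (K y) /\ F (K y) = y) ->
  (forall y, V y -> continuous K y) ->
  Cn_on (S s) U F -> (forall x, U x -> Derive F x <> 0) -> Cn_on (S s) V K.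
Proof.
  intros HV HK HKc HF HF0.
  assert (Hd : forall y, V y -> is_derive K y (/ Derive F (K y))).
  { intros y Hy. destruct (HK y Hy) as [H1 H2].
    apply is_derive_inverse with (V := V) (F := F); auto.
    - intros z Hz. now apply HK.
    - eapply Cn_derivable; eauto. }
  assert (HF' : Cn_on s U (Derive F)) by (eapply Cn_Derive; eassumption).
  assert (forall t, (t <= s)%nat -> Cn_on t V K) as HKt.
  { induction t as [|t IH]; intros Ht.
    - now apply Cn_0.
    - apply Cn_of_derive with (h' := fun y => / Derive F (K y)); auto.
      apply Cn_inv; auto.
      + intros y Hy. apply HF0. now apply HK.
      + apply Cn_comp with (V := U); auto.
        * intros y Hy. now apply HK.
        * eapply Cn_le; [|eassumption]. lia.
        * apply IH. lia. }
  apply Cn_of_derive with (h' := fun y => / Derive F (K y)); auto.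
  apply Cn_inv; auto.
  - intros y Hy. apply HF0. now apply HK.
  - apply Cn_comp with (V := U); auto. intros y Hy. now apply HK.
Qed.

(** ** Monotonicity and bijections *)

Definition convex (U : R -> Prop) :=
  forall x y z, U x -> U z -> x <= y <= z -> U y.

Lemma MVT_on (U : R -> Prop) f f' x y :
  convex U -> (forall t, U t -> is_derive f t (f' t)) -> U x -> U y -> x < y ->
  exists c, x < c < y /\ f y - f x = f' c * (y - x).
Proof.
  intros HU Hf Hx Hy Hxy.
  destruct (MVT_cor2 f f' x y Hxy) as [c [H1 H2]].
  - intros c Hc. apply is_derive_Reals, Hf. now apply HU with x y.
  - exists c. tauto.
Qed.

Lemma increasing_of_derive (U : R -> Prop) f f' :
  convex U -> (forall t, U t -> is_derive f t (f' t)) ->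
  (forall t, U t -> 0 < f' t) -> increasing_on U f.
Proof.
  intros HU Hf Hp x y Hx Hy Hxy.
  destruct (MVT_on U f f' x y HU Hf Hx Hy Hxy) as [c [Hc E]].
  assert (0 < f' c) by (apply Hp; apply HU with x y; auto; lra).
  assert (0 < f' c * (y - x)) by (apply Rmult_lt_0_compat; lra). lra.
Qed.

Lemma constant_of_derive (U : R -> Prop) f x y :
  convex U -> (forall t, U t -> is_derive f t 0) -> U x -> U y -> f x = f y.
Proof.
  intros HU Hf Hx Hy.
  destruct (Rtotal_order x y) as [H|[H|H]].
  - destruct (MVT_on U f (fun _ => 0) x y HU Hf Hx Hy H) as [c [_ E]]. lra.
  - now rewrite H.
  - destruct (MVT_on U f (fun _ => 0) y x HU Hf Hy Hx H) as [c [_ E]]. lra.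
Qed.

Lemma IVT_on (f : R -> R) x y v :
  x <= y -> (forall t, x <= t <= y -> continuous f t) -> f x <= v <= f y ->
  exists t, x <= t <= y /\ f t = v.
Proof.
  intros Hxy Hc Hv.
  destruct (Rle_lt_or_eq_dec _ _ (proj1 Hv)) as [H1|H1].
  2:{ exists x. lra. }
  destruct (Rle_lt_or_eq_dec _ _ (proj2 Hv)) as [H2|H2].
  2:{ exists y. lra. }
  destruct (Rle_lt_or_eq_dec _ _ Hxy) as [H3|H3].
  2:{ subst y. lra. }
  destruct (IVT_interv (fun t => f t - v) x y) as [t [Ht E]].
  - intros t Ht. apply continuity_pt_minus.
    + apply continuity_pt_filterlim. now apply Hc.
    + apply continuity_pt_const. intros ? ?; reflexivity.
  - exact H3.
  - simpl; lra.
  - simpl; lra.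
  - exists t. simpl in E. split; [exact Ht|lra].
Qed.

Lemma diffeo_ext s (U U' V V' : R -> Prop) h :
  (forall x, U' x <-> U x) -> (forall x, V' x <-> V x) ->
  diffeo_on s U V h -> diffeo_on s U' V' h.
Proof.
  intros HU HV [k [H1 [H2 [H3 H4]]]]. exists k.
  repeat split.
  - apply HV, H1, HU, H.
  - apply H1, HU, H.
  - apply HU, H2, HV, H.
  - apply H2, HV, H.
  - apply H3; [now apply HU|assumption].
  - apply H3; [now apply HU|assumption].
  - apply H4; [now apply HV|assumption].
  - apply H4; [now apply HV|assumption].
Qed.

(** A right inverse on [V] is enough: an increasing function is injective. *)
Lemma diffeo_of_increasing s (U V : R -> Prop) (F K : R -> R) :
  open U -> open V -> increasing_on U F ->
  Cn_on (S s) U F -> (forall x, U x -> Derive F x <> 0) ->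
  (forall x, U x -> V (F x)) ->
  (forall y, V y -> U (K y) /\ F (K y) = y) ->
  diffeo_on (S s) U V F.
Proof.
  intros HU HV Hinc HF HF0 HUV HK. exists K. repeat split.
  - now apply HUV.
  - destruct (HK (F x) (HUV x H)) as [H1 H2].
    destruct (Rtotal_order (K (F x)) x) as [H3|[H3|H3]]; auto.
    + pose proof (Hinc _ _ H1 H H3). lra.
    + pose proof (Hinc _ _ H H1 H3). lra.
  - now apply HK.
  - now apply HK.
  - now apply HF.
  - now apply HF.
  - revert x k H H0. apply Cn_inverse with (U := U) (F := F); auto.
    now apply increasing_inv_continuous with (U := U) (F := F).
  - revert x k H H0. apply Cn_inverse with (U := U) (F := F); auto.
    now apply increasing_inv_continuous with (U := U) (F := F).
Qed.

Lemma choice_on (U V : R -> Prop) (F : R -> R) :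
  (forall y, V y -> exists x, U x /\ F x = y) ->
  exists K : R -> R, forall y, V y -> U (K y) /\ F (K y) = y.
Proof.
  intros H.
  exists (fun y => epsilon (inhabits 0) (fun x => U x /\ F x = y)).
  intros y Hy. apply epsilon_spec. now apply H.
Qed.

(** * A step function and a cutoff of finite smoothness *)

Definition whole : R -> Prop := fun _ => True.

Lemma open_whole : open whole.
Proof. exact open_true. Qed.
#[export] Hint Resolve open_whole open_itv : core.
#[export] Hint Extern 0 (whole _) => exact I : core.

Definition pospow (n : nat) (x : R) : R := Rmax x 0 ^ S n.

Lemma pospow_nonneg n x : 0 <= pospow n x.
Proof. apply pow_le, Rmax_r. Qed.

Lemma pospow_zero n x : x <= 0 -> pospow n x = 0.
Proof. intros H. unfold pospow. rewrite Rmax_right; auto. simpl; ring. Qed.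

Lemma pospow_pos n x : 0 < x -> 0 < pospow n x.
Proof. intros H. unfold pospow. rewrite Rmax_left by lra. now apply pow_lt. Qed.

Lemma is_derive_pospow n x :
  is_derive (pospow (S n)) x (INR (S (S n)) * pospow n x).
Proof.
  destruct (Rtotal_order x 0) as [H|[H|H]].
  - apply is_derive_ext_loc with (f := fun _ => 0).
    + apply filter_imp with (2 := open_lt 0 x H). intros t Ht.
      symmetry. apply pospow_zero. lra.
    + rewrite pospow_zero by lra. rewrite Rmult_0_r.
      apply derive_const.
  - subst x. rewrite pospow_zero by lra. rewrite Rmult_0_r.
    apply is_derive_Reals. intros eps He.
    assert (Hm : 0 < Rmin eps 1) by (apply Rmin_pos; lra).
    exists (mkposreal _ Hm). simpl. intros h Hh0 Hh.
    rewrite (pospow_zero (S n) 0) by lra. rewrite Rplus_0_l, !Rminus_0_r.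
    destruct (Rle_dec h 0) as [Hle|Hle].
    + rewrite pospow_zero by lra. unfold Rdiv. rewrite Rmult_0_l, Rabs_R0. exact He.
    + unfold pospow. rewrite Rmax_left by lra.
      replace (h ^ S (S n) / h) with (h * h ^ n) by (simpl; field; lra).
      rewrite Rabs_right in Hh by lra.
      destruct (Rmin_Rgt_l _ _ _ Hh) as [He1 Hh1].
      assert (0 < h ^ n <= 1).
      { split; [apply pow_lt; lra|]. rewrite <- (pow1 n). apply pow_incr. lra. }
      rewrite Rabs_right.
      * apply Rle_lt_trans with (h * 1); [apply Rmult_le_compat_l; lra|lra].
      * apply Rle_ge, Rmult_le_pos; lra.
  - apply is_derive_ext_loc with (f := fun t => t ^ S (S n)).
    + apply filter_imp with (2 := open_gt 0 x H). intros t Ht.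
      unfold pospow. rewrite Rmax_left by lra. reflexivity.
    + unfold pospow. rewrite Rmax_left by lra.
      apply is_derive_Reals. apply derivable_pt_lim_pow.
Qed.

Lemma Cn_pospow n : Cn_on n whole (pospow n).
Proof.
  induction n as [|n IH].
  - apply Cn_0. intros x _. apply continuous_ext with (f := fun x => Rmax x 0).
    + intros t. unfold pospow. simpl. ring.
    + apply continuous_eps. intros eps He. exists eps. split; [lra|]. intros y Hy.
      apply Rle_lt_trans with (2 := Hy).
      unfold Rmax; repeat destruct Rle_dec; unfold Rabs; repeat destruct Rcase_abs; lra.
  - apply Cn_of_derive with (h' := fun x => INR (S (S n)) * pospow n x); auto.
    + intros x _. apply is_derive_pospow.
    + apply Cn_scal; auto.
Qed.

(** The classical quotient construction, with powers in place of flat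
    exponentials since finite smoothness is enough. *)
Definition step (n : nat) (x : R) : R :=
  pospow n x / (pospow n x + pospow n (1 - x)).

Lemma step_den n x : 0 < pospow n x + pospow n (1 - x).
Proof.
  pose proof (pospow_nonneg n x). pose proof (pospow_nonneg n (1 - x)).
  destruct (Rlt_dec 0 x) as [Hx|Hx].
  - pose proof (pospow_pos n x Hx). lra.
  - pose proof (pospow_pos n (1 - x) ltac:(lra)). lra.
Qed.

Lemma step_0 n x : x <= 0 -> step n x = 0.
Proof. intros H. unfold step, Rdiv. rewrite pospow_zero by lra. apply Rmult_0_l. Qed.

Lemma step_1 n x : 1 <= x -> step n x = 1.
Proof.
  intros H. unfold step. rewrite (pospow_zero n (1 - x)) by lra.
  pose proof (pospow_pos n x ltac:(lra)). field. lra.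
Qed.

Lemma step_range n x : 0 <= step n x <= 1.
Proof.
  unfold step. pose proof (pospow_nonneg n x). pose proof (pospow_nonneg n (1 - x)).
  pose proof (step_den n x). split.
  - apply Rdiv_le_0_compat; lra.
  - apply -> Rdiv_le_1; lra.
Qed.

Lemma step_lt_1 n x : x < 1 -> step n x < 1.
Proof.
  intros Hx. unfold step. pose proof (pospow_pos n (1 - x) ltac:(lra)).
  pose proof (step_den n x). apply Rmult_lt_reg_r with (1 := H0). unfold Rdiv.
  rewrite Rmult_assoc, Rinv_l by lra. lra.
Qed.

Lemma Cn_step n : Cn_on n whole (step n).
Proof.
  unfold step. apply Cn_div; auto.
  - intros x _. apply Rgt_not_eq, step_den.
  - apply Cn_pospow.
  - apply Cn_plus; auto; [apply Cn_pospow|].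
    apply Cn_comp with (V := whole); auto; [apply Cn_pospow|].
    apply Cn_minus; auto; [now apply Cn_const|now apply Cn_id].
Qed.

Definition step' (n : nat) (x : R) : R :=
  INR (S (S n)) *
  (pospow n x * pospow (S n) (1 - x) + pospow (S n) x * pospow n (1 - x)) /
  (pospow (S n) x + pospow (S n) (1 - x)) ^ 2.

Lemma is_derive_step n x : is_derive (step (S n)) x (step' n x).
Proof.
  pose proof (step_den (S n) x).
  assert (H1 : is_derive (fun x => pospow (S n) (1 - x)) x
                 (- (INR (S (S n)) * pospow n (1 - x)))).
  { eapply is_derive_eq.
    - apply (derive_comp (pospow (S n)) (fun x => 1 - x)).
      + apply is_derive_pospow.
      + apply (derive_minus (fun _ => 1) (fun x => x) x).
        * apply derive_const.
        * apply derive_id.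
    - ring. }
  eapply is_derive_eq.
  - apply is_derive_div; [apply is_derive_pospow| |lra].
    apply derive_plus; [apply is_derive_pospow|exact H1].
  - unfold step', plus; simpl. field. lra.
Qed.

Lemma step'_nonneg n x : 0 <= step' n x.
Proof.
  unfold step'. pose proof (step_den (S n) x).
  apply Rdiv_le_0_compat; [|now apply pow_lt].
  apply Rmult_le_pos; [apply pos_INR|].
  apply Rplus_le_le_0_compat; apply Rmult_le_pos; apply pospow_nonneg.
Qed.

Lemma step'_pos n x : 0 < x < 1 -> 0 < step' n x.
Proof.
  intros Hx. unfold step'. pose proof (step_den (S n) x).
  apply Rdiv_lt_0_compat; [|now apply pow_lt].
  apply Rmult_lt_0_compat; [apply lt_0_INR; lia|].
  apply Rplus_lt_0_compat; apply Rmult_lt_0_compat; apply pospow_pos; lra.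
Qed.

Lemma step'_outside n x : x <= 0 \/ 1 <= x -> step' n x = 0.
Proof.
  unfold step', Rdiv. intros [H|H].
  - rewrite (pospow_zero n x), (pospow_zero (S n) x) by lra. ring.
  - rewrite (pospow_zero n (1 - x)), (pospow_zero (S n) (1 - x)) by lra. ring.
Qed.

Lemma step_strict n x y : 0 < x < 1 -> x < y -> step (S n) x < step (S n) y.
Proof.
  intros Hx Hxy. destruct (Rlt_dec y 1) as [Hy|Hy].
  - apply (increasing_of_derive (fun t => 0 < t < 1) (step (S n)) (step' n)); try lra.
    + intros a b c; lra.
    + intros; apply is_derive_step.
    + apply step'_pos.
  - rewrite (step_1 _ y) by lra. apply step_lt_1. lra.
Qed.

Lemma step_mono n x y : x <= y -> step (S n) x <= step (S n) y.
Proof.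
  intros Hxy.
  destruct (Rle_lt_dec x 0) as [H0|H0].
  { rewrite (step_0 _ x H0). apply step_range. }
  destruct (Rle_lt_dec 1 x) as [H1|H1].
  { rewrite (step_1 _ x), (step_1 _ y) by lra. lra. }
  destruct (Rle_lt_or_eq_dec _ _ Hxy) as [H2|H2].
  - left. apply step_strict; lra.
  - rewrite H2. lra.
Qed.

Lemma step'_bounded n : exists C, forall x, Rabs (step' n x) <= C.
Proof.
  destruct (continuity_ab_maj (step' n) 0 1) as [m [Hm _]]; [lra| |].
  - intros c _. apply continuity_pt_filterlim.
    apply continuous_ext with (f := Derive (step (S n))).
    + intros t. apply is_derive_unique, is_derive_step.
    + apply Cn_continuous with (s := n) (U := whole); [|exact I].
      apply Cn_Derive. apply Cn_step.
  - exists (step' n m). intros x. rewrite Rabs_right by apply Rle_ge, step'_nonneg.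
    destruct (Rle_lt_dec x 0) as [H0|H0].
    { rewrite (step'_outside n x) by auto. apply step'_nonneg. }
    destruct (Rle_lt_dec 1 x) as [H1|H1].
    { rewrite (step'_outside n x) by auto. apply step'_nonneg. }
    apply Hm. lra.
Qed.

Definition cutoff (n : nat) (x : R) : R := step n (2 - x) * step n (2 + x).

Lemma cutoff_1 n x : Rabs x <= 1 -> cutoff n x = 1.
Proof.
  intros H. apply Rabs_le_between in H. unfold cutoff.
  rewrite !step_1 by lra. ring.
Qed.

Lemma cutoff_0 n x : 2 <= Rabs x -> cutoff n x = 0.
Proof.
  intros H. unfold cutoff.
  destruct (Rle_dec 0 x) as [Hx|Hx].
  - rewrite Rabs_right in H by lra. rewrite step_0 by lra. ring.
  - rewrite Rabs_left in H by lra. rewrite (step_0 n (2 + x)) by lra. ring.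
Qed.

Lemma cutoff_range n x : 0 <= cutoff n x <= 1.
Proof.
  unfold cutoff. pose proof (step_range n (2 - x)). pose proof (step_range n (2 + x)).
  split; [apply Rmult_le_pos; lra|].
  rewrite <- (Rmult_1_l 1). apply Rmult_le_compat; lra.
Qed.

Lemma Cn_cutoff n : Cn_on n whole (cutoff n).
Proof.
  apply Cn_mult; auto; apply Cn_comp with (V := whole); auto;
    try apply Cn_step.
  - apply Cn_minus; auto; [now apply Cn_const|now apply Cn_id].
  - apply Cn_plus; auto; [now apply Cn_const|now apply Cn_id].
Qed.

Lemma cutoff_derive_bounded n :
  exists C, 0 <= C /\ forall x, Rabs (Derive (cutoff (S n)) x) <= C.
Proof.
  destruct (step'_bounded n) as [C HC].
  assert (HC0 : 0 <= C) by (apply Rle_trans with (2 := HC 0), Rabs_pos).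
  exists (C + C). split; [lra|]. intros x.
  assert (H : is_derive (cutoff (S n)) x
    (- step' n (2 - x) * step (S n) (2 + x) + step (S n) (2 - x) * step' n (2 + x))).
  { unfold cutoff. eapply is_derive_eq.
    - apply (derive_mult (fun x => step (S n) (2 - x)) (fun x => step (S n) (2 + x))).
      + apply (derive_comp (step (S n)) (fun x => 2 - x)).
        * apply is_derive_step.
        * apply (derive_minus (fun _ => 2) (fun x => x) x).
          -- apply derive_const.
          -- apply derive_id.
      + apply (derive_comp (step (S n)) (fun x => 2 + x)).
        * apply is_derive_step.
        * apply (derive_plus (fun _ => 2) (fun x => x) x).
          -- apply derive_const.
          -- apply derive_id.
    - ring. }
  rewrite (is_derive_unique _ _ _ H).
  eapply Rle_trans; [apply Rabs_triang|].
  pose proof (step_range (S n) (2 - x)). pose proof (step_range (S n) (2 + x)).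
  apply Rplus_le_compat; rewrite Rabs_mult.
  - rewrite Rabs_Ropp, <- (Rmult_1_r C).
    apply Rmult_le_compat; try apply Rabs_pos; auto. rewrite Rabs_right; lra.
  - rewrite <- (Rmult_1_l C).
    apply Rmult_le_compat; try apply Rabs_pos; auto. rewrite Rabs_right; lra.
Qed.

(** * Extension of a tame map to a diffeomorphism of the line *)

Record global_diffeo (s : nat) (F K : R -> R) : Prop := {
  gd_F : Cn_on s whole F;
  gd_K : Cn_on s whole K;
  gd_KF : forall x, K (F x) = x;
  gd_FK : forall x, F (K x) = x;
  gd_F' : forall x, 0 < Derive F x;
  gd_K' : forall x, 0 < Derive K x;
  gd_Finc : increasing_on whole F;
  gd_Kinc : increasing_on whole K }.

Lemma global_diffeo_sym s F K : global_diffeo s F K -> global_diffeo s K F.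
Proof. intros []. now constructor. Qed.

Lemma global_diffeo_exists s F a b :
  0 < a -> Cn_on (S s) whole F -> (forall x, a <= Derive F x <= b) ->
  exists K, global_diffeo (S s) F K /\ forall x, Derive K x <= / a.
Proof.
  intros Ha HF Hab.
  assert (Hd : forall x, is_derive F x (Derive F x)).
  { intros x. eapply Cn_derivable; [exact HF|exact I]. }
  assert (Hc : forall x, continuous F x).
  { intros x. eapply Cn_continuous; [exact HF|exact I]. }
  assert (Hw : convex whole) by (intros ? ? ? _ _ _; exact I).
  assert (Hinc : increasing_on whole F).
  { apply increasing_of_derive with (f' := Derive F); auto.
    intros t _. specialize (Hab t). lra. }
  assert (Hgrow : forall x y, x < y -> a * (y - x) <= F y - F x).
  { intros x y Hxy.
    destruct (MVT_on whole F (Derive F) x y Hw (fun t _ => Hd t) I I Hxy) as [c [_ ->]].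
    apply Rmult_le_compat_r; [lra|apply Hab]. }
  assert (Hsurj : forall y, exists x, whole x /\ F x = y).
  { intros y. set (R0 := Rabs (y - F 0) / a + 1).
    assert (HR : 0 < R0 /\ Rabs (y - F 0) <= a * R0).
    { unfold R0. assert (0 <= Rabs (y - F 0) / a).
      { apply Rdiv_le_0_compat; [apply Rabs_pos|lra]. }
      split; [lra|]. replace (a * (Rabs (y - F 0) / a + 1)) with (Rabs (y - F 0) + a)
        by (field; lra). lra. }
    pose proof (Hgrow 0 R0 ltac:(lra)). pose proof (Hgrow (- R0) 0 ltac:(lra)).
    destruct HR as [HR0 HR]. apply Rabs_le_between in HR.
    destruct (IVT_on F (- R0) R0 y) as [t [_ Ht]]; try lra; auto.
    exists t. split; [exact I|exact Ht]. }
  destruct (choice_on whole whole F) as [K HK]; [intros y _; apply Hsurj|].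
  assert (Hn0 : forall x, whole x -> Derive F x <> 0).
  { intros x _. specialize (Hab x). lra. }
  assert (HKF : forall x, K (F x) = x).
  { intros x. destruct (HK (F x) I) as [_ E].
    destruct (Rtotal_order (K (F x)) x) as [H|[H|H]]; auto;
      pose proof (Hinc _ _ I I H); lra. }
  assert (HKc : forall y, whole y -> continuous K y).
  { apply increasing_inv_continuous with (U := whole) (F := F); auto. }
  assert (HKd : forall y, is_derive K y (/ Derive F (K y))).
  { intros y. apply is_derive_inverse with (V := whole) (F := F); auto.
    intros z _. now apply HK. }
  exists K. split.
  - constructor; auto.
    + apply Cn_inverse with (U := whole) (F := F); auto.
    + intros x. now apply HK.
    + intros x. specialize (Hab x). lra.
    + intros x. rewrite (is_derive_unique _ _ _ (HKd x)).
      specialize (Hab (K x)). apply Rinv_0_lt_compat. lra.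
    + apply increasing_of_derive with (f' := fun y => / Derive F (K y)); auto.
      intros x _. specialize (Hab (K x)). apply Rinv_0_lt_compat. lra.
  - intros x. rewrite (is_derive_unique _ _ _ (HKd x)).
    apply Rinv_le_contravar; [lra|]. apply Hab.
Qed.

(** What is used of a map close to a saddle-node bifurcation.  The last
    condition confines the fixed points to [(-l, l)]; the bound on [F 0], relative
    to [l], and the bound on [F' - 1] keep the displacement below a fixed fraction
    of [l], which leaves room for the extension to the line. *)
Record tame (r : nat) (e l : R) (F : R -> R) : Prop := {
  tame_l : 0 < l;
  tame_Cn : Cn_on r (fun x => - (3 * l) < x < 3 * l) F;
  tame_F' : forall x, Rabs x < 3 * l -> Rabs (Derive F x - 1) <= e;
  tame_F'' : forall x, Rabs x < 3 * l -> Derive_n F 2 x < 0;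
  tame_F0 : Rabs (F 0) <= e * l;
  tame_below : forall x, l <= Rabs x < 3 * l -> F x < x }.

(** The displacement [F x - x] is cut off to the negative constant [- e l].
    Where this happens [F] is already below the diagonal, so that no fixed point
    is created. *)
Definition ext (n : nat) (e l : R) (F : R -> R) (x : R) : R :=
  x + cutoff n (x / l) * (F x - x + e * l) - e * l.

(** The term of [(ext F)'] that contains the derivative of the cutoff is at most
    [4 e] times that derivative, since the displacement is at most [3 e l] and the
    cutoff lives at scale [l]; under this bound the slope of [ext F] stays within
    [1/2] of [1]. *)
Definition slack (n : nat) (e : R) : Prop :=
  0 < e <= / 10 /\ forall x, (4 * Rabs (Derive (cutoff n) x) + 1) * e <= / 2.

Lemma slack_exists n : exists e, slack (S n) e.
Proof.
  destruct (cutoff_derive_bounded n) as [C [HC0 HC]].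
  exists (/ (8 * C + 10)). split.
  - split; [apply Rinv_0_lt_compat; lra|apply Rinv_le_contravar; lra].
  - intros x. specialize (HC x).
    apply Rmult_le_reg_r with (8 * C + 10); [lra|].
    rewrite Rmult_assoc, Rinv_l by lra. lra.
Qed.

Lemma ext_eq n e l F x : 0 < l -> Rabs x <= l -> ext n e l F x = F x.
Proof.
  intros Hl Hx. unfold ext. rewrite cutoff_1; [ring|].
  rewrite Rabs_div, (Rabs_right l) by lra. apply -> Rdiv_le_1; lra.
Qed.

Lemma ext_far n e l F x : 0 < l -> 2 * l <= Rabs x -> ext n e l F x = x - e * l.
Proof.
  intros Hl Hx. unfold ext. rewrite cutoff_0; [ring|].
  rewrite Rabs_div, (Rabs_right l) by lra. apply -> Rle_div_r; lra.
Qed.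

Section Ext.
Variables (n : nat) (e l : R) (F : R -> R).
Hypothesis Hs : slack (S n) e.
Hypothesis HF : tame (S n) e l F.

Let Hl : 0 < l := tame_l _ _ _ _ HF.

Lemma tame_displacement x : Rabs x <= 2 * l -> Rabs (F x - x) <= 3 * (e * l).
Proof using Hs HF.
  intros Hx. pose proof (tame_F0 _ _ _ _ HF) as H0.
  assert (He : 0 < e <= / 10) by apply Hs.
  assert (HU : convex (fun x => - (3 * l) < x < 3 * l)) by (intros a b c; lra).
  set (ph := fun x => F x - x).
  assert (Hd : forall t, - (3 * l) < t < 3 * l -> is_derive ph t (Derive F t - 1)).
  { intros t Ht. apply derive_minus.
    - eapply Cn_derivable; [exact (tame_Cn _ _ _ _ HF)|exact Ht].
    - apply derive_id. }
  assert (Hb : forall t, - (3 * l) < t < 3 * l -> Rabs (Derive F t - 1) <= e).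
  { intros t Ht. apply (tame_F' _ _ _ _ HF). apply Rabs_def1; lra. }
  assert (Hph : Rabs (ph x - ph 0) <= e * (2 * l)).
  { apply Rabs_le_between in Hx.
    destruct (Rtotal_order x 0) as [H|[H|H]].
    - destruct (MVT_on _ ph _ x 0 HU Hd ltac:(lra) ltac:(lra) H) as [c [Hc E]].
      rewrite Rabs_minus_sym, E, Rabs_mult, (Rabs_right (0 - x)) by lra.
      apply Rmult_le_compat; try lra; [apply Rabs_pos|apply Hb; lra].
    - subst x. unfold Rminus. rewrite Rplus_opp_r, Rabs_R0.
      apply Rmult_le_pos; lra.
    - destruct (MVT_on _ ph _ 0 x HU Hd ltac:(lra) ltac:(lra) H) as [c [Hc E]].
      rewrite E, Rabs_mult, (Rabs_right (x - 0)) by lra.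
      apply Rmult_le_compat; try lra; [apply Rabs_pos|apply Hb; lra]. }
  unfold ph in Hph. replace (F 0 - 0) with (F 0) in Hph by ring.
  replace (F x - x) with ((F x - x - F 0) + F 0) by ring.
  eapply Rle_trans; [apply Rabs_triang|]. lra.
Qed.

Lemma ext_displacement x : Rabs (ext (S n) e l F x - x) < l.
Proof using Hs HF.
  assert (He : 0 < e <= / 10) by apply Hs.
  assert (Hel : 0 < e * l <= / 10 * l).
  { split; [apply Rmult_lt_0_compat; lra|apply Rmult_le_compat_r; lra]. }
  destruct (Rle_lt_dec (2 * l) (Rabs x)) as [Hx|Hx].
  - rewrite ext_far by lra. apply Rabs_def1; lra.
  - pose proof (tame_displacement x ltac:(lra)) as Hd.
    apply Rabs_le_between in Hd.
    unfold ext. pose proof (cutoff_range (S n) (x / l)) as Hc.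
    set (c := cutoff (S n) (x / l)) in *.
    apply Rabs_def1; nra.
Qed.

Lemma ext_below x : l <= Rabs x -> ext (S n) e l F x < x.
Proof using Hs HF.
  intros Hx.
  assert (He : 0 < e <= / 10) by apply Hs.
  assert (Hel : 0 < e * l) by (apply Rmult_lt_0_compat; lra).
  destruct (Rle_lt_dec (2 * l) (Rabs x)) as [H2|H2].
  - rewrite ext_far by lra. lra.
  - pose proof (tame_below _ _ _ _ HF x ltac:(lra)) as Hd.
    unfold ext. pose proof (cutoff_range (S n) (x / l)) as Hc.
    set (c := cutoff (S n) (x / l)) in *.
    assert (0 <= (1 - c) * (e * l)) by (apply Rmult_le_pos; lra).
    destruct (Rle_lt_or_eq_dec _ _ (proj1 Hc)) as [Hc0|Hc0].
    + assert (0 < c * (x - F x)) by (apply Rmult_lt_0_compat; lra). lra.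
    + rewrite <- Hc0. lra.
Qed.

Lemma Cn_ext_map : Cn_on (S n) whole (ext (S n) e l F).
Proof using Hs HF.
  apply Cn_local. intros x _.
  destruct (Rle_lt_dec (Rabs x) (2 * l)) as [Hx|Hx].
  - exists (fun x => - (3 * l) < x < 3 * l). split.
    + apply Rabs_le_between in Hx. cbv beta. lra.
    + unfold ext.
      apply Cn_minus; auto; [|now apply Cn_const].
      apply Cn_plus; auto; [now apply Cn_id|].
      apply Cn_mult; auto.
      * apply Cn_comp with (V := whole); auto.
        -- apply Cn_cutoff.
        -- apply Cn_ext with (f := fun x => / l * x); auto.
           ++ intros t _. field. lra.
           ++ apply Cn_scal; auto. now apply Cn_id.
      * apply Cn_plus; auto; [|now apply Cn_const].
        apply Cn_minus; auto; [|now apply Cn_id].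
        exact (tame_Cn _ _ _ _ HF).
  - exists (fun x => 2 * l < Rabs x). split; [exact Hx|].
    assert (Ho : open (fun x : R => 2 * l < Rabs x)).
    { apply open_comp with (f := Rabs) (D := fun y => 2 * l < y).
      - intros y _. apply continuous_Rabs.
      - apply open_gt. }
    apply Cn_ext with (f := fun x => x - e * l); auto.
    + intros t Ht. rewrite ext_far; lra.
    + apply Cn_minus; auto; [now apply Cn_id|now apply Cn_const].
Qed.

Lemma ext_derive x : Rabs (Derive (ext (S n) e l F) x - 1) <= / 2.
Proof using Hs HF.
  assert (He : 0 < e <= / 10) by apply Hs.
  assert (Hel : 0 < e * l) by (apply Rmult_lt_0_compat; lra).
  destruct (Rle_lt_dec (Rabs x) (2 * l)) as [Hx|Hx].
  - assert (Hx3 : - (3 * l) < x < 3 * l) by (apply Rabs_le_between in Hx; lra).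
    set (c' := Derive (cutoff (S n)) (x / l)).
    assert (Hdiv : is_derive (fun x => x / l) x (/ l)).
    { auto_derive; [exact I|]. unfold Rdiv. ring. }
    assert (Hd : is_derive (ext (S n) e l F) x
      (1 + (/ l * c' * (F x - x + e * l) + cutoff (S n) (x / l) * (Derive F x - 1)))).
    { unfold ext. eapply is_derive_eq.
      - apply derive_minus.
        + apply derive_plus.
          * apply derive_id.
          * apply (derive_mult (fun x => cutoff (S n) (x / l)) (fun x => F x - x + e * l)).
            -- apply (derive_comp (cutoff (S n)) (fun x => x / l)); [|exact Hdiv].
               eapply Cn_derivable; [apply Cn_cutoff|exact I].
            -- apply derive_plus.
               ++ apply derive_minus.
                  ** eapply Cn_derivable; [exact (tame_Cn _ _ _ _ HF)|exact Hx3].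
                  ** apply derive_id.
               ++ apply derive_const.
        + apply derive_const.
      - fold c'. ring. }
    rewrite (is_derive_unique _ _ _ Hd).
    pose proof (tame_displacement x Hx) as H1.
    pose proof (tame_F' _ _ _ _ HF x ltac:(lra)) as H2.
    pose proof (cutoff_range (S n) (x / l)) as H3.
    pose proof (proj2 Hs (x / l)) as H4. fold c' in H4.
    set (ch := cutoff (S n) (x / l)) in *.
    match goal with |- Rabs (1 + ?A - 1) <= _ => replace (1 + A - 1) with A by ring end.
    eapply Rle_trans; [apply Rabs_triang|].
    assert (HA : Rabs (/ l * c' * (F x - x + e * l)) <= 4 * Rabs c' * e).
    { rewrite !Rabs_mult, Rabs_inv, (Rabs_right l) by lra.
      replace (4 * Rabs c' * e) with (/ l * Rabs c' * (4 * (e * l))) by (field; lra).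
      apply Rmult_le_compat_l.
      - apply Rmult_le_pos; [left; apply Rinv_0_lt_compat; lra|apply Rabs_pos].
      - eapply Rle_trans; [apply Rabs_triang|]. rewrite (Rabs_right (e * l)) by lra. lra. }
    assert (HB : Rabs (ch * (Derive F x - 1)) <= e).
    { rewrite Rabs_mult, (Rabs_right ch) by lra. rewrite <- (Rmult_1_l e).
      apply Rmult_le_compat; try lra. apply Rabs_pos. }
    lra.
  - assert (Ho : open (fun x : R => 2 * l < Rabs x)).
    { apply open_comp with (f := Rabs) (D := fun y => 2 * l < y).
      - intros y _. apply continuous_Rabs.
      - apply open_gt. }
    assert (Hd : is_derive (ext (S n) e l F) x 1).
    { apply is_derive_ext_loc with (f := fun x => x - e * l).
      - apply filter_imp with (2 := Ho x Hx). intros t Ht. rewrite ext_far; lra.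
      - auto_derive; [exact I|ring]. }
    rewrite (is_derive_unique _ _ _ Hd). unfold Rminus. rewrite Rplus_opp_r, Rabs_R0. lra.
Qed.

Lemma ext_global : exists K, global_diffeo (S n) (ext (S n) e l F) K /\
  forall x, Derive K x <= 2.
Proof using Hs HF.
  destruct (global_diffeo_exists n (ext (S n) e l F) (/ 2) (3 / 2)) as [K [H1 H2]].
  - lra.
  - apply Cn_ext_map.
  - intros x. pose proof (ext_derive x) as H. apply Rabs_le_between in H. lra.
  - exists K. split; auto. intros x. specialize (H2 x). lra.
Qed.
End Ext.

(** * Iteration of monotone maps *)

Lemma iter_commute (F G : R -> R) n x :
  (forall y, F (G y) = G (F y)) -> Nat.iter n F (G x) = G (Nat.iter n F x).
Proof. intros H. induction n as [|n IH]; simpl; [reflexivity|]. now rewrite IH, H. Qed.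

Lemma iter_S_r (F : R -> R) n x : Nat.iter (S n) F x = Nat.iter n F (F x).
Proof. symmetry. now apply iter_commute. Qed.

Lemma iter_cancel (F K : R -> R) n x :
  (forall y, K (F y) = y) -> Nat.iter n K (Nat.iter n F x) = x.
Proof.
  intros H. revert x. induction n as [|n IH]; intros x; [reflexivity|].
  rewrite iter_S_r. simpl. now rewrite H, IH.
Qed.

Lemma iter_stable (J : R -> Prop) (F : R -> R) n x :
  (forall y, J y -> J (F y)) -> J x -> J (Nat.iter n F x).
Proof. intros H Hx. induction n as [|n IH]; simpl; auto. Qed.

Lemma iter_stable_le (J : R -> Prop) (F : R -> R) n m x :
  (forall y, J y -> J (F y)) -> (n <= m)%nat ->
  J (Nat.iter n F x) -> J (Nat.iter m F x).
Proof.
  intros H Hnm Hx. replace m with ((m - n) + n)%nat by lia.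
  rewrite Nat.iter_add. now apply iter_stable.
Qed.

Lemma iter_increasing (F : R -> R) n :
  increasing_on whole F -> increasing_on whole (Nat.iter n F).
Proof.
  intros H x y _ _ Hxy. induction n as [|n IH]; simpl; auto.
Qed.

Lemma increasing_le (F : R -> R) x y : increasing_on whole F -> x <= y -> F x <= F y.
Proof.
  intros H [Hxy|Hxy]; [left; now apply H|right; now rewrite Hxy].
Qed.

Lemma Cn_iter s (F : R -> R) n : Cn_on s whole F -> Cn_on s whole (Nat.iter n F).
Proof.
  intros H. induction n as [|n IH]; simpl.
  - now apply Cn_id.
  - apply (Cn_comp s whole whole (Nat.iter n F) F); auto.
Qed.

Lemma iter_opp (F : R -> R) n x :
  Nat.iter n (fun y => - F (- y)) x = - Nat.iter n F (- x).
Proof.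
  induction n as [|n IH]; simpl; [ring|]. rewrite IH. now rewrite Ropp_involutive.
Qed.

Lemma iter_lim_above (F : R -> R) p x :
  (forall y, continuous F y) -> (forall y, p < y <= x -> p < F y < y) ->
  p < x -> is_lim_seq (fun n => Nat.iter n F x) p.
Proof.
  intros Hc HF Hx. set (u := fun n => Nat.iter n F x).
  assert (Hu : forall n, p < u n <= x).
  { intros n. induction n as [|n IH]; unfold u in *; simpl; [lra|].
    pose proof (HF _ IH). lra. }
  assert (Hd : forall n, u (S n) <= u n) by (intros n; left; apply (HF _ (Hu n))).
  destruct (ex_finite_lim_seq_decr u p Hd) as [q Hq].
  { intros n. left. apply Hu. }
  assert (Hpq : p <= q).
  { apply (is_lim_seq_le (fun _ => p) u p q); auto.
    - intros n. left. apply Hu.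
    - apply is_lim_seq_const. }
  assert (Hqx : q <= x).
  { apply (is_lim_seq_le u (fun _ => x) q x); auto.
    - intros n. apply Hu.
    - apply is_lim_seq_const. }
  assert (HFq : F q = q).
  { assert (H1 : is_lim_seq (fun n => u (S n)) q) by now apply is_lim_seq_incr_1 in Hq.
    assert (H2 : is_lim_seq (fun n => F (u n)) (F q)).
    { apply is_lim_seq_continuous; auto. apply continuity_pt_filterlim, Hc. }
    apply is_lim_seq_unique in H1. apply is_lim_seq_unique in H2.
    change (fun n => F (u n)) with (fun n => u (S n)) in H2.
    rewrite H1 in H2. now injection H2. }
  destruct (Rle_lt_or_eq_dec _ _ Hpq) as [H|H].
  - pose proof (HF q ltac:(lra)). lra.
  - now rewrite H.
Qed.

Lemma iter_lim_below (F : R -> R) p x :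
  (forall y, continuous F y) -> (forall y, x <= y < p -> y < F y < p) ->
  x < p -> is_lim_seq (fun n => Nat.iter n F x) p.
Proof.
  intros Hc HF Hx.
  apply is_lim_seq_ext with (u := fun n => - Nat.iter n (fun y => - F (- y)) (- x)).
  { intros n. now rewrite iter_opp, !Ropp_involutive. }
  rewrite <- (Ropp_involutive p).
  apply (is_lim_seq_opp _ (Finite (- p))).
  apply iter_lim_above; [|intros y Hy; pose proof (HF (- y)); lra|lra].
  intros y. apply cont_opp.
  apply continuous_comp; [|apply Hc].
  apply cont_opp. apply continuous_id.
Qed.

Lemma lim_seq_enters (u : nat -> R) (p : R) (J : R -> Prop) :
  is_lim_seq u p -> open J -> J p -> exists n, J (u n).
Proof.
  intros Hu HJ Hp. destruct (Hu J (HJ p Hp)) as [n Hn]. exists n. apply Hn. lia.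
Qed.

(** ** Extending a conjugacy from an attracting neighbourhood *)

(** On [J], where [h0] conjugates [F] to [G], the maps [G^-n o h0 o F^n] all
    agree with [h0]; hence at any point whose orbit enters [J] they are
    eventually independent of [n], and so inherit the smoothness of [h0]. *)
Lemma extend_half s F G L (I J : R -> Prop) h0 :
  open J -> Cn_on s whole F -> Cn_on s whole L ->
  (forall x, L (G x) = x) -> (forall x, G (L x) = x) ->
  (forall x, J x -> J (F x)) -> (forall x, I x -> exists n, J (Nat.iter n F x)) ->
  Cn_on s J h0 -> (forall x, J x -> h0 (F x) = G (h0 x)) ->
  exists h : R -> R, Cn_on s I h /\
    (forall x, I x -> h (F x) = G (h x)) /\
    (forall n x, J (Nat.iter n F x) -> h x = Nat.iter n L (h0 (Nat.iter n F x))).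
Proof.
  intros HJo HF HL HLG HGL HJ HI Hh0 Hconj.
  set (h := fun x => real (Lim_seq (fun n => Nat.iter n L (h0 (Nat.iter n F x))))).
  assert (Hstep : forall k n x, J (Nat.iter n F x) ->
    Nat.iter (k + n) L (h0 (Nat.iter (k + n) F x)) = Nat.iter n L (h0 (Nat.iter n F x))).
  { induction k as [|k IH]; intros n x Hx; [reflexivity|].
    rewrite <- (IH n x Hx).
    change (S k + n)%nat with (S (k + n)).
    change (Nat.iter (S (k + n)) F x) with (F (Nat.iter (k + n) F x)).
    rewrite iter_S_r, Hconj, HLG; [reflexivity|].
    apply iter_stable_le with (n := n); auto. lia. }
  assert (Hh : forall n x, J (Nat.iter n F x) -> h x = Nat.iter n L (h0 (Nat.iter n F x))).
  { intros n x Hx. unfold h.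
    rewrite (is_lim_seq_unique _ (Nat.iter n L (h0 (Nat.iter n F x)))); [reflexivity|].
    apply is_lim_seq_ext_loc with (u := fun _ => Nat.iter n L (h0 (Nat.iter n F x))).
    - exists n. intros m Hm. replace m with ((m - n) + n)%nat by lia. now rewrite Hstep.
    - apply is_lim_seq_const. }
  exists h. split; [|split]; auto.
  - apply Cn_local. intros x Hx. destruct (HI x Hx) as [n Hn].
    exists (fun y => J (Nat.iter n F y)). split; auto.
    assert (Ho : open (fun y => J (Nat.iter n F y))).
    { apply open_comp with (f := Nat.iter n F) (D := J); auto.
      intros y _. apply Cn_continuous with (s := s) (U := whole); auto.
      now apply Cn_iter. }
    apply Cn_ext with (f := fun y => Nat.iter n L (h0 (Nat.iter n F y))); auto.
    + intros y Hy. symmetry. now apply Hh.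
    + apply Cn_comp with (V := whole); auto; [now apply Cn_iter|].
      apply Cn_comp with (V := J); auto.
      apply Cn_subset with (U := whole); auto. now apply Cn_iter.
  - intros x Hx. destruct (HI x Hx) as [n Hn].
    assert (Hn' : J (Nat.iter n F (F x))).
    { rewrite <- iter_S_r. simpl. auto. }
    rewrite (Hh n x Hn), (Hh n (F x) Hn').
    rewrite <- iter_S_r. simpl. rewrite Hconj by auto.
    apply iter_commute. intros y. now rewrite HLG, HGL.
Qed.

(** Extending [h0] from [F] to [G] and its inverse from [G] to [F] gives two maps
    that are inverse to each other: each is determined by its values on the
    attracting neighbourhood. *)
Lemma conj_extend s F K G L (I I' J J' : R -> Prop) h0 :
  global_diffeo s F K -> global_diffeo s G L ->
  (forall x, I x -> I (K x)) -> (forall x, I' x -> I' (L x)) ->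
  open J -> open J' -> (forall x, J x -> I x) -> (forall x, J' x -> I' x) ->
  (forall x, J x -> J (F x)) -> (forall x, J' x -> J' (G x)) ->
  (forall x, I x -> exists n, J (Nat.iter n F x)) ->
  (forall x, I' x -> exists n, J' (Nat.iter n G x)) ->
  diffeo_on s J J' h0 -> increasing_on J h0 ->
  (forall x, J x -> h0 (F x) = G (h0 x)) ->
  exists h : R -> R, diffeo_on s I I' h /\ increasing_on I h /\
    (forall x, I x -> h (F x) = G (h x)) /\ (forall x, J x -> h x = h0 x).
Proof.
  intros HF HG HIK HIL HJo HJo' HJI HJI' HJF HJG HIJ HIJ' [k0 [Hk1 [Hk2 [Hk3 Hk4]]]] Hinc Hconj.
  assert (Hconj' : forall y, J' y -> k0 (G y) = F (k0 y)).
  { intros y Hy. destruct (Hk2 y Hy) as [H1 H2].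
    rewrite <- H2 at 1. rewrite <- Hconj by auto. apply Hk1. auto. }
  destruct (extend_half s F G L I J h0) as [h [Hh1 [Hh2 Hh3]]];
    auto; try apply HF; try apply HG.
  destruct (extend_half s G F K I' J' k0) as [k [Hk5 [Hk6 Hk7]]];
    auto; try apply HF; try apply HG.
  assert (HGn : forall n x, J (Nat.iter n F x) -> Nat.iter n G (h x) = h0 (Nat.iter n F x)).
  { intros n x Hx. rewrite (Hh3 n x Hx). apply iter_cancel. apply HG. }
  assert (HFn : forall n y, J' (Nat.iter n G y) -> Nat.iter n F (k y) = k0 (Nat.iter n G y)).
  { intros n x Hx. rewrite (Hk7 n x Hx). apply iter_cancel. apply HF. }
  exists h. split; [exists k; split; [|split; [|split]]; auto|split; [|split]]; auto.
  - intros x Hx. destruct (HIJ x Hx) as [n Hn]. split.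
    + rewrite (Hh3 n x Hn). apply iter_stable; auto. apply HJI', Hk1, Hn.
    + rewrite (Hk7 n (h x)), HGn; auto; [|rewrite HGn; auto; now apply Hk1].
      rewrite (proj2 (Hk1 _ Hn)). apply iter_cancel. apply HF.
  - intros y Hy. destruct (HIJ' y Hy) as [n Hn]. split.
    + rewrite (Hk7 n y Hn). apply iter_stable; auto. apply HJI, Hk2, Hn.
    + rewrite (Hh3 n (k y)), HFn; auto; [|rewrite HFn; auto; now apply Hk2].
      rewrite (proj2 (Hk2 _ Hn)). apply iter_cancel. apply HG.
  - intros x y Hx Hy Hxy.
    destruct (HIJ x Hx) as [n Hn]. destruct (HIJ y Hy) as [m Hm].
    apply (iter_stable_le J F n (n + m)) in Hn; auto; [|lia].
    apply (iter_stable_le J F m (n + m)) in Hm; auto; [|lia].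
    rewrite (Hh3 _ _ Hn), (Hh3 _ _ Hm).
    apply (iter_increasing L); auto; [apply HG|].
    apply Hinc; auto. apply (iter_increasing F); auto. apply HF.
  - intros x Hx. exact (Hh3 0%nat x Hx).
Qed.

(** * Linearisation of a contraction *)

Lemma CVU_dom_rate (fn : nat -> R -> R) (D : R -> Prop) (v : R -> R) C q :
  0 <= q < 1 -> 0 <= C -> (forall n x, D x -> Rabs (fn n x - v x) <= C * q ^ n) ->
  (forall x, D x -> is_lim_seq (fun n => fn n x) (v x)) /\ CVU_dom fn D.
Proof.
  intros Hq HC H.
  assert (Hev : forall eps, 0 < eps -> exists N, forall n, (N <= n)%nat -> C * q ^ n < eps).
  { intros eps He.
    assert (Hl : is_lim_seq (fun n => C * q ^ n) 0).
    { replace (Finite 0) with (Rbar_mult C 0) by (simpl; f_equal; ring).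
      apply is_lim_seq_scal_l, is_lim_seq_geom. rewrite Rabs_right; lra. }
    destruct (proj2 (is_lim_seq_spec _ _) Hl (mkposreal eps He)) as [N HN].
    exists N. intros n Hn. specialize (HN n Hn). simpl in HN.
    apply Rabs_def2 in HN. lra. }
  assert (Hlim : forall x, D x -> is_lim_seq (fun n => fn n x) (v x)).
  { intros x Hx. apply is_lim_seq_spec. intros eps.
    destruct (Hev eps (cond_pos eps)) as [N HN]. exists N. intros n Hn.
    eapply Rle_lt_trans; [apply H; auto|auto]. }
  split; auto. intros eps.
  destruct (Hev eps (cond_pos eps)) as [N HN]. exists N. intros n Hn x Hx.
  rewrite (is_lim_seq_unique _ _ (Hlim x Hx)). simpl.
  eapply Rle_lt_trans; [apply H; auto|auto].
Qed.

Lemma geometric_limit (v : nat -> R) C q :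
  0 <= q < 1 -> 0 <= C -> (forall n, Rabs (v (S n) - v n) <= C * q ^ n) ->
  forall n, Rabs (v n - real (Lim_seq v)) <= C / (1 - q) * q ^ n.
Proof.
  intros Hq HC H.
  assert (Hnm : forall m n, Rabs (v (n + m)%nat - v n) <= C / (1 - q) * q ^ n).
  { assert (Hnm' : forall m n,
      Rabs (v (n + m)%nat - v n) <= C / (1 - q) * (q ^ n - q ^ (n + m))).
    { induction m as [|m IH]; intros n.
      - rewrite Nat.add_0_r. unfold Rminus. rewrite !Rplus_opp_r, Rabs_R0. lra.
      - replace (v (n + S m)%nat - v n)
          with ((v (S (n + m)) - v (n + m)%nat) + (v (n + m)%nat - v n))
          by (rewrite Nat.add_succ_r; ring).
        eapply Rle_trans; [apply Rabs_triang|].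
        eapply Rle_trans; [apply Rplus_le_compat; [apply H|apply IH]|].
        right. rewrite Nat.add_succ_r. simpl. field. lra. }
    intros m n. eapply Rle_trans; [apply Hnm'|].
    apply Rmult_le_compat_l.
    - apply Rdiv_le_0_compat; lra.
    - pose proof (pow_le q (n + m) (proj1 Hq)). lra. }
  assert (Hex : ex_finite_lim_seq v).
  { apply ex_lim_seq_cauchy_corr. intros eps.
    assert (Hl : is_lim_seq (fun n => 2 * (C / (1 - q)) * q ^ n) 0).
    { replace (Finite 0) with (Rbar_mult (2 * (C / (1 - q))) 0) by (simpl; f_equal; ring).
      apply is_lim_seq_scal_l, is_lim_seq_geom. rewrite Rabs_right; lra. }
    destruct (proj2 (is_lim_seq_spec _ _) Hl eps) as [N HN].
    exists N. intros n m Hn Hm. specialize (HN N (le_n N)). simpl in HN.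
    apply Rabs_def2 in HN.
    replace (v n - v m) with ((v n - v N) - (v m - v N)) by ring.
    pose proof (Hnm (n - N)%nat N) as H1. pose proof (Hnm (m - N)%nat N) as H2.
    replace (N + (n - N))%nat with n in H1 by lia.
    replace (N + (m - N))%nat with m in H2 by lia.
    eapply Rle_lt_trans; [apply Rabs_triang|]. rewrite Rabs_Ropp. lra. }
  intros n. rewrite Rabs_minus_sym.
  apply Lim_seq_correct' in Hex.
  assert (Hl : is_lim_seq (fun m => Rabs (v (n + m)%nat - v n))
                 (Rabs (real (Lim_seq v) - v n))).
  { apply (is_lim_seq_abs _ (Finite _)).
    apply (is_lim_seq_minus' _ (fun _ => v n)); [|apply is_lim_seq_const].
    apply is_lim_seq_ext with (u := fun m => v (m + n)%nat).
    - intros m. f_equal. lia.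
    - now apply is_lim_seq_incr_n. }
  exact (is_lim_seq_le _ (fun _ => C / (1 - q) * q ^ n) _ (Finite _)
    (fun m => Hnm m n) Hl (is_lim_seq_const _)).
Qed.

Lemma bounded_on_closed (f : R -> R) x y :
  x <= y -> (forall t, x <= t <= y -> continuous f t) ->
  exists M, 0 <= M /\ forall t, x <= t <= y -> Rabs (f t) <= M.
Proof.
  intros Hxy Hc.
  destruct (continuity_ab_maj (fun t => Rabs (f t)) x y Hxy) as [m [Hm _]].
  - intros t Ht. apply continuity_pt_filterlim.
    apply continuous_comp; [now apply Hc|apply continuous_Rabs].
  - exists (Rabs (f m)). split; [apply Rabs_pos|exact Hm].
Qed.

Fixpoint transfer (A psi F : R -> R) (n : nat) (x : R) : R :=
  match n with
  | O => 0
  | S m => psi x + A x * transfer A psi F m (F x)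
  end.

Section Transfer.
Variables (p eta q : R) (F : R -> R).
Hypothesis Heta : 0 < eta.
Hypothesis Hq : 0 <= q < 1.
Let J := fun x => p - eta < x < p + eta.
Hypothesis HFp : forall x, J x -> Rabs (F x - p) <= Rabs (x - p).

Lemma ball_convex_J rho x : rho < eta -> Rabs (x - p) <= rho -> J x.
Proof using.
  intros H1 H2. apply Rabs_le_between in H2. unfold J. lra.
Qed.

Lemma J_stable x : J x -> J (F x).
Proof using HFp.
  intros Hx. pose proof (HFp x Hx) as H. unfold J in *.
  assert (Rabs (x - p) < eta) by (apply Rabs_def1; lra).
  assert (H1 : Rabs (F x - p) < eta) by lra. apply Rabs_def2 in H1. lra.
Qed.

(** The balls around [p] are invariant under [F], and each step multiplies the
    difference of two consecutive iterates by a value of [A]. *)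
Lemma transfer_rate (A psi : R -> R) (rho : R) :
  rho < eta -> (forall x, J x -> Rabs (A x) <= q) ->
  (forall x, J x -> continuous psi x) ->
  exists C, 0 <= C /\ forall n x, Rabs (x - p) <= rho ->
    Rabs (transfer A psi F n x - real (Lim_seq (fun n => transfer A psi F n x)))
      <= C * q ^ n.
Proof using Hq HFp.
  intros Hrho HA Hpsi.
  destruct (Rle_lt_dec 0 rho) as [Hr0|Hr0].
  2:{ exists 0. split; [lra|]. intros n x Hx. pose proof (Rabs_pos (x - p)). lra. }
  destruct (bounded_on_closed psi (p - rho) (p + rho)) as [M [HM0 HM]]; [lra| |].
  { intros t Ht. apply Hpsi. unfold J; lra. }
  assert (H : forall n x, Rabs (x - p) <= rho ->
    Rabs (transfer A psi F (S n) x - transfer A psi F n x) <= M * q ^ n).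
  { induction n as [|n IH]; intros x Hx.
    - simpl. replace (psi x + A x * 0 - 0) with (psi x) by ring. rewrite Rmult_1_r.
      apply HM. apply Rabs_le_between in Hx. lra.
    - assert (HJx : J x) by now apply ball_convex_J with rho.
      replace (transfer A psi F (S (S n)) x - transfer A psi F (S n) x)
        with (A x * (transfer A psi F (S n) (F x) - transfer A psi F n (F x)))
        by (simpl; ring).
      rewrite Rabs_mult. replace (M * q ^ S n) with (q * (M * q ^ n)) by (simpl; ring).
      apply Rmult_le_compat; try apply Rabs_pos; auto.
      apply IH. apply Rle_trans with (2 := Hx). auto. }
  exists (M / (1 - q)). split; [apply Rdiv_le_0_compat; lra|].
  intros n x Hx.
  apply (geometric_limit (fun n => transfer A psi F n x) M q Hq HM0).
  intros m. now apply H.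
Qed.

(** The solution [u] of [u = psi + A (u o F)] is a uniform limit, and formally
    [u'] solves an equation of the same shape, with weight [A F'] and source
    [psi' + A' (u o F)].  Differentiating therefore only changes the data of the
    equation, and the class of [u] is raised by induction. *)
Lemma transfer_Cn k (A psi : R -> R) :
  Cn_on k J F -> (forall x, J x -> Rabs (Derive F x) <= 1) ->
  Cn_on k J A -> Cn_on k J psi -> (forall x, J x -> Rabs (A x) <= q) ->
  let u := fun x => real (Lim_seq (fun n => transfer A psi F n x)) in
  Cn_on k J u /\ forall x, J x -> u x = psi x + A x * u (F x).
Proof using Heta Hq HFp.
  intros HF HF1. revert A psi. induction k as [|k IH]; intros A psi HA Hpsi HAq u.
  - assert (HcA : forall x, J x -> continuous A x)
      by (intros; eapply Cn_continuous; eauto).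
    assert (Hcpsi : forall x, J x -> continuous psi x)
      by (intros; eapply Cn_continuous; eauto).
    assert (Hlim : forall x, J x ->
      is_lim_seq (fun n => transfer A psi F n x) (u x)).
    { intros x Hx.
      destruct (transfer_rate A psi (Rabs (x - p))) as [C [HC HCr]]; auto.
      { apply Rabs_def1; unfold J in Hx; lra. }
      apply (CVU_dom_rate (fun n => transfer A psi F n)
        (fun y => Rabs (y - p) <= Rabs (x - p)) u C q); auto. lra. }
    split.
    + apply Cn_0. intros x Hx.
      set (rho := (Rabs (x - p) + eta) / 2).
      assert (Hrho : Rabs (x - p) < rho /\ rho < eta).
      { assert (Rabs (x - p) < eta) by (apply Rabs_def1; unfold J in Hx; lra).
        unfold rho. lra. }
      destruct (transfer_rate A psi rho) as [C [HC HCr]]; try tauto.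
      apply continuity_pt_filterlim.
      apply CVU_cont_open with (D := fun y => p - rho < y < p + rho).
      * apply open_itv.
      * apply (CVU_dom_rate _ _ u C q); auto.
        intros n y Hy. apply HCr. apply Rabs_le_between. lra.
      * intros n. induction n as [|n IHn]; intros y Hy; simpl.
        { apply continuity_pt_const. intros ? ?; reflexivity. }
        assert (HJy : J y) by (unfold J; lra).
        assert (Hcont : forall g, continuous g y -> continuity_pt g y)
          by (intros g Hg; now apply continuity_pt_filterlim).
        apply continuity_pt_plus; [now apply Hcont, Hcpsi|].
        apply continuity_pt_mult; [now apply Hcont, HcA|].
        apply (continuity_pt_comp F).
        -- apply Hcont. eapply Cn_continuous; eauto.
        -- apply IHn. assert (Hy' : Rabs (y - p) < rho) by (apply Rabs_def1; lra).
           pose proof (HFp y HJy) as Hb.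
           assert (Hb' : Rabs (F y - p) < rho) by lra.
           apply Rabs_def2 in Hb'. lra.
      * destruct Hrho as [Hr _]. apply Rabs_def2 in Hr. lra.
    + intros x Hx.
      assert (H1 : is_lim_seq (fun n => transfer A psi F (S n) x) (u x)).
      { apply (is_lim_seq_incr_1 (fun n => transfer A psi F n x)). auto. }
      assert (H2 : is_lim_seq (fun n => transfer A psi F (S n) x)
                     (psi x + A x * u (F x))).
      { simpl. apply (is_lim_seq_plus' (fun _ => psi x)); [apply is_lim_seq_const|].
        apply (is_lim_seq_scal_l _ (A x) (Finite _)). apply Hlim. now apply J_stable. }
      apply is_lim_seq_unique in H1. apply is_lim_seq_unique in H2.
      rewrite H1 in H2. now injection H2.
  - assert (HFk : Cn_on k J F) by (eapply Cn_le; [|exact HF]; lia).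
    assert (HAk : Cn_on k J A) by (eapply Cn_le; [|exact HA]; lia).
    assert (Hpsik : Cn_on k J psi) by (eapply Cn_le; [|exact Hpsi]; lia).
    assert (HJo : open J) by apply open_itv.
    destruct (IH HFk A psi HAk Hpsik HAq) as [Huk Hu]. fold u in Huk, Hu.
    split; [|exact Hu].
    assert (HF' : Cn_on k J (Derive F)) by (eapply Cn_Derive; eassumption).
    assert (HA' : Cn_on k J (Derive A)) by (eapply Cn_Derive; eassumption).
    assert (Hpsi' : Cn_on k J (Derive psi)) by (eapply Cn_Derive; eassumption).
    set (A1 := fun x => A x * Derive F x).
    set (psi1 := fun x => Derive psi x + Derive A x * u (F x)).
    assert (HA1 : Cn_on k J A1) by (apply Cn_mult; auto).
    assert (Hpsi1 : Cn_on k J psi1).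
    { apply Cn_plus; auto. apply Cn_mult; auto. apply Cn_comp with (V := J); auto.
      apply J_stable. }
    assert (HA1q : forall x, J x -> Rabs (A1 x) <= q).
    { intros x Hx. unfold A1. rewrite Rabs_mult, <- (Rmult_1_r q).
      apply Rmult_le_compat; try apply Rabs_pos; auto. }
    destruct (IH HFk A1 psi1 HA1 Hpsi1 HA1q) as [Hvk Hv]. cbv zeta in Hvk, Hv.
    set (v := fun x => real (Lim_seq (fun n => transfer A1 psi1 F n x))).
    assert (Hv' : forall x, J x -> v x = psi1 x + A1 x * v (F x)) by exact Hv.
    change (Cn_on k J v) in Hvk.
    apply Cn_of_derive with (h' := v); auto.
    assert (Htr : forall n, Cn_on (S k) J (transfer A psi F n)).
    { induction n as [|n IHn]; simpl; [now apply Cn_const|].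
      apply Cn_plus; auto. apply Cn_mult; auto.
      apply Cn_comp with (V := J); auto. apply J_stable. }
    assert (Hder : forall n x, J x -> Derive (transfer A psi F (S n)) x =
      Derive psi x + (Derive A x * transfer A psi F n (F x)
        + A x * (Derive F x * Derive (transfer A psi F n) (F x)))).
    { intros n x Hx. apply is_derive_unique. simpl.
      apply derive_plus.
      - eapply Cn_derivable; eauto.
      - apply (derive_mult A (fun y => transfer A psi F n (F y))).
        + eapply Cn_derivable; eauto.
        + apply (derive_comp (transfer A psi F n) F).
          * eapply Cn_derivable; [apply Htr|]. now apply J_stable.
          * eapply Cn_derivable; eauto. }
    intros x Hx.
    set (rho := (Rabs (x - p) + eta) / 2).
    assert (Hrho : Rabs (x - p) < rho /\ rho < eta).
    { assert (Rabs (x - p) < eta) by (apply Rabs_def1; unfold J in Hx; lra).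
      unfold rho. lra. }
    assert (Hrho0 : 0 <= rho) by (pose proof (Rabs_pos (x - p)); lra).
    destruct (transfer_rate A psi rho) as [C [HC HCr]]; try tauto.
    { intros; eapply Cn_continuous; eauto. }
    destruct (bounded_on_closed (Derive A) (p - rho) (p + rho)) as [M [HM0 HM]]; [lra| |].
    { intros t Ht. eapply Cn_continuous; eauto. unfold J; lra. }
    destruct (bounded_on_closed v (p - rho) (p + rho)) as [V [HV0 HV]]; [lra| |].
    { intros t Ht. eapply Cn_continuous; eauto. unfold J; lra. }
    (* A ratio [r > q] absorbs the source term [M * C * q ^ n] left by the
       error on [u]. *)
    set (r := (1 + q) / 2).
    assert (Hr : q < r < 1) by (unfold r; lra).
    set (K := V + M * C / (r - q)).
    assert (HMC : 0 <= M * C) by (apply Rmult_le_pos; auto).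
    assert (HK : V <= K /\ M * C <= K * (r - q)).
    { unfold K. assert (0 <= M * C / (r - q)) by (apply Rdiv_le_0_compat; lra).
      split; [lra|]. rewrite Rmult_plus_distr_r.
      replace (M * C / (r - q) * (r - q)) with (M * C) by (field; lra).
      assert (0 <= V * (r - q)) by (apply Rmult_le_pos; lra). lra. }
    assert (Hrate : forall n y, Rabs (y - p) <= rho ->
      Rabs (Derive (transfer A psi F n) y - v y) <= K * r ^ n).
    { induction n as [|n IHn]; intros y Hy.
      - simpl. rewrite Derive_const. rewrite Rminus_0_l, Rabs_Ropp, Rmult_1_r.
        apply Rle_trans with V; [|lra]. apply HV. apply Rabs_le_between in Hy. lra.
      - assert (HJy : J y) by (apply ball_convex_J with rho; tauto).
        assert (HFy : Rabs (F y - p) <= rho) by (apply Rle_trans with (2 := Hy); auto).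
        rewrite Hder, Hv' by auto.
        unfold psi1, A1.
        match goal with |- Rabs ?X <= _ =>
          replace X with (Derive A y * (transfer A psi F n (F y) - u (F y))
            + A y * Derive F y * (Derive (transfer A psi F n) (F y) - v (F y)))
            by ring end.
        eapply Rle_trans; [apply Rabs_triang|]. rewrite !Rabs_mult.
        apply Rle_trans with (M * (C * q ^ n) + q * (K * r ^ n)).
        { apply Rplus_le_compat.
          - apply Rmult_le_compat; try apply Rabs_pos.
            + apply HM. apply Rabs_le_between in Hy. lra.
            + now apply HCr.
          - apply Rmult_le_compat; try apply Rabs_pos; auto.
            + rewrite <- Rabs_mult. apply Rabs_pos.
            + rewrite <- Rabs_mult. now apply HA1q. }
        assert (Hqr : q ^ n <= r ^ n) by (apply pow_incr; lra).
        assert (0 <= r ^ n) by (apply pow_le; lra).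
        apply Rle_trans with (M * C * r ^ n + q * (K * r ^ n)).
        { apply Rplus_le_compat_r. rewrite <- Rmult_assoc.
          apply Rmult_le_compat_l; auto. }
        replace (K * r ^ S n) with (K * (r - q) * r ^ n + q * (K * r ^ n))
          by (simpl; ring).
        apply Rplus_le_compat_r. apply Rmult_le_compat_r; lra. }
    set (D := fun y => p - rho < y < p + rho).
    assert (HD : forall y, D y -> Rabs (y - p) <= rho).
    { intros y Hy. unfold D in Hy. apply Rabs_le_between. lra. }
    assert (HDJ : forall y, D y -> J y) by (unfold D, J; intros; lra).
    destruct (CVU_dom_rate (fun n => transfer A psi F n) D u C q) as [_ HU1]; auto.
    destruct (CVU_dom_rate (fun n y => Derive (transfer A psi F n) y) D v K r)
      as [HL2 HU2]; auto; try lra.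
    assert (HDx : D x).
    { destruct Hrho as [Hr1 _]. apply Rabs_def2 in Hr1. unfold D. lra. }
    replace (v x) with (real (Lim_seq (fun n => Derive (transfer A psi F n) x))).
    2:{ rewrite (is_lim_seq_unique _ _ (HL2 x HDx)). reflexivity. }
    apply (CVU_Derive (fun n => transfer A psi F n) D); auto.
    + apply open_itv.
    + intros a b c Ha Hb Hc. unfold D in *. lra.
    + intros n y Hy. exists (Derive (transfer A psi F n) y).
      eapply Cn_derivable; [apply Htr|auto].
    + intros n y Hy. apply continuity_pt_filterlim.
      apply Cn_continuous with (s := k) (U := J); auto.
      apply Cn_Derive. apply Htr.
Qed.
End Transfer.

Lemma primitive_exists (J : R -> Prop) (v : R -> R) p :
  open J -> convex J -> J p -> (forall x, J x -> continuous v x) ->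
  exists P : R -> R, P p = 0 /\ forall x, J x -> is_derive P x (v x).
Proof.
  intros HJo HJc HJp Hv. exists (fun x => RInt v p x). split.
  - exact (RInt_point (V := R_CompleteNormedModule) p v).
  - intros x Hx. apply (is_derive_RInt (V := R_NormedModule) v _ p); auto.
    apply filter_imp with (2 := HJo x Hx). intros b Hb.
    apply (RInt_correct (V := R_CompleteNormedModule)).
    apply (ex_RInt_continuous (V := R_CompleteNormedModule)).
    intros z Hz. apply Hv.
    unfold Rmin, Rmax in Hz. destruct Rle_dec.
    + now apply HJc with p b.
    + now apply HJc with b p.
Qed.

(** Looking for the linearisation in the form [phi' = exp P] turns
    [phi o F = lam phi] into [P' = F''/F' + F' (P' o F)], an equation with
    contracting weight [F']. *)
Lemma linearize_local k F p eta q :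
  0 < eta -> q < 1 ->
  let J := fun x => p - eta < x < p + eta in
  Cn_on (S (S k)) J F -> F p = p -> (forall x, J x -> 0 < Derive F x <= q) ->
  exists phi : R -> R, Cn_on (S (S k)) J phi /\ phi p = 0 /\
    (forall x, J x -> 0 < Derive phi x) /\
    (forall x, J x -> J (F x) /\ phi (F x) = Derive F p * phi x).
Proof.
  intros Heta Hq J HF HFp HF'.
  assert (HJp : J p) by (unfold J; lra).
  assert (HJo : open J) by apply open_itv.
  assert (HJc : convex J) by (intros a b c; unfold J; lra).
  assert (Hq0 : 0 <= q < 1) by (specialize (HF' p HJp); lra).
  assert (HFd : forall x, J x -> is_derive F x (Derive F x)).
  { intros x Hx. eapply Cn_derivable; eauto. }
  assert (Hcontr : forall x, J x -> Rabs (F x - p) <= Rabs (x - p)).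
  { intros x Hx. rewrite <- HFp at 1.
    destruct (Rtotal_order x p) as [H|[H|H]].
    - destruct (MVT_on J F _ x p HJc HFd Hx HJp H) as [c [Hc E]].
      specialize (HF' c ltac:(apply HJc with x p; auto; lra)).
      rewrite Rabs_minus_sym, E, Rabs_mult, (Rabs_minus_sym x p).
      rewrite <- (Rmult_1_l (Rabs (p - x))) at 2.
      apply Rmult_le_compat_r; [apply Rabs_pos|]. rewrite Rabs_right; lra.
    - subst x. unfold Rminus. rewrite !Rplus_opp_r. lra.
    - destruct (MVT_on J F _ p x HJc HFd HJp Hx H) as [c [Hc E]].
      specialize (HF' c ltac:(apply HJc with p x; auto; lra)).
      rewrite E, Rabs_mult.
      rewrite <- (Rmult_1_l (Rabs (x - p))) at 2.
      apply Rmult_le_compat_r; [apply Rabs_pos|]. rewrite Rabs_right; lra. }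
  assert (HJF : forall x, J x -> J (F x)).
  { intros x Hx. exact (J_stable p eta F Hcontr x Hx). }
  assert (HF1 : Cn_on (S k) J (Derive F)) by (eapply Cn_Derive; eassumption).
  assert (HF2 : Cn_on k J (Derive (Derive F))) by (eapply Cn_Derive; eassumption).
  assert (HF0 : forall x, J x -> Derive F x <> 0) by (intros x Hx; specialize (HF' x Hx); lra).
  destruct (transfer_Cn p eta q F Heta Hq0 Hcontr k (Derive F)
             (fun x => Derive (Derive F) x / Derive F x)) as [Hv Hveq]; fold J.
  - eapply Cn_le; [|exact HF]. lia.
  - intros x Hx. specialize (HF' x Hx). rewrite Rabs_right; lra.
  - eapply Cn_le; [|exact HF1]. lia.
  - apply Cn_div; auto. eapply Cn_le; [|exact HF1]. lia.
  - intros x Hx. specialize (HF' x Hx). rewrite Rabs_right; lra.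
  - fold J in Hv, Hveq.
    match type of Hv with Cn_on _ _ ?w => set (v := w) in Hv end.
    assert (Hveq' : forall x, J x ->
      v x = Derive (Derive F) x / Derive F x + Derive F x * v (F x)) by exact Hveq.
    destruct (primitive_exists J v p HJo HJc HJp) as [P [HPp HP]].
    { intros x Hx. eapply Cn_continuous; eauto. }
    assert (HPC : Cn_on (S k) J P) by (apply Cn_of_derive with (h' := v); auto).
    assert (HeP : Cn_on (S k) J (fun x => exp (P x))) by now apply Cn_exp.
    destruct (primitive_exists J (fun x => exp (P x)) p HJo HJc HJp) as [phi [Hphp Hph]].
    { intros x Hx. eapply Cn_continuous; eauto. }
    assert (Hlog : forall x, J x -> P (F x) + ln (Derive F x) - P x = ln (Derive F p)).
    { intros x Hx.
      rewrite (constant_of_derive J (fun x => P (F x) + ln (Derive F x) - P x) x p); auto.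
      - rewrite HFp, HPp. ring.
      - intros t Ht. eapply is_derive_eq.
        + apply derive_minus; [|now apply HP].
          apply derive_plus.
          * apply (derive_comp P F); [apply HP; auto|auto].
          * apply (derive_comp ln (Derive F)).
            -- apply is_derive_ln. now apply HF'.
            -- eapply Cn_derivable; eauto.
        + rewrite (Hveq' t Ht). field. auto. }
    exists phi. split; [|split; [|split]]; auto.
    + apply Cn_of_derive with (h' := fun x => exp (P x)); auto.
    + intros x Hx. rewrite (is_derive_unique _ _ _ (Hph x Hx)). apply exp_pos.
    + intros x Hx. split; auto. apply Rminus_diag_uniq.
      rewrite (constant_of_derive J (fun x => phi (F x) - Derive F p * phi x) x p); auto.
      * rewrite HFp, Hphp. ring.
      * intros t Ht. eapply is_derive_eq.
        -- apply derive_minus.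
           ++ apply (derive_comp phi F); [apply Hph; auto|auto].
           ++ apply (is_derive_scal phi t (Derive F p)). now apply Hph.
        -- assert (E : P t = P (F t) + ln (Derive F t) - ln (Derive F p))
             by (specialize (Hlog t Ht); lra).
           rewrite E. unfold Rminus. rewrite !exp_plus, exp_Ropp, !exp_ln by now apply HF'.
           field. now apply HF0.
Qed.

Lemma global_diffeo_scal s lam :
  0 < lam -> global_diffeo s (fun y => lam * y) (fun y => / lam * y).
Proof.
  intros Hlam.
  assert (Hi : 0 < / lam) by now apply Rinv_0_lt_compat.
  assert (HD : forall c x, Derive (fun y => c * y) x = c).
  { intros c x. apply is_derive_unique. auto_derive; [exact I|ring]. }
  constructor.
  - apply Cn_scal; auto. now apply Cn_id.
  - apply Cn_scal; auto. now apply Cn_id.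
  - intros x. field. lra.
  - intros x. field. lra.
  - intros x. now rewrite HD.
  - intros x. now rewrite HD.
  - intros x y _ _ H. now apply Rmult_lt_compat_l.
  - intros x y _ _ H. now apply Rmult_lt_compat_l.
Qed.

Lemma iter_scal lam n y : Nat.iter n (fun y => lam * y) y = lam ^ n * y.
Proof. induction n as [|n IH]; simpl; [ring|]. rewrite IH. ring. Qed.

Lemma restrict_diffeo s (U : R -> Prop) F x y :
  open U -> convex U -> U x -> U y -> x < y -> Cn_on (S s) U F ->
  (forall t, U t -> 0 < Derive F t) ->
  diffeo_on (S s) (fun t => x < t < y) (fun v => F x < v < F y) F /\
  increasing_on U F.
Proof.
  intros HUo HUc Hx Hy Hxy HF HF'.
  assert (Hinc : increasing_on U F).
  { apply increasing_of_derive with (f' := Derive F); auto.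
    intros t Ht. eapply Cn_derivable; eauto. }
  assert (HU : forall t, x <= t <= y -> U t) by (intros t Ht; now apply HUc with x y).
  split; auto.
  destruct (choice_on (fun t => x < t < y) (fun v => F x < v < F y) F) as [K HK].
  { intros v Hv. destruct (IVT_on F x y v) as [t [Ht E]]; try lra.
    - intros t Ht. eapply Cn_continuous; eauto.
    - exists t. split; auto.
      split; apply Rnot_le_lt; intros Hle.
      + assert (t = x) by lra. subst t. lra.
      + assert (t = y) by lra. subst t. lra. }
  apply diffeo_of_increasing with (K := K); auto.
  - intros a b Ha Hb Hab. apply Hinc; auto; apply HU; lra.
  - eapply Cn_subset; [|exact HF]. intros t Ht. apply HU. lra.
  - intros t Ht. apply Rgt_not_eq, HF', HU. lra.
  - intros t Ht. split; apply Hinc; auto; try lra; apply HU; lra.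
Qed.

(** The local linearisation has range a neighbourhood of [0]; since every
    orbit of [y => lam y] enters it, the extension is onto the whole line. *)
Lemma linearize_basin k F K p (I : R -> Prop) :
  global_diffeo (S (S k)) F K -> F p = p -> Derive F p < 1 ->
  open I -> I p -> (forall x, I x -> I (K x)) ->
  (forall x, I x -> is_lim_seq (fun n => Nat.iter n F x) p) ->
  exists Phi : R -> R, diffeo_on (S (S k)) I whole Phi /\ increasing_on I Phi /\
    Phi p = 0 /\ (forall x, I x -> Phi (F x) = Derive F p * Phi x).
Proof.
  intros HF HFp Hlam HIo HIp HIK HIlim.
  set (lam := Derive F p) in *.
  assert (Hlam0 : 0 < lam) by apply HF.
  assert (HF'c : continuous (Derive F) p).
  { apply Cn_continuous with (s := S k) (U := whole); auto. apply Cn_Derive. apply HF. }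
  destruct (proj1 (continuous_eps _ _) HF'c ((1 - lam) / 2)) as [d1 [Hd1 Hd1']]; [lra|].
  destruct (open_eps I p HIo HIp) as [d2 [Hd2 Hd2']].
  set (eta := Rmin d1 d2).
  assert (Heta : 0 < eta /\ eta <= d1 /\ eta <= d2).
  { unfold eta. solve_min. }
  destruct (linearize_local k F p eta ((1 + lam) / 2)) as [phi [Hph1 [Hph2 [Hph3 Hph4]]]];
    auto; try lra.
  { apply Cn_subset with (U := whole); auto. apply HF. }
  { intros x Hx. split; [apply HF|].
    assert (Hb : Rabs (x - p) < d1) by (apply Rabs_def1; lra).
    specialize (Hd1' x Hb). fold lam in Hd1'. apply Rabs_def2 in Hd1'. lra. }
  fold lam in Hph4.
  set (J0 := fun x => p - eta < x < p + eta) in *.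
  set (J := fun x => p - eta / 2 < x < p + eta / 2).
  set (J' := fun y => phi (p - eta / 2) < y < phi (p + eta / 2)).
  assert (HJ0o : open J0) by apply open_itv.
  assert (HJ0c : convex J0) by (intros a b c; unfold J0; lra).
  assert (HJ0 : forall x, J x -> J0 x) by (unfold J, J0; intros; lra).
  destruct (restrict_diffeo (S k) J0 phi (p - eta / 2) (p + eta / 2)) as [Hdiff Hinc];
    auto; try (unfold J0; lra); try lra.
  fold J J' in Hdiff.
  assert (HJ'0 : phi (p - eta / 2) < 0 < phi (p + eta / 2)).
  { rewrite <- Hph2. split; apply Hinc; unfold J0; lra. }
  assert (HJF : forall x, J x -> J (F x)).
  { intros x Hx.
    assert (HJ0x := HJ0 x Hx). destruct (Hph4 x HJ0x) as [Hi E].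
    destruct Hdiff as [kk [Hk1 [Hk2 _]]].
    assert (HJ'x : J' (phi x)) by now apply Hk1.
    assert (HJ'F : J' (phi (F x))).
    { rewrite E. unfold J' in *. split; nra. }
    destruct (Hk2 _ HJ'F) as [H1 H2].
    assert (kk (phi (F x)) = F x).
    { destruct (Rtotal_order (kk (phi (F x))) (F x)) as [H|[H|H]]; auto;
        apply Hinc in H; auto; lra. }
    now rewrite <- H. }
  destruct (conj_extend (S (S k)) F K (fun y => lam * y) (fun y => / lam * y)
              I whole J J' phi) as [Phi [HP1 [HP2 [HP3 HP4]]]]; auto.
  - now apply global_diffeo_scal.
  - apply open_itv.
  - apply open_itv.
  - intros x Hx. apply Hd2'. unfold J in Hx. apply Rabs_def1; lra.
  - intros y Hy. unfold J' in *. split; nra.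
  - intros x Hx. apply lim_seq_enters with (p := p); auto; [apply open_itv|unfold J; lra].
  - intros y _. apply lim_seq_enters with (p := 0); [|apply open_itv|exact HJ'0].
    apply is_lim_seq_ext with (u := fun n => y * lam ^ n).
    + intros n. rewrite iter_scal. ring.
    + replace (Finite 0) with (Rbar_mult y 0) by (simpl; f_equal; ring).
      apply is_lim_seq_scal_l, is_lim_seq_geom. rewrite Rabs_right; lra.
  - intros x y Hx Hy H. apply Hinc; auto.
  - intros x Hx. now apply Hph4, HJ0.
  - exists Phi. split; [|split; [|split]]; auto.
    rewrite HP4; auto. unfold J; lra.
Qed.

(** Linearisations [Phi] and [Psi] with the same multiplier give the conjugacies
    [Psi^-1 (c Phi)]; the scaling [c > 0] is spent on sending [b] to [d]. *)
Lemma basin_conjugacy k F K G L p q (I I' : R -> Prop) b d :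
  global_diffeo (S (S k)) F K -> global_diffeo (S (S k)) G L ->
  F p = p -> G q = q -> Derive F p = Derive G q -> Derive F p < 1 ->
  open I -> open I' -> I p -> I' q ->
  (forall x, I x -> I (K x)) -> (forall x, I' x -> I' (L x)) ->
  (forall x, I x -> I (F x)) -> (forall x, I' x -> I' (G x)) ->
  (forall x, I x -> is_lim_seq (fun n => Nat.iter n F x) p) ->
  (forall x, I' x -> is_lim_seq (fun n => Nat.iter n G x) q) ->
  I b -> I' d -> (p < b /\ q < d) \/ (b < p /\ d < q) ->
  exists h : R -> R, diffeo_on (S (S k)) I I' h /\ increasing_on I h /\
    h p = q /\ h b = d /\ (forall x, I x -> h (F x) = G (h x)).
Proof.
  intros HF HG HFp HGq Hmul Hlam HIo HI'o HIp HI'q HIK HIL HIF HI'G HlF HlG HIb HId Hbd.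
  destruct (linearize_basin k F K p I) as [Phi [HP1 [HP2 [HP3 HP4]]]]; auto.
  destruct (linearize_basin k G L q I') as [Psi [HQ1 [HQ2 [HQ3 HQ4]]]]; auto.
  { now rewrite <- Hmul. }
  destruct HP1 as [Phi' [HPa [HPb [HPc HPd]]]].
  destruct HQ1 as [Psi' [HQa [HQb [HQc HQd]]]].
  assert (Hc : exists c, 0 < c /\ c * Phi b = Psi d).
  { exists (Psi d / Phi b).
    destruct Hbd as [[H1 H2]|[H1 H2]]; apply HP2 in H1; apply HQ2 in H2; auto;
      rewrite HP3 in H1; rewrite HQ3 in H2.
    - split; [apply Rdiv_lt_0_compat; lra|field; lra].
    - split; [|field; lra].
      replace (Psi d / Phi b) with (- Psi d / - Phi b) by (field; lra).
      apply Rdiv_lt_0_compat; lra. }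
  destruct Hc as [c [Hc0 Hcb]].
  assert (Hinc : increasing_on I (fun x => Psi' (c * Phi x))).
  { intros x y Hx Hy Hxy. apply HP2 in Hxy; auto.
    assert (Hlt : c * Phi x < c * Phi y) by now apply Rmult_lt_compat_l.
    destruct (HQb (c * Phi x) Logic.I) as [Ha1 Ha2]. destruct (HQb (c * Phi y) Logic.I) as [Hb1 Hb2].
    destruct (Rtotal_order (Psi' (c * Phi x)) (Psi' (c * Phi y))) as [H|[H|H]]; auto.
    - rewrite H in Ha2. lra.
    - apply HQ2 in H; auto. lra. }
  exists (fun x => Psi' (c * Phi x)). split; [|split; [|split; [|split]]]; auto.
  - exists (fun y => Phi' (/ c * Psi y)). split; [|split; [|split]].
    + intros x Hx. destruct (HQb (c * Phi x) Logic.I) as [H1 H2]. split; auto.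
      rewrite H2. replace (/ c * (c * Phi x)) with (Phi x) by (field; lra). now apply HPa.
    + intros y Hy. destruct (HPb (/ c * Psi y) Logic.I) as [H1 H2]. split; auto.
      rewrite H2. replace (c * (/ c * Psi y)) with (Psi y) by (field; lra). now apply HQa.
    + apply Cn_comp with (V := whole); auto. now apply Cn_scal.
    + apply Cn_comp with (V := whole); auto. now apply Cn_scal.
  - rewrite HP3, Rmult_0_r, <- HQ3. now apply HQa.
  - rewrite Hcb. now apply HQa.
  - intros x Hx. rewrite HP4 by auto.
    destruct (HQb (c * Phi x) Logic.I) as [H1 H2].
    replace (c * (Derive F p * Phi x)) with (Derive G q * (c * Phi x)) by (rewrite Hmul; ring).
    rewrite <- H2 at 1. rewrite <- HQ4 by auto. apply HQa. auto.
Qed.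

(** * Maps asymptotic to a translation *)

Definition half_line : R -> Prop := fun z => 0 < z.

Lemma open_half_line : open half_line.
Proof. exact (open_gt 0). Qed.
#[export] Hint Resolve open_half_line : core.

Lemma convex_half_line : convex half_line.
Proof. intros a b c; unfold half_line; lra. Qed.

(** A map with a parabolic fixed point, seen from one side of this point in the
    coordinate [z = 1 / x] that puts the point at infinity. *)
Record near_translation (A : R) (Z : R -> R) : Prop := {
  nt_A : 0 < A;
  nt_pos : forall z, 0 < z -> 0 < Z z;
  nt_onto : forall z, 0 < z -> exists w, 0 < w /\ Z w = z;
  nt_derive : forall z, 0 < z -> is_derive Z z (Derive Z z);
  nt_derive_pos : forall z, 0 < z -> 0 < Derive Z z;
  nt_derive_cont : forall z, 0 < z -> continuous (Derive Z) z;
  nt_up : forall z, 0 < z -> z < Z z;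
  nt_asym : exists C z0, 0 < C /\ 0 < z0 /\ forall z, z0 <= z ->
    Rabs (Z z - z - A) <= C / z /\ Rabs (Derive Z z - 1) <= C / z ^ 2 }.

Lemma ln_bound t : Rabs (t - 1) <= / 2 -> Rabs (ln t) <= 2 * Rabs (t - 1).
Proof.
  intros H. assert (Ht : / 2 <= t) by (apply Rabs_le_between in H; lra).
  assert (Hup : forall s, 0 < s -> ln s <= s - 1).
  { intros s Hs. pose proof (exp_ineq1_le (ln s)) as E. rewrite exp_ln in E; lra. }
  pose proof (Hup t ltac:(lra)) as H1.
  pose proof (Hup (/ t) ltac:(apply Rinv_0_lt_compat; lra)) as H2.
  rewrite ln_Rinv in H2 by lra.
  apply Rabs_le. pose proof (Rle_abs (t - 1)). pose proof (Rabs_maj2 (t - 1)).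
  pose proof (Rabs_pos (t - 1)).
  split; [|lra].
  assert (H5 : (1 - t) / t <= 2 * Rabs (t - 1)).
  { apply Rmult_le_reg_r with t; [lra|]. unfold Rdiv.
    rewrite Rmult_assoc, Rinv_l, Rmult_1_r by lra.
    assert (Rabs (t - 1) * 1 <= Rabs (t - 1) * (2 * t))
      by (apply Rmult_le_compat_l; lra).
    lra. }
  replace ((1 - t) / t) with (/ t - 1) in H5 by (field; lra). lra.
Qed.

Fixpoint birkhoff (psi Z : R -> R) (n : nat) (z : R) : R :=
  match n with
  | O => 0
  | S m => birkhoff psi Z m z + psi (Nat.iter m Z z)
  end.

Lemma birkhoff_S psi Z n z :
  birkhoff psi Z (S n) z = psi z + birkhoff psi Z n (Z z).
Proof.
  induction n as [|n IH]; [simpl; ring|].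
  change (birkhoff psi Z (S (S n)) z)
    with (birkhoff psi Z (S n) z + psi (Nat.iter (S n) Z z)).
  rewrite IH, iter_S_r. simpl. ring.
Qed.

Section NearTranslation.
Variables (A : R) (Z : R -> R).
Hypothesis HZ : near_translation A Z.

Lemma nt_increasing : increasing_on half_line Z.
Proof using HZ.
  apply increasing_of_derive with (f' := Derive Z).
  - apply convex_half_line.
  - apply HZ.
  - apply HZ.
Qed.

Lemma nt_iter_pos n z : 0 < z -> 0 < Nat.iter n Z z.
Proof using HZ. apply (iter_stable half_line). apply HZ. Qed.

Lemma nt_iter_mono n x y : 0 < x -> x <= y -> Nat.iter n Z x <= Nat.iter n Z y.
Proof using HZ.
  intros Hx Hxy. induction n as [|n IH]; simpl; auto.
  destruct IH as [IH|IH]; [|rewrite IH; lra].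
  left. apply nt_increasing; auto; apply nt_iter_pos; lra.
Qed.

Lemma nt_Z_cont z : 0 < z -> continuous Z z.
Proof using HZ.
  intros Hz. apply (ex_derive_continuous Z z). exists (Derive Z z). now apply HZ.
Qed.

Lemma nt_iter_cont n z : 0 < z -> continuous (Nat.iter n Z) z.
Proof using HZ.
  intros Hz. induction n as [|n IH]; simpl.
  - apply continuous_id.
  - apply (continuous_comp (Nat.iter n Z) Z); auto.
    apply nt_Z_cont, nt_iter_pos, Hz.
Qed.

Lemma nt_escape z B : 0 < z -> exists N, forall n, (N <= n)%nat -> B < Nat.iter n Z z.
Proof using HZ.
  intros Hz. apply NNPP. intros Hno.
  assert (Hinc : forall n, Nat.iter n Z z <= Nat.iter (S n) Z z).
  { intros n. left. apply (nt_up _ _ HZ). now apply nt_iter_pos. }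
  assert (Hmono : forall k n, Nat.iter n Z z <= Nat.iter (k + n) Z z).
  { induction k as [|k IH]; intros n; [simpl; lra|].
    eapply Rle_trans; [apply IH|apply Hinc]. }
  assert (HB : forall n, Nat.iter n Z z <= B).
  { intros n. apply Rnot_lt_le. intros Hn. apply Hno. exists n. intros m Hm.
    replace m with ((m - n) + n)%nat by lia. apply Rlt_le_trans with (1 := Hn), Hmono. }
  destruct (ex_finite_lim_seq_incr _ B Hinc HB) as [q Hq].
  assert (Hzq : z <= q).
  { apply (is_lim_seq_le (fun _ => z) (fun n => Nat.iter n Z z) z q); auto.
    - intros n. rewrite <- (Nat.add_0_r n). exact (Hmono n 0%nat).
    - apply is_lim_seq_const. }
  assert (H1 : is_lim_seq (fun n => Nat.iter (S n) Z z) q)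
    by (apply (is_lim_seq_incr_1 (fun n => Nat.iter n Z z)); exact Hq).
  assert (H2 : is_lim_seq (fun n => Nat.iter (S n) Z z) (Z q)).
  { simpl. apply is_lim_seq_continuous; auto.
    apply continuity_pt_filterlim, nt_Z_cont. lra. }
  apply is_lim_seq_unique in H1. apply is_lim_seq_unique in H2.
  rewrite H1 in H2. injection H2 as H2.
  pose proof (nt_up _ _ HZ q ltac:(lra)). lra.
Qed.

(** The bound telescopes along orbits, so that the sums of [ln Z'] converge. *)
Lemma nt_log_bound : exists B z1, 0 < B /\ 0 < z1 /\ forall z, z1 <= z ->
  Rabs (ln (Derive Z z)) <= B * (/ z - / Z z).
Proof using HZ.
  destruct (nt_asym _ _ HZ) as [C [z0 [HC [Hz0 H]]]].
  pose proof (nt_A _ _ HZ) as HA.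
  set (z1 := z0 + 2 * C / A + 2 * C + 2 * A + 1).
  assert (HCA : 0 < C / A) by (apply Rdiv_lt_0_compat; lra).
  exists (8 * C / A), z1. split; [|split].
  - apply Rdiv_lt_0_compat; lra.
  - unfold z1, Rdiv in *; lra.
  - intros z Hz.
    assert (Hz1 : z0 <= z /\ 2 * C / A <= z /\ 2 * C <= z /\ 2 * A <= z /\ 1 <= z).
    { unfold z1, Rdiv in *; lra. }
    destruct (H z ltac:(lra)) as [H1 H2].
    assert (HCz : C / z <= A / 2).
    { apply Rmult_le_reg_r with (z * (2 / A)).
      - apply Rmult_lt_0_compat; [lra|]. apply Rdiv_lt_0_compat; lra.
      - replace (C / z * (z * (2 / A))) with (2 * C / A) by (field; lra).
        replace (A / 2 * (z * (2 / A))) with z by (field; lra). lra. }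
    apply Rabs_le_between in H1.
    assert (HZ1 : z + A / 2 <= Z z <= 2 * z) by lra.
    assert (HCz2 : C / z ^ 2 <= / 2).
    { apply Rmult_le_reg_r with (z ^ 2); [apply pow_lt; lra|].
      replace (C / z ^ 2 * z ^ 2) with C by (field; lra). nra. }
    apply Rle_trans with (1 := ln_bound (Derive Z z) ltac:(lra)).
    apply Rle_trans with (2 * (C / z ^ 2)); [lra|].
    apply Rle_trans with (8 * C / A * ((A / 2) * / (z * (2 * z)))).
    { right. field. lra. }
    apply Rmult_le_compat_l.
    { apply Rlt_le, Rdiv_lt_0_compat; lra. }
    replace (/ z - / Z z) with ((Z z - z) * / (z * Z z)) by (field; lra).
    apply Rmult_le_compat; try lra.
    + apply Rlt_le, Rinv_0_lt_compat. apply Rmult_lt_0_compat; lra.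
    + apply Rinv_le_contravar; [apply Rmult_lt_0_compat; lra|].
      apply Rmult_le_compat_l; lra.
Qed.

(** [u = sum_n ln Z' (Z^n z)] is the logarithm of an invariant density.  The
    telescoping bound makes the tail of the sum after [n] steps at most
    [B / Z^n z], uniformly on half-lines. *)
Lemma nt_density : exists u : R -> R,
  (forall z, 0 < z -> continuous u z) /\
  (forall z, 0 < z -> u z = ln (Derive Z z) + u (Z z)) /\
  (exists B z1, 0 < z1 /\ forall z, z1 <= z -> Rabs (u z) <= B / z).
Proof using HZ.
  destruct nt_log_bound as [B [z1 [HB [Hz1 Hlog]]]].
  set (psi := fun z => ln (Derive Z z)) in *.
  set (s := birkhoff psi Z).
  set (u := fun z => real (Lim_seq (fun n => s n z))).
  assert (Htail : forall n m z, 0 < z -> (forall k, (n <= k)%nat -> z1 <= Nat.iter k Z z) ->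
    Rabs (s (n + m)%nat z - s n z) <= B * (/ Nat.iter n Z z - / Nat.iter (n + m) Z z)).
  { intros n m z Hz Hk. induction m as [|m IH].
    - rewrite Nat.add_0_r. unfold Rminus. rewrite !Rplus_opp_r, Rabs_R0. lra.
    - rewrite Nat.add_succ_r. unfold s in *. simpl.
      replace (birkhoff psi Z (n + m) z + psi (Nat.iter (n + m) Z z) - birkhoff psi Z n z)
        with ((birkhoff psi Z (n + m) z - birkhoff psi Z n z) + psi (Nat.iter (n + m) Z z))
        by ring.
      eapply Rle_trans; [apply Rabs_triang|].
      pose proof (Hlog (Nat.iter (n + m) Z z) (Hk (n + m)%nat ltac:(lia))) as Hl.
      unfold psi in *. lra. }
  assert (Hlim : forall z, 0 < z -> is_lim_seq (fun n => s n z) (u z) /\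
    forall n, (forall k, (n <= k)%nat -> z1 <= Nat.iter k Z z) ->
      Rabs (u z - s n z) <= B / Nat.iter n Z z).
  { intros z Hz.
    assert (Htail' : forall n m, (forall k, (n <= k)%nat -> z1 <= Nat.iter k Z z) ->
      Rabs (s (n + m)%nat z - s n z) <= B / Nat.iter n Z z).
    { intros n m Hk. eapply Rle_trans; [now apply Htail|].
      pose proof (Rinv_0_lt_compat _ (nt_iter_pos (n + m) z Hz)).
      unfold Rdiv. apply Rmult_le_compat_l; lra. }
    assert (Hex : ex_finite_lim_seq (fun n => s n z)).
    { apply ex_lim_seq_cauchy_corr. intros eps.
      destruct (nt_escape z (z1 + 2 * B / eps) Hz) as [N HN].
      assert (HBe : 0 < 2 * B / eps)
        by (apply Rdiv_lt_0_compat; [lra|apply cond_pos]).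
      assert (HkN : forall k, (N <= k)%nat -> z1 <= Nat.iter k Z z).
      { intros k Hk. specialize (HN k Hk). lra. }
      assert (HNe : B / Nat.iter N Z z < eps / 2).
      { pose proof (HN N (le_n N)). pose proof (nt_iter_pos N z Hz).
        pose proof (cond_pos eps).
        apply Rmult_lt_reg_r with (Nat.iter N Z z); [lra|].
        unfold Rdiv. rewrite Rmult_assoc, Rinv_l, Rmult_1_r by lra.
        apply Rmult_lt_reg_l with (2 / eps); [apply Rdiv_lt_0_compat; lra|].
        replace (2 / eps * (eps * / 2 * Nat.iter N Z z)) with (Nat.iter N Z z) by (field; lra).
        replace (2 / eps * B) with (2 * B / eps) by (field; lra). lra. }
      exists N. intros n m Hn Hm.
      pose proof (Htail' N (n - N)%nat HkN) as H1.
      pose proof (Htail' N (m - N)%nat HkN) as H2.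
      replace (N + (n - N))%nat with n in H1 by lia.
      replace (N + (m - N))%nat with m in H2 by lia.
      replace (s n z - s m z) with ((s n z - s N z) - (s m z - s N z)) by ring.
      eapply Rle_lt_trans; [apply Rabs_triang|]. rewrite Rabs_Ropp. lra. }
    apply Lim_seq_correct' in Hex. split; [exact Hex|].
    intros n Hk.
    assert (Hl : is_lim_seq (fun m => Rabs (s (n + m)%nat z - s n z))
                   (Rabs (u z - s n z))).
    { apply (is_lim_seq_abs _ (Finite _)).
      apply (is_lim_seq_minus' _ (fun _ => s n z)); [|apply is_lim_seq_const].
      apply is_lim_seq_ext with (u := fun m => s (m + n)%nat z).
      - intros m. f_equal. lia.
      - now apply (is_lim_seq_incr_n (fun n => s n z)). }
    exact (is_lim_seq_le _ (fun _ => B / Nat.iter n Z z) _ (Finite _)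
      (fun m => Htail' n m Hk) Hl (is_lim_seq_const _)). }
  exists u. split; [|split].
  - intros z Hz. apply continuity_pt_filterlim.
    apply CVU_cont_open with (D := fun y => z / 2 < y).
    + apply open_gt.
    + intros eps.
      destruct (nt_escape (z / 2) (z1 + B / eps) ltac:(lra)) as [N HN].
      assert (HBe : 0 < B / eps)
        by (apply Rdiv_lt_0_compat; [lra|apply cond_pos]).
      exists N. intros n Hn y Hy. change (real (Lim_seq (fun n => s n y))) with (u y).
      assert (Hge : forall k, (N <= k)%nat -> z1 + B / eps < Nat.iter k Z y).
      { intros k Hk. specialize (HN k Hk).
        pose proof (nt_iter_mono k (z / 2) y ltac:(lra) ltac:(lra)). lra. }
      rewrite Rabs_minus_sym.
      eapply Rle_lt_trans.
      * apply (proj2 (Hlim y ltac:(lra)) n). intros k Hk.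
        specialize (Hge k ltac:(lia)). lra.
      * pose proof (Hge n Hn). pose proof (cond_pos eps).
        pose proof (nt_iter_pos n y ltac:(lra)).
        apply Rmult_lt_reg_r with (Nat.iter n Z y); [lra|].
        unfold Rdiv. rewrite Rmult_assoc, Rinv_l, Rmult_1_r by lra.
        apply Rmult_lt_reg_l with (/ eps); [apply Rinv_0_lt_compat; lra|].
        replace (/ eps * (eps * Nat.iter n Z y)) with (Nat.iter n Z y) by (field; lra).
        unfold Rdiv in *. lra.
    + intros n. unfold s. induction n as [|n IHn]; intros y Hy; simpl.
      { apply continuity_pt_const. intros ? ?; reflexivity. }
      apply continuity_pt_plus; [now apply IHn|].
      assert (Hy0 : 0 < y) by lra.
      apply (continuity_pt_comp (Nat.iter n Z) psi).
      { apply continuity_pt_filterlim. now apply nt_iter_cont. }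
      pose proof (nt_iter_pos n y Hy0) as Hp.
      apply (continuity_pt_comp (Derive Z) ln).
      * apply continuity_pt_filterlim. now apply (nt_derive_cont _ _ HZ).
      * apply continuity_pt_filterlim.
        apply (ex_derive_continuous ln). eexists. apply is_derive_ln.
        now apply (nt_derive_pos _ _ HZ).
    + lra.
  - intros z Hz. pose proof (nt_pos _ _ HZ z Hz) as HZz.
    assert (H1 : is_lim_seq (fun n => s (S n) z) (u z))
      by (apply (is_lim_seq_incr_1 (fun n => s n z)); now apply Hlim).
    assert (H2 : is_lim_seq (fun n => s (S n) z) (psi z + u (Z z))).
    { apply is_lim_seq_ext with (u := fun n => psi z + s n (Z z)).
      - intros n. symmetry. apply birkhoff_S.
      - apply (is_lim_seq_plus' (fun _ => psi z)); [apply is_lim_seq_const|].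
        now apply Hlim. }
    apply is_lim_seq_unique in H1. apply is_lim_seq_unique in H2.
    rewrite H1 in H2. now injection H2.
  - exists B, z1. split; auto. intros z Hz.
    replace (u z) with (u z - s 0%nat z) by (unfold s; simpl; ring).
    apply (proj2 (Hlim z ltac:(lra)) 0%nat). intros k _.
    induction k as [|k IH]; simpl; auto.
    pose proof (nt_up _ _ HZ (Nat.iter k Z z) ltac:(lra)). lra.
Qed.

(** For [Phi' = exp u / A] the difference [Phi o Z - Phi] has derivative [0]; its
    value is [1] because, far out, [Phi'] is close to [1 / A] while [Z] moves
    points by nearly [A]. *)
Lemma nt_abel : exists Phi Phi' : R -> R,
  (forall z, 0 < z -> is_derive Phi z (Phi' z)) /\
  (forall z, 0 < z -> 0 < Phi' z) /\
  (forall z, 0 < z -> continuous Phi' z) /\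
  (forall z, 0 < z -> Phi (Z z) = Phi z + 1) /\
  (forall eps, 0 < eps -> exists z1, 0 < z1 /\ forall z, z1 <= z ->
     Rabs (Phi' z - / A) < eps) /\
  (forall y, exists z, 0 < z /\ Phi z = y).
Proof using HZ.
  destruct nt_density as [u [Hu1 [Hu2 [B [z1 [Hz1 Hu3]]]]]].
  pose proof (nt_A _ _ HZ) as HA.
  set (Phi' := fun z => / A * exp (u z)).
  assert (HPc : forall z, 0 < z -> continuous Phi' z).
  { intros z Hz. apply (continuous_scal_r (V := R_NormedModule) (/ A) (fun z => exp (u z))).
    apply (continuous_comp u exp); [now apply Hu1|apply continuous_exp]. }
  assert (HPp : forall z, 0 < z -> 0 < Phi' z).
  { intros z Hz. apply Rmult_lt_0_compat; [now apply Rinv_0_lt_compat|apply exp_pos]. }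
  destruct (primitive_exists half_line Phi' 1) as [Phi [_ HPd]]; auto.
  { apply convex_half_line. }
  { unfold half_line; lra. }
  assert (Hlim : forall eps, 0 < eps -> exists z1, 0 < z1 /\ forall z, z1 <= z ->
     Rabs (Phi' z - / A) < eps).
  { intros eps He.
    destruct (proj1 (continuous_eps exp 0) (continuous_exp 0) (eps * A)) as [d [Hd Hd']].
    { now apply Rmult_lt_0_compat. }
    assert (HBd : 0 <= Rabs B / d) by (apply Rdiv_le_0_compat; [apply Rabs_pos|lra]).
    exists (z1 + Rabs B / d + 1). split; [lra|]. intros z Hz.
    unfold Phi'. replace (/ A * exp (u z) - / A) with (/ A * (exp (u z) - exp 0))
      by (rewrite exp_0; ring).
    rewrite Rabs_mult, Rabs_inv, (Rabs_right A) by lra.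
    apply Rmult_lt_reg_l with A; [lra|].
    rewrite <- Rmult_assoc, Rinv_r, Rmult_1_l, (Rmult_comm A) by lra.
    apply Hd'. rewrite Rminus_0_r.
    apply Rle_lt_trans with (1 := Hu3 z ltac:(lra)).
    apply Rmult_lt_reg_r with z; [lra|].
    unfold Rdiv. rewrite Rmult_assoc, Rinv_l, Rmult_1_r by lra.
    apply Rle_lt_trans with (1 := Rle_abs B).
    apply Rmult_lt_reg_l with (/ d); [now apply Rinv_0_lt_compat|].
    rewrite <- Rmult_assoc, Rinv_l, Rmult_1_l by lra. unfold Rdiv in *. lra. }
  assert (HZd : forall z, 0 < z -> is_derive (fun z => Phi (Z z) - Phi z) z 0).
  { intros z Hz. eapply is_derive_eq.
    - apply derive_minus; [|now apply HPd].
      apply (derive_comp Phi Z); [apply HPd; now apply HZ|now apply HZ].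
    - unfold Phi'.
      rewrite (Hu2 z Hz), exp_plus, exp_ln by now apply HZ. ring. }
  assert (Hone : forall z, 0 < z -> Phi (Z z) = Phi z + 1).
  { intros z Hz.
    assert (Heps : forall eps, 0 < eps < 1 -> Rabs (Phi (Z z) - Phi z - 1) <= eps * (A + / A + 1)).
    { intros eps He.
      destruct (Hlim eps (proj1 He)) as [z2 [Hz2 H2]].
      destruct (nt_asym _ _ HZ) as [C [z0 [HC [Hz0 H]]]].
      assert (HCe : 0 < C / eps) by (apply Rdiv_lt_0_compat; lra).
      set (w := z0 + z2 + C / eps).
      assert (Hw : 0 < w) by (unfold w; lra).
      replace (Phi (Z z) - Phi z) with (Phi (Z w) - Phi w).
      2:{ apply (constant_of_derive half_line (fun z => Phi (Z z) - Phi z)); auto.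
          apply convex_half_line. }
      destruct (MVT_on half_line Phi Phi' w (Z w)) as [c [Hc E]]; auto.
      - apply convex_half_line.
      - now apply HZ.
      - now apply HZ.
      - rewrite E.
        assert (H3 : Rabs (Z w - w - A) <= eps).
        { apply Rle_trans with (1 := proj1 (H w ltac:(unfold w; lra))).
          apply Rmult_le_reg_r with w; [lra|].
          unfold Rdiv. rewrite Rmult_assoc, Rinv_l, Rmult_1_r by lra.
          apply Rmult_le_reg_l with (/ eps); [apply Rinv_0_lt_compat; lra|].
          rewrite <- Rmult_assoc, Rinv_l, Rmult_1_l by lra.
          unfold w, Rdiv in *. lra. }
        assert (H4 : Rabs (Phi' c - / A) < eps) by (apply H2; unfold w in *; lra).
        replace (Phi' c * (Z w - w) - 1)
          with ((Phi' c - / A) * A + ((Phi' c - / A) + / A) * (Z w - w - A)) by (field; lra).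
        assert (HiA : 0 < / A) by now apply Rinv_0_lt_compat.
        eapply Rle_trans; [apply Rabs_triang|]. rewrite !Rabs_mult, (Rabs_right A) by lra.
        replace (eps * (A + / A + 1)) with (eps * A + (1 + / A) * eps) by ring.
        apply Rplus_le_compat; [apply Rmult_le_compat_r; lra|].
        apply Rmult_le_compat; try apply Rabs_pos; auto.
        eapply Rle_trans; [apply Rabs_triang|]. rewrite (Rabs_right (/ A)); lra. }
    assert (HK : 0 < A + / A + 1) by (pose proof (Rinv_0_lt_compat A HA); lra).
    assert (H0 : Rabs (Phi (Z z) - Phi z - 1) = 0).
    { apply Rle_antisym; [|apply Rabs_pos]. apply Rnot_lt_le. intros Hlt.
      set (k := A + / A + 1) in *.
      set (x := Rabs (Phi (Z z) - Phi z - 1)) in *.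
      set (eps := Rmin (/ 2) (x / (2 * k))).
      assert (Hx : 0 < x / (2 * k)) by (apply Rdiv_lt_0_compat; lra).
      assert (He : 0 < eps < 1 /\ eps <= x / (2 * k)).
      { unfold eps. solve_min. }
      pose proof (Heps eps (proj1 He)) as H1.
      assert (eps * k <= x / 2).
      { replace (x / 2) with (x / (2 * k) * k) by (field; lra).
        apply Rmult_le_compat_r; lra. }
      lra. }
    apply Rabs_eq_0 in H0. lra. }
  exists Phi, Phi'. repeat (split; [assumption|]).
  assert (Hn : forall n, exists z, 0 < z /\ Phi z = Phi 1 - INR n).
  { induction n as [|n [z [Hz E]]].
    - exists 1. split; [lra|]. simpl. ring.
    - destruct (nt_onto _ _ HZ z Hz) as [w [Hw Ew]]. exists w. split; auto.
      pose proof (Hone w Hw). rewrite Ew in H. rewrite S_INR. lra. }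
  assert (Hp : forall n, exists z, 0 < z /\ Phi z = Phi 1 + INR n).
  { induction n as [|n [z [Hz E]]].
    - exists 1. split; [lra|]. simpl. ring.
    - exists (Z z). split; [now apply HZ|]. rewrite Hone by auto. rewrite S_INR. lra. }
  intros y.
  destruct (INR_unbounded (Rabs (y - Phi 1))) as [n Hny].
  apply Rgt_lt, Rabs_def2 in Hny.
  destruct (Hn n) as [x1 [Hx1 E1]]. destruct (Hp n) as [x2 [Hx2 E2]].
  assert (Hx12 : x1 <= x2).
  { apply Rnot_lt_le. intros Hlt.
    assert (Phi x2 < Phi x1).
    { apply (increasing_of_derive half_line Phi Phi'); auto. apply convex_half_line. }
    lra. }
  destruct (IVT_on Phi x1 x2 y Hx12) as [t [Ht Et]].
  - intros t Ht. apply (ex_derive_continuous Phi t). exists (Phi' t). apply HPd.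
    unfold half_line; lra.
  - lra.
  - exists t. split; [lra|exact Et].
Qed.
End NearTranslation.

(** Abel functions [P] and [Q] give the conjugacies [Q^-1 (P + c)].  The constant
    [c] is spent on [H b = d]; the derivative at infinity does not depend on it. *)
Lemma nt_conjugacy A1 A2 (Z1 Z2 : R -> R) b d :
  near_translation A1 Z1 -> near_translation A2 Z2 -> 0 < b -> 0 < d ->
  exists H H' : R -> R,
    (forall z, 0 < z -> 0 < H z) /\
    (forall z, 0 < z -> is_derive H z (H' z)) /\
    (forall z, 0 < z -> 0 < H' z) /\
    (forall z, 0 < z -> continuous H' z) /\
    (forall y, 0 < y -> exists z, 0 < z /\ H z = y) /\
    H b = d /\ (forall z, 0 < z -> H (Z1 z) = Z2 (H z)) /\
    (forall eps, 0 < eps -> exists z1, 0 < z1 /\ forall z, z1 <= z ->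
       Rabs (H' z - A2 / A1) < eps).
Proof.
  intros HZ1 HZ2 Hb Hd.
  destruct (nt_abel _ _ HZ1) as [P [P' [HPd [HPp [HPc [HP1 [HPl HPs]]]]]]].
  destruct (nt_abel _ _ HZ2) as [Q [Q' [HQd [HQp [HQc [HQ1 [HQl HQs]]]]]]].
  pose proof (nt_A _ _ HZ1) as HA1. pose proof (nt_A _ _ HZ2) as HA2.
  assert (HPi : increasing_on half_line P)
    by (apply (increasing_of_derive half_line P P'); auto; apply convex_half_line).
  assert (HQi : increasing_on half_line Q)
    by (apply (increasing_of_derive half_line Q Q'); auto; apply convex_half_line).
  destruct (choice_on half_line whole Q) as [K HK]; [intros y _; apply HQs|].
  assert (HKQ : forall z, 0 < z -> K (Q z) = z).
  { intros z Hz. destruct (HK (Q z) Logic.I) as [H1 H2].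
    destruct (Rtotal_order (K (Q z)) z) as [H|[H|H]]; auto; apply HQi in H; auto; lra. }
  assert (HKc : forall y, continuous K y).
  { intros y. apply increasing_inv_continuous with (U := half_line) (V := whole) (F := Q); auto. }
  assert (HKd : forall y, is_derive K y (/ Q' (K y))).
  { intros y. destruct (HK y Logic.I) as [H1 H2].
    apply is_derive_inverse with (V := whole) (F := Q); auto.
    - intros z _. now apply HK.
    - apply Rgt_not_eq. now apply HQp. }
  set (c := Q d - P b).
  assert (HPcont : forall z, 0 < z -> continuous P z).
  { intros z Hz. apply (ex_derive_continuous P z). exists (P' z). auto. }
  set (H := fun z => K (P z + c)).
  assert (HHp : forall z, 0 < H z /\ Q (H z) = P z + c).
  { intros z. now apply HK. }
  assert (HHc : forall z, 0 < z -> continuous H z).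
  { intros z Hz. apply (continuous_comp (fun z => P z + c) K); auto.
    apply cont_plus; auto. apply continuous_const. }
  exists H, (fun z => P' z / Q' (H z)).
  split; [|split; [|split; [|split; [|split; [|split; [|split]]]]]].
  - intros z _. apply HHp.
  - intros z Hz. eapply is_derive_eq.
    + apply (derive_comp K (fun z => P z + c)); [apply HKd|].
      apply derive_plus; [now apply HPd|].
      apply derive_const.
    + fold (H z).
      field. apply Rgt_not_eq, HQp, HHp.
  - intros z Hz. apply Rdiv_lt_0_compat; auto. apply HQp, HHp.
  - intros z Hz.
    apply (cont_mult P' (fun z => / Q' (H z))); auto.
    apply continuity_pt_filterlim, (continuity_pt_inv (fun z => Q' (H z))).
    + apply continuity_pt_filterlim. apply (continuous_comp H Q'); auto.
      apply HQc, HHp.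
    + apply Rgt_not_eq, HQp, HHp.
  - intros y Hy. destruct (HPs (Q y - c)) as [z [Hz E]]. exists z. split; auto.
    unfold H. rewrite E. replace (Q y - c + c) with (Q y) by ring. auto.
  - unfold H, c. replace (P b + (Q d - P b)) with (Q d) by ring. auto.
  - intros z Hz. unfold H at 1. rewrite HP1 by auto.
    replace (P z + 1 + c) with (Q (H z) + 1) by (rewrite (proj2 (HHp z)); ring).
    rewrite <- HQ1 by apply HHp. apply HKQ. apply HZ2, HHp.
  - intros eps He.
    assert (Hcont : exists dl, 0 < dl /\ forall x y, Rabs (x - / A1) < dl ->
      Rabs (y - / A2) < dl -> Rabs (x / y - A2 / A1) < eps).
    { assert (Hl : filterlim (fun w : R * R => fst w / snd w)
        (filter_prod (locally (/ A1)) (locally (/ A2))) (locally (/ A1 / / A2))).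
      { apply (filterlim_comp_2 (G := locally (/ A1)) (H := locally (/ / A2))
          (fun w => fst w) (fun w => / snd w) Rmult).
        - apply filterlim_fst.
        - eapply filterlim_comp; [apply filterlim_snd|].
          apply (continuous_Rinv (/ A2)).
          apply Rgt_not_eq. now apply Rinv_0_lt_compat.
        - apply (filterlim_mult (K := R_AbsRing) (/ A1) (/ / A2)). }
      replace (/ A1 / / A2) with (A2 / A1) in Hl by (field; lra).
      destruct (proj1 (filterlim_locally _ _) Hl (mkposreal eps He))
        as [S1 S2 [d1 Hd1] [d2 Hd2] HS].
      exists (Rmin d1 d2). split; [apply Rmin_pos; apply cond_pos|].
      intros x y Hx Hy. apply HS.
      - apply Hd1. eapply Rlt_le_trans; [exact Hx|apply Rmin_l].
      - apply Hd2. eapply Rlt_le_trans; [exact Hy|apply Rmin_r]. }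
    destruct Hcont as [dl [Hdl Hcont]].
    destruct (HPl dl Hdl) as [z1 [Hz1 Hz1']]. destruct (HQl dl Hdl) as [z2 [Hz2 Hz2']].
    destruct (HPs (Q z2 - c)) as [z3 [Hz3 Ez3]].
    exists (z1 + z3). split; [lra|]. intros z Hz. apply Hcont.
    + apply Hz1'. lra.
    + apply Hz2'. apply Rnot_lt_le. intros Hlt.
      apply HQi in Hlt; auto; [|apply HHp].
      rewrite (proj2 (HHp z)) in Hlt.
      assert (P z3 < P z) by (apply HPi; unfold half_line; lra). lra.
Qed.

(** * Conjugacy at a parabolic fixed point *)

Definition quadratic_contact (al : R) (F : R -> R) : Prop :=
  0 < al /\ exists C eta, 0 < eta /\ 0 <= C /\ forall x, Rabs x < eta ->
    Rabs (F x - x + al * x ^ 2) <= C * Rabs x ^ 3 /\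
    Rabs (Derive F x - 1 + 2 * al * x) <= C * Rabs x ^ 2.

Lemma gd_derive s F K x : global_diffeo (S s) F K -> is_derive F x (Derive F x).
Proof. intros H. apply Cn_derivable with (s := s) (U := whole); auto. apply H. Qed.

Lemma gd_cont s F K x : global_diffeo s F K -> continuous F x.
Proof. intros H. apply Cn_continuous with (s := s) (U := whole); auto. apply H. Qed.

Lemma gd_inverse_derive s F K y :
  global_diffeo (S s) F K -> Derive K y = / Derive F (K y).
Proof.
  intros H. apply is_derive_unique.
  apply is_derive_inverse with (V := whole) (F := F); auto.
  - intros z _. apply H.
  - apply (gd_cont _ _ _ y (global_diffeo_sym _ _ _ H)).
  - eapply gd_derive; eassumption.
  - apply Rgt_not_eq, H.
Qed.

Lemma Derive_reflect s K x :
  Cn_on (S s) whole K -> is_derive (fun x => - K (- x)) x (Derive K (- x)).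
Proof.
  intros H. eapply is_derive_eq.
  - apply (derive_opp (fun x => K (- x))).
    apply (derive_comp K (fun x => - x)).
    + eapply Cn_derivable; [exact H|exact Logic.I].
    + apply (derive_opp (fun x => x)).
      apply derive_id.
  - ring.
Qed.

Lemma Derive_reflect_eq s K (x : R) :
  Cn_on (S s) whole K -> Derive (fun x => - K (- x)) x = Derive K (- x).
Proof. intros H. exact (is_derive_unique _ _ _ (Derive_reflect s K x H)). Qed.

Lemma global_diffeo_reflect s F K :
  global_diffeo (S s) F K ->
  global_diffeo (S s) (fun x => - K (- x)) (fun x => - F (- x)).
Proof.
  intros [H1 H2 H3 H4 H5 H6 H7 H8].
  assert (HC : forall G, Cn_on (S s) whole G -> Cn_on (S s) whole (fun x => - G (- x))).
  { intros G HG. apply Cn_opp; auto.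
    apply (Cn_comp (S s) whole whole (fun x => - x) G); auto.
    apply Cn_opp; auto. now apply Cn_id. }
  constructor; auto.
  - intros x. now rewrite Ropp_involutive, H4, Ropp_involutive.
  - intros x. now rewrite Ropp_involutive, H3, Ropp_involutive.
  - intros x. now rewrite (Derive_reflect_eq s).
  - intros x. now rewrite (Derive_reflect_eq s).
  - intros x y _ _ H. apply Ropp_lt_contravar. apply H8; auto with real.
  - intros x y _ _ H. apply Ropp_lt_contravar. apply H7; auto with real.
Qed.

(** [F^-1 x = x + al x^2 + O(x^3)], so that reflecting the inverse turns the
    repelling side of [0] into an attracting side with the same [al]. *)
Lemma quadratic_contact_reflect s F K al :
  global_diffeo (S s) F K -> F 0 = 0 -> quadratic_contact al F ->
  quadratic_contact al (fun x => - K (- x)).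
Proof.
  intros HF HF0 [Hal [C [eta [Heta [HC H]]]]]. split; auto.
  pose proof (global_diffeo_sym _ _ _ HF) as HK.
  assert (HK0 : K 0 = 0) by (rewrite <- HF0 at 1; apply HF).
  set (E := al + C).
  set (e := Rmin (Rmin eta 1) (/ (8 * (E + 1)))).
  assert (HE : 0 < E) by (unfold E; lra).
  assert (He : 0 < e /\ e <= eta /\ e <= 1 /\ e * (E + 1) <= / 8).
  { assert (Hi : 0 < / (8 * (E + 1))) by (apply Rinv_0_lt_compat; lra).
    unfold e. split; [repeat apply Rmin_pos; lra|].
    split; [eapply Rle_trans; apply Rmin_l|].
    split; [eapply Rle_trans; [apply Rmin_l|apply Rmin_r]|].
    replace (/ 8) with (/ (8 * (E + 1)) * (E + 1)) by (field; lra).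
    apply Rmult_le_compat_r; [lra|apply Rmin_r]. }
  destruct (proj1 (continuous_eps K 0) (gd_cont _ _ _ 0 HK) e ltac:(lra)) as [d [Hd Hd']].
  set (C' := 16 * (C + al * E * (2 + E) + 2 * al * E + 2 * al * ((1 + E) * (2 * al + C)))).
  exists C', d. split; [auto|].
  assert (HC' : 0 <= C').
  { unfold C'. assert (0 <= al * E * (2 + E)) by (repeat apply Rmult_le_pos; lra).
    assert (0 <= 2 * al * E) by (repeat apply Rmult_le_pos; lra).
    assert (0 <= 2 * al * ((1 + E) * (2 * al + C))) by (repeat apply Rmult_le_pos; lra).
    lra. }
  split; [auto|]. intros y Hy.
  set (x := K (- y)).
  assert (Hxe : Rabs x < e).
  { unfold x. rewrite <- (Rminus_0_r (K (- y))), <- HK0. apply Hd'.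
    now rewrite Rminus_0_r, Rabs_Ropp. }
  assert (HFx : F x = - y) by apply HF.
  destruct (H x ltac:(lra)) as [H1 H2].
  set (ax := Rabs x) in *.
  assert (Hax : 0 <= ax) by apply Rabs_pos.
  assert (Hax2 : Rabs (x ^ 2) = ax ^ 2) by (unfold ax; now rewrite RPow_abs).
  assert (Hax3 : C * ax ^ 3 <= C * ax ^ 2).
  { apply Rmult_le_compat_l; auto.
    replace (ax ^ 3) with (ax ^ 2 * ax) by ring. rewrite <- (Rmult_1_r (ax ^ 2)) at 2.
    apply Rmult_le_compat_l; [apply pow2_ge_0|lra]. }
  assert (H3 : Rabs (F x - x) <= E * ax ^ 2).
  { replace (F x - x) with ((F x - x + al * x ^ 2) + - (al * x ^ 2)) by ring.
    eapply Rle_trans; [apply Rabs_triang|].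
    rewrite Rabs_Ropp, Rabs_mult, (Rabs_right al), Hax2 by lra. unfold E. lra. }
  assert (Hsm : E * ax ^ 2 <= / 8 * ax).
  { replace (E * ax ^ 2) with ((ax * E) * ax) by ring. apply Rmult_le_compat_r; auto.
    apply Rle_trans with (e * (E + 1)); [|lra].
    apply Rmult_le_compat; lra. }
  assert (Hsm1 : E * ax ^ 2 <= E * ax).
  { replace (E * ax ^ 2) with (E * ax * ax) by ring.
    rewrite <- (Rmult_1_r (E * ax)) at 2.
    apply Rmult_le_compat_l; [apply Rmult_le_pos|]; lra. }
  assert (H4 : Rabs (F x + x) <= (2 + E) * ax).
  { replace (F x + x) with ((F x - x) + 2 * x) by ring.
    eapply Rle_trans; [apply Rabs_triang|].
    rewrite (Rabs_mult 2 x), (Rabs_right 2) by lra. fold ax.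
    assert (0 <= E * ax) by (apply Rmult_le_pos; lra). lra. }
  assert (H5 : Rabs (F x) <= (1 + E) * ax).
  { replace (F x) with ((F x - x) + x) by ring.
    eapply Rle_trans; [apply Rabs_triang|]. fold ax.
    assert (0 <= E * ax) by (apply Rmult_le_pos; lra). lra. }
  assert (Hxy : ax <= 2 * Rabs y).
  { rewrite <- (Rabs_Ropp y), <- HFx.
    replace (F x) with (x - (x - F x)) by ring.
    pose proof (Rabs_triang_inv x (x - F x)) as Ht. fold ax in Ht.
    rewrite (Rabs_minus_sym x (F x)) in Ht. lra. }
  assert (Hay : 0 <= Rabs y) by apply Rabs_pos.
  assert (HD1 : Rabs (Derive F x - 1) <= / 2).
  { replace (Derive F x - 1) with ((Derive F x - 1 + 2 * al * x) + - (2 * al * x)) by ring.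
    eapply Rle_trans; [apply Rabs_triang|].
    rewrite Rabs_Ropp, !Rabs_mult, (Rabs_right 2), (Rabs_right al) by lra. fold ax.
    assert (C * ax ^ 2 <= C * ax).
    { apply Rmult_le_compat_l; auto. replace (ax ^ 2) with (ax * ax) by ring.
      rewrite <- (Rmult_1_r ax) at 3. apply Rmult_le_compat_l; lra. }
    assert ((2 * al + C) * ax <= (2 * (E + 1)) * e)
      by (apply Rmult_le_compat; unfold E; lra).
    lra. }
  apply Rabs_le_between in HD1.
  split.
  - replace (- x - y + al * y ^ 2)
      with ((F x - x + al * x ^ 2) + al * ((F x - x) * (F x + x))).
    2:{ rewrite HFx. ring. }
    eapply Rle_trans; [apply Rabs_triang|].
    rewrite !Rabs_mult, (Rabs_right al) by lra.
    apply Rle_trans with ((C + al * E * (2 + E)) * ax ^ 3).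
    { assert (al * (Rabs (F x - x) * Rabs (F x + x)) <= al * (E * ax ^ 2 * ((2 + E) * ax))).
      { apply Rmult_le_compat_l; [lra|]. apply Rmult_le_compat; try apply Rabs_pos; auto. }
      replace ((C + al * E * (2 + E)) * ax ^ 3)
        with (C * ax ^ 3 + al * (E * ax ^ 2 * ((2 + E) * ax))) by ring.
      apply Rplus_le_compat; assumption. }
    apply Rle_trans with ((C' / 16) * (2 * Rabs y) ^ 3).
    { apply Rmult_le_compat.
      - assert (0 <= al * E * (2 + E)) by (repeat apply Rmult_le_pos; lra). lra.
      - apply pow_le; auto.
      - unfold C'. assert (0 <= 2 * al * E) by (repeat apply Rmult_le_pos; lra).
        assert (0 <= 2 * al * ((1 + E) * (2 * al + C))) by (repeat apply Rmult_le_pos; lra).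
        lra.
      - apply pow_incr. lra. }
    replace (C' / 16 * (2 * Rabs y) ^ 3) with (C' / 2 * Rabs y ^ 3) by field.
    apply Rmult_le_compat_r; [now apply pow_le|lra].
  - rewrite (Derive_reflect_eq s K y (gd_K _ _ _ HF)).
    rewrite (gd_inverse_derive s F K (- y) HF). fold x.
    set (D := Derive F x) in *.
    replace (/ D - 1 + 2 * al * y)
      with ((2 * al * (- (F x - x)) + - (D - 1 + 2 * al * x)
             + 2 * al * (F x * (2 * al * x + - (D - 1 + 2 * al * x)))) * / D).
    2:{ rewrite HFx. field. lra. }
    rewrite Rabs_mult, Rabs_inv, (Rabs_right D) by lra.
    apply Rle_trans with
      ((2 * al * (E * ax ^ 2) + C * ax ^ 2
        + 2 * al * ((1 + E) * ax * ((2 * al + C) * ax))) * 2).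
    { apply Rmult_le_compat.
      - apply Rabs_pos.
      - left. apply Rinv_0_lt_compat. lra.
      - eapply Rle_trans; [apply Rabs_triang|]. apply Rplus_le_compat.
        + eapply Rle_trans; [apply Rabs_triang|].
          rewrite Rabs_mult, !Rabs_Ropp, (Rabs_right (2 * al)) by lra.
          apply Rplus_le_compat; [apply Rmult_le_compat_l; lra|exact H2].
        + rewrite !Rabs_mult, (Rabs_right 2), (Rabs_right al) by lra.
          apply Rmult_le_compat_l; [lra|].
          apply Rmult_le_compat; try apply Rabs_pos; auto.
          eapply Rle_trans; [apply Rabs_triang|].
          rewrite Rabs_Ropp, !Rabs_mult, (Rabs_right 2), (Rabs_right al) by lra. fold ax.
          assert (C * ax ^ 2 <= C * ax).
          { apply Rmult_le_compat_l; auto. replace (ax ^ 2) with (ax * ax) by ring.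
            rewrite <- (Rmult_1_r ax) at 3. apply Rmult_le_compat_l; lra. }
          lra.
      - rewrite <- (Rinv_inv 2). apply Rinv_le_contravar; lra. }
    apply Rle_trans with ((C' / 8) * (2 * Rabs y) ^ 2).
    { replace ((2 * al * (E * ax ^ 2) + C * ax ^ 2
        + 2 * al * ((1 + E) * ax * ((2 * al + C) * ax))) * 2)
        with ((2 * (C + 2 * al * E + 2 * al * ((1 + E) * (2 * al + C)))) * ax ^ 2) by ring.
      assert (0 <= al * E * (2 + E)) by (repeat apply Rmult_le_pos; lra).
      assert (0 <= 2 * al * E) by (repeat apply Rmult_le_pos; lra).
      assert (0 <= 2 * al * ((1 + E) * (2 * al + C))) by (repeat apply Rmult_le_pos; lra).
      apply Rmult_le_compat.
      - lra.
      - apply pow2_ge_0.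
      - unfold C'. lra.
      - apply pow_incr. lra. }
    replace (C' / 8 * (2 * Rabs y) ^ 2) with (C' / 2 * Rabs y ^ 2) by field.
    apply Rmult_le_compat_r; [apply pow2_ge_0|lra].
Qed.

(** [F x = x (1 - al x + O(x^2))], hence
    [1 / F (1 / z) = z (1 - al / z + O(1/z^2))^-1 = z + al + O(1/z)]. *)
Lemma contact_translation s F K al :
  global_diffeo (S s) F K -> F 0 = 0 -> (forall x, 0 < x -> F x < x) ->
  quadratic_contact al F -> near_translation al (fun z => / F (/ z)).
Proof.
  intros HF HF0 Hdown [Hal [C [eta [Heta [HC H]]]]].
  assert (Hip : forall z, 0 < z -> 0 < / z) by (intros; now apply Rinv_0_lt_compat).
  assert (HFp : forall x, 0 < x -> 0 < F x).
  { intros x Hx. rewrite <- HF0. now apply HF. }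
  assert (HD : forall z, 0 < z -> is_derive (fun z => / F (/ z)) z
     (Derive F (/ z) / (z * F (/ z)) ^ 2)).
  { intros z Hz. pose proof (HFp _ (Hip z Hz)).
    eapply is_derive_eq.
    - apply is_derive_inv; [|lra].
      apply (derive_comp F (fun z => / z)); [eapply gd_derive; eassumption|].
      apply (is_derive_inv (fun z => z)); [apply derive_id|lra].
    - cbv beta. field. split; lra. }
  assert (HDe : forall z : R, 0 < z ->
    Derive (fun z => / F (/ z)) z = Derive F (/ z) / (z * F (/ z)) ^ 2).
  { intros z Hz. exact (is_derive_unique _ _ _ (HD z Hz)). }
  constructor; auto.
  - intros z Hz. assert (HK : 0 < K (/ z)).
    { replace 0 with (K 0) by (rewrite <- HF0 at 1; apply HF). apply HF; auto. }
    exists (/ K (/ z)). split; auto. rewrite Rinv_inv, (gd_FK _ _ _ HF). now rewrite Rinv_inv.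
  - intros z Hz. apply Derive_correct. eexists. now apply HD.
  - intros z Hz. rewrite HDe by auto.
    apply Rdiv_lt_0_compat; [apply HF|]. apply pow_lt, Rmult_lt_0_compat; auto.
  - intros z Hz.
    apply continuous_ext_loc with (g := fun z => Derive F (/ z) / (z * F (/ z)) ^ 2).
    + apply filter_imp with (2 := open_half_line z Hz). intros t Ht.
      symmetry. now apply HDe.
    + apply Cn_continuous with (s := 0%nat) (U := half_line); auto.
      assert (Hinv : Cn_on (S s) half_line (fun z => / z)).
      { apply Cn_inv; auto; [unfold half_line; intros; lra|now apply Cn_id]. }
      apply Cn_div; auto.
      * intros x Hx. apply Rgt_not_eq, pow_lt, Rmult_lt_0_compat; auto.
      * apply Cn_le with (s := s); [lia|].
        apply (Cn_comp s half_line whole (fun z => / z) (Derive F)); auto.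
        -- apply Cn_Derive, HF.
        -- eapply Cn_le; [|exact Hinv]. lia.
      * apply Cn_le with (s := S s); [lia|]. apply Cn_pow; auto. apply Cn_mult; auto.
        -- now apply Cn_id.
        -- apply (Cn_comp (S s) half_line whole (fun z => / z) F); auto. apply HF.
  - intros z Hz. rewrite <- (Rinv_inv z) at 1.
    apply Rinv_lt_contravar; [apply Rmult_lt_0_compat|]; auto.
  - (* With [w = F x / x = 1 - al x + rho] both asymptotics become rational
       expressions in [x], [w] and the two error terms [rho] and [sg]. *)
    set (E := al + C + 1).
    set (z0 := / eta + 2 * E + 1).
    assert (HE : 0 < E) by (unfold E; lra).
    pose proof (Hip eta Heta) as Hieta.
    exists (4 * (C + C + C + al ^ 2 + 2 * al * C + C * C + al * al + 1)), z0.
    assert (Hn1 : 0 <= al ^ 2) by apply pow2_ge_0.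
    assert (Hn2 : 0 <= al * C) by (apply Rmult_le_pos; lra).
    assert (Hn3 : 0 <= C * C) by (apply Rmult_le_pos; lra).
    split; [nra|]. split; [unfold z0; lra|]. intros z Hz.
    assert (Hz1 : 0 < z /\ / eta < z /\ 1 <= z /\ 2 * E <= z) by (unfold z0 in Hz; lra).
    set (x := / z).
    assert (Hx : 0 < x) by (apply Hip; lra).
    assert (Hxe : x < eta).
    { unfold x. rewrite <- (Rinv_inv eta). apply Rinv_lt_contravar; [|lra].
      apply Rmult_lt_0_compat; lra. }
    assert (HxE : x * E <= / 2).
    { apply Rmult_le_reg_r with (2 * z); [lra|].
      replace (x * E * (2 * z)) with (2 * E) by (unfold x; field; lra). lra. }
    assert (Hx1 : x <= 1).
    { unfold x. rewrite <- Rinv_1. apply Rinv_le_contravar; lra. }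
    destruct (H x) as [H1 H2]; [rewrite Rabs_right; lra|].
    rewrite (Rabs_right x) in H1, H2 by lra.
    set (rho := (F x - x + al * x ^ 2) / x).
    set (sg := Derive F x - 1 + 2 * al * x) in *.
    set (w := 1 - al * x + rho).
    assert (Hrho : Rabs rho <= C * x ^ 2).
    { unfold rho. rewrite Rabs_div, (Rabs_right x) by lra.
      apply Rmult_le_reg_r with x; [lra|].
      unfold Rdiv. rewrite Rmult_assoc, Rinv_l by lra.
      replace (C * x ^ 2 * x) with (C * x ^ 3) by ring. lra. }
    assert (HFw : F x = x * w) by (unfold w, rho; field; lra).
    assert (Hx2 : x ^ 2 <= x).
    { replace (x ^ 2) with (x * x) by ring. rewrite <- (Rmult_1_r x) at 3.
      apply Rmult_le_compat_l; lra. }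
    assert (HCx2 : C * x ^ 2 <= C * x) by (apply Rmult_le_compat_l; lra).
    apply Rabs_le_between in Hrho.
    assert (Hw : / 2 <= w).
    { replace (x * E) with (al * x + C * x + x) in HxE by (unfold E; ring). unfold w. lra. }
    assert (Hxz : x * z = 1) by (unfold x; field; lra).
    assert (Hiw : 0 < / w <= 2).
    { split; [apply Rinv_0_lt_compat; lra|].
      rewrite <- (Rinv_inv 2). apply Rinv_le_contravar; lra. }
    split.
    + fold x. replace (/ F x - z - al) with ((al * (al * x - rho) + - (rho * z)) * / w).
      2:{ rewrite HFw. replace z with (/ x) by (unfold x; apply Rinv_inv).
          replace rho with (w - 1 + al * x) by (unfold w; ring).
          clearbody w x. field. split; lra. }
      rewrite Rabs_mult, (Rabs_right (/ w)) by lra.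
      apply Rle_trans with ((al * (al * x + C * x) + C * x) * 2).
      { apply Rmult_le_compat; try apply Rabs_pos; try lra.
        eapply Rle_trans; [apply Rabs_triang|]. rewrite Rabs_Ropp.
        apply Rplus_le_compat.
        - rewrite Rabs_mult, (Rabs_right al) by lra. apply Rmult_le_compat_l; [lra|].
          assert (0 <= al * x) by (apply Rmult_le_pos; lra).
          apply Rabs_le. lra.
        - rewrite Rabs_mult, (Rabs_right z) by lra.
          apply Rle_trans with (C * x ^ 2 * z).
          + apply Rmult_le_compat_r; [lra|]. apply Rabs_le; lra.
          + right. replace (C * x ^ 2 * z) with (C * x * (x * z)) by ring.
            rewrite Hxz. ring. }
      replace (4 * (C + C + C + al ^ 2 + 2 * al * C + C * C + al * al + 1) / z)
        with (4 * (C + C + C + al ^ 2 + 2 * al * C + C * C + al * al + 1) * x)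
        by (unfold x, Rdiv; ring).
      replace ((al * (al * x + C * x) + C * x) * 2)
        with ((2 * (al * al + al * C + C)) * x) by ring.
      apply Rmult_le_compat_r; lra.
    + rewrite HDe by lra. fold x. rewrite HFw.
      replace (z * (x * w)) with w by (rewrite <- Rmult_assoc, (Rmult_comm z), Hxz; ring).
      replace (Derive F x / w ^ 2 - 1)
        with ((sg + - (al ^ 2 * x ^ 2) + - (2 * rho) + 2 * (al * x * rho) + - (rho * rho))
              * (/ w * / w)).
      2:{ replace (Derive F x) with (1 - 2 * al * x + sg) by (unfold sg; ring).
          replace (sg + - (al ^ 2 * x ^ 2) + - (2 * rho) + 2 * (al * x * rho) + - (rho * rho))
            with (1 - 2 * al * x + sg - w ^ 2) by (unfold w; ring).
          field. lra. }
      rewrite Rabs_mult, (Rabs_right (/ w * / w)) by nra.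
      replace (4 * (C + C + C + al ^ 2 + 2 * al * C + C * C + al * al + 1) / z ^ 2)
        with ((C + al ^ 2 + 2 * C + 2 * al * C + C * C + al * al + 1) * x ^ 2 * (2 * 2)).
      2:{ unfold x. field. lra. }
      assert (Hr : Rabs rho <= C * x ^ 2) by (apply Rabs_le; lra).
      assert (Hx20 : 0 <= x ^ 2) by apply pow2_ge_0.
      apply Rmult_le_compat; try apply Rabs_pos.
      * apply Rmult_le_pos; lra.
      * assert (T1 : Rabs (al ^ 2 * x ^ 2) <= al ^ 2 * x ^ 2).
        { rewrite Rabs_right; [lra|]. apply Rle_ge, Rmult_le_pos; lra. }
        assert (T2 : Rabs (2 * rho) <= 2 * C * x ^ 2).
        { rewrite Rabs_mult, (Rabs_right 2) by lra. lra. }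
        assert (T3 : Rabs (2 * (al * x * rho)) <= 2 * al * C * x ^ 2).
        { rewrite !Rabs_mult, (Rabs_right 2), (Rabs_right al), (Rabs_right x) by lra.
          apply Rle_trans with (2 * (al * 1 * (C * x ^ 2))); [|right; ring].
          apply Rmult_le_compat_l; [lra|].
          apply Rmult_le_compat; [apply Rmult_le_pos; lra|apply Rabs_pos| |auto].
          apply Rmult_le_compat_l; lra. }
        assert (T4 : Rabs (rho * rho) <= C * C * x ^ 2).
        { rewrite Rabs_mult. apply Rle_trans with (C * x ^ 2 * C).
          - apply Rmult_le_compat; try apply Rabs_pos; auto.
            apply Rle_trans with (1 := Hr).
            rewrite <- (Rmult_1_r C) at 2. apply Rmult_le_compat_l; lra.
          - right; ring. }
        repeat (eapply Rle_trans; [apply Rabs_triang|rewrite ?Rabs_Ropp]).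
        eapply Rle_trans.
        { apply Rplus_le_compat; [|exact T4].
          eapply Rle_trans; [apply Rabs_triang|]. apply Rplus_le_compat; [|exact T3].
          eapply Rle_trans; [apply Rabs_triang|]. rewrite Rabs_Ropp.
          apply Rplus_le_compat; [|exact T2].
          eapply Rle_trans; [apply Rabs_triang|]. rewrite Rabs_Ropp.
          apply Rplus_le_compat; [exact H2|exact T1]. }
        replace (C * x ^ 2 + al ^ 2 * x ^ 2 + 2 * C * x ^ 2 + 2 * al * C * x ^ 2 + C * C * x ^ 2)
          with ((C + al ^ 2 + 2 * C + 2 * al * C + C * C) * x ^ 2) by ring.
        apply Rmult_le_compat_r; auto. nra.
      * apply Rmult_le_compat; lra.
Qed.

Lemma slope_limit (H H' : R -> R) c :
  (forall z, 0 < z -> is_derive H z (H' z)) ->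
  (forall eps, 0 < eps -> exists z1, 0 < z1 /\ forall z, z1 <= z -> Rabs (H' z - c) < eps) ->
  forall eps, 0 < eps -> exists z1, 0 < z1 /\ forall z, z1 <= z -> Rabs (H z / z - c) < eps.
Proof.
  intros Hd Hl eps He.
  destruct (Hl (eps / 2)) as [z1 [Hz1 Hz1']]; [lra|].
  set (B := Rabs (H z1 - c * z1)).
  assert (HB : 0 <= B) by apply Rabs_pos.
  assert (HBe : 0 <= 2 * B / eps) by (apply Rdiv_le_0_compat; lra).
  exists (z1 + 2 * B / eps + 1). split; [lra|]. intros z Hz.
  destruct (MVT_on half_line H H' z1 z) as [x [Hx E]]; auto;
    try (unfold half_line; lra); try lra.
  { apply convex_half_line. }
  specialize (Hz1' x ltac:(lra)).
  replace (H z / z - c) with (((H z1 - c * z1) + (H' x - c) * (z - z1)) / z).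
  2:{ replace (H z) with (H z1 + H' x * (z - z1)) by lra. field. lra. }
  rewrite Rabs_div, (Rabs_right z) by lra.
  apply Rmult_lt_reg_r with z; [lra|].
  unfold Rdiv. rewrite Rmult_assoc, Rinv_l, Rmult_1_r by lra.
  eapply Rle_lt_trans; [apply Rabs_triang|]. fold B.
  rewrite Rabs_mult, (Rabs_right (z - z1)) by lra.
  assert (HBz : B < eps / 2 * z).
  { apply Rmult_lt_reg_l with (2 / eps); [apply Rdiv_lt_0_compat; lra|].
    replace (2 / eps * B) with (2 * B / eps) by (field; lra).
    replace (2 / eps * (eps / 2 * z)) with z by (field; lra). lra. }
  assert (Rabs (H' x - c) * (z - z1) <= eps / 2 * z) by
    (apply Rmult_le_compat; try apply Rabs_pos; lra).
  lra.
Qed.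

(** For [h x = 1 / H (1 / x)] and [z = 1 / x] one has [h x / x = 1 / (H z / z)] and
    [h' x = H' z / (H z / z)^2]: these are the two functions whose limits are taken
    here at a point where [H' z] and [H z / z] have the common limit [c]. *)
Lemma inversion_continuity c eps : 0 < c -> 0 < eps ->
  exists d, 0 < d /\ forall x y, Rabs (x - c) < d -> Rabs (y - c) < d ->
    Rabs (/ y - / c) < eps /\ Rabs (x * (/ y * / y) - / c) < eps.
Proof.
  intros Hc He.
  assert (Hinv : forall e, 0 < e -> exists d, 0 < d /\ forall y, Rabs (y - c) < d ->
    Rabs (/ y - / c) < e).
  { apply (continuous_eps Rinv c). apply continuous_Rinv. lra. }
  assert (Hmul : filterlim (fun w : R * R => fst w * (snd w * snd w))
    (filter_prod (locally c) (locally (/ c))) (locally (c * (/ c * / c)))).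
  { apply (filterlim_comp_2 (G := locally c) (H := locally (/ c * / c))
      (fun w => fst w) (fun w => snd w * snd w) Rmult).
    - apply filterlim_fst.
    - apply (filterlim_comp_2 (G := locally (/ c)) (H := locally (/ c))
        (fun w => snd w) (fun w => snd w) Rmult); try apply filterlim_snd.
      apply (filterlim_mult (K := R_AbsRing) (/ c) (/ c)).
    - apply (filterlim_mult (K := R_AbsRing) c (/ c * / c)). }
  replace (c * (/ c * / c)) with (/ c) in Hmul by (field; lra).
  destruct (proj1 (filterlim_locally _ _) Hmul (mkposreal eps He))
    as [S1 S2 [d1 Hd1] [d2 Hd2] HS].
  destruct (Hinv (Rmin d2 eps)) as [d3 [Hd3 Hd3']].
  { apply Rmin_pos; [apply cond_pos|lra]. }
  exists (Rmin d1 d3). split; [apply Rmin_pos; [apply cond_pos|lra]|].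
  intros x y Hx Hy.
  specialize (Hd3' y ltac:(eapply Rlt_le_trans; [exact Hy|apply Rmin_r])).
  split.
  - eapply Rlt_le_trans; [exact Hd3'|apply Rmin_r].
  - apply (HS x (/ y)).
    + apply Hd1. eapply Rlt_le_trans; [exact Hx|apply Rmin_l].
    + apply Hd2. eapply Rlt_le_trans; [exact Hd3'|apply Rmin_l].
Qed.

(** The limit of the derivative at infinity in the coordinate [1 / x] becomes the
    derivative at [0].  That it does not depend on the choice of [b] and [d] is why
    the two sides of the fixed point can be treated independently and still fit
    together. *)
Lemma half_conjugacy s F K G L al be b d :
  global_diffeo (S s) F K -> global_diffeo (S s) G L -> F 0 = 0 -> G 0 = 0 ->
  (forall x, 0 < x -> F x < x) -> (forall x, 0 < x -> G x < x) ->
  quadratic_contact al F -> quadratic_contact be G -> 0 < b -> 0 < d ->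
  exists h h' : R -> R,
    (forall x, 0 < x -> 0 < h x) /\
    (forall x, 0 < x -> is_derive h x (h' x)) /\
    (forall x, 0 < x -> 0 < h' x) /\
    (forall x, 0 < x -> continuous h' x) /\
    (forall y, 0 < y -> exists x, 0 < x /\ h x = y) /\
    h b = d /\ (forall x, 0 < x -> h (F x) = G (h x)) /\
    (forall eps, 0 < eps -> exists dl, 0 < dl /\ forall x, 0 < x < dl ->
       Rabs (h x / x - al / be) < eps /\ Rabs (h' x - al / be) < eps).
Proof.
  intros HF HG HF0 HG0 HFd HGd HFq HGq Hb Hd.
  assert (Hip : forall z, 0 < z -> 0 < / z) by (intros; now apply Rinv_0_lt_compat).
  assert (HFp : forall x, 0 < x -> 0 < F x) by (intros x Hx; rewrite <- HF0; now apply HF).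
  destruct (nt_conjugacy al be (fun z => / F (/ z)) (fun z => / G (/ z)) (/ b) (/ d))
    as [H [H' [H1 [H2 [H3 [H4 [H5 [H6 [H7 H8]]]]]]]]]; auto.
  { eapply contact_translation; eauto. }
  { eapply contact_translation; eauto. }
  assert (Hal : 0 < al) by apply HFq. assert (Hbe : 0 < be) by apply HGq.
  exists (fun x => / H (/ x)), (fun x => H' (/ x) * (/ (x * H (/ x)) * / (x * H (/ x)))).
  assert (HHp : forall x, 0 < x -> 0 < H (/ x)) by auto.
  assert (Hxh : forall x, 0 < x -> 0 < x * H (/ x))
    by (intros; apply Rmult_lt_0_compat; auto).
  split; [|split; [|split; [|split; [|split; [|split; [|split]]]]]].
  - auto.
  - intros x Hx. specialize (HHp x Hx). eapply is_derive_eq.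
    + apply is_derive_inv; [|lra].
      apply (derive_comp H (fun x => / x)); [apply H2; auto|].
      apply (is_derive_inv (fun x => x)); [apply derive_id|lra].
    + cbv beta. field. split; lra.
  - intros x Hx. repeat apply Rmult_lt_0_compat; auto.
  - intros x Hx.
    assert (Hci : continuous (fun x => / x) x) by (apply continuous_Rinv; lra).
    assert (HcH : continuous (fun x => H (/ x)) x).
    { apply (continuous_comp (fun x => / x) H); auto.
      apply (ex_derive_continuous H). eexists. apply H2. auto. }
    assert (Hc2 : continuous (fun x => / (x * H (/ x))) x).
    { apply (continuous_Rinv_comp (fun x => x * H (/ x))).
      - apply (cont_mult (fun x => x)); auto. apply continuous_id.
      - apply Rgt_not_eq. now apply Hxh. }
    apply (cont_mult (fun x => H' (/ x))).
    + apply (continuous_comp (fun x => / x) H'); auto.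
    + apply (cont_mult (fun x => / (x * H (/ x)))); auto.
  - intros y Hy. destruct (H5 (/ y) (Hip y Hy)) as [z [Hz E]].
    exists (/ z). split; auto. now rewrite Rinv_inv, E, Rinv_inv.
  - now rewrite H6, Rinv_inv.
  - intros x Hx. rewrite <- (Rinv_inv x) at 1. rewrite H7 by auto.
    now rewrite Rinv_inv.
  - intros eps He.
    assert (Hba : 0 < be / al) by now apply Rdiv_lt_0_compat.
    destruct (inversion_continuity (be / al) eps Hba He) as [e [He0 Hinv]].
    replace (/ (be / al)) with (al / be) in Hinv by (field; lra).
    destruct (H8 e He0) as [z1 [Hz1 Hz1']].
    destruct (slope_limit H H' (be / al) H2 H8 e He0) as [z2 [Hz2 Hz2']].
    exists (/ (z1 + z2)). split; [apply Hip; lra|]. intros x Hx.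
    assert (Hz : z1 + z2 <= / x).
    { rewrite <- (Rinv_inv (z1 + z2)). apply Rinv_le_contravar; lra. }
    specialize (HHp x (proj1 Hx)).
    destruct (Hinv (H' (/ x)) (H (/ x) / / x)) as [Ha Hb'].
    + apply Hz1'. lra.
    + apply Hz2'. lra.
    + replace (/ (H (/ x) / / x)) with (/ H (/ x) / x) in Ha by (field; split; lra).
      replace (H (/ x) / / x) with (x * H (/ x)) in Hb' by (field; lra).
      auto.
Qed.

(** The half-conjugacy of the reflected inverses, reflected back, conjugates the
    maps on the negative side.  Both halves have derivative [al / be] at [0]. *)
Lemma parabolic_conjugacy s F K G L al be a b c d :
  global_diffeo (S s) F K -> global_diffeo (S s) G L -> F 0 = 0 -> G 0 = 0 ->
  (forall x, x <> 0 -> F x < x) -> (forall x, x <> 0 -> G x < x) ->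
  quadratic_contact al F -> quadratic_contact be G ->
  a < 0 < b -> c < 0 < d ->
  exists h : R -> R, diffeo_on 1 whole whole h /\ increasing_on whole h /\
    h a = c /\ h b = d /\ forall x, h (F x) = G (h x).
Proof.
  intros HF HG HF0 HG0 HFd HGd HFq HGq Hab Hcd.
  assert (HKd : forall F K, global_diffeo (S s) F K -> (forall x, x <> 0 -> F x < x) ->
    F 0 = 0 -> forall x, 0 < x -> - K (- x) < x).
  { intros F0 K0 H0 Hd0 H00 x Hx.
    assert (HKx : K0 (- x) < 0).
    { replace 0 with (K0 0) by (rewrite <- H00 at 1; apply H0). apply H0; auto. lra. }
    specialize (Hd0 (K0 (- x)) ltac:(lra)). rewrite (gd_FK _ _ _ H0) in Hd0. lra. }
  destruct (half_conjugacy s F K G L al be b d) as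
    [h1 [h1' [P1 [P2 [P3 [P4 [P5 [P6 [P7 P8]]]]]]]]]; auto; try lra.
  { intros; apply HFd; lra. } { intros; apply HGd; lra. }
  assert (HK0 : K 0 = 0) by (rewrite <- HF0 at 1; apply HF).
  assert (HL0 : L 0 = 0) by (rewrite <- HG0 at 1; apply HG).
  destruct (half_conjugacy s (fun x => - K (- x)) (fun x => - F (- x))
      (fun x => - L (- x)) (fun x => - G (- x)) al be (- a) (- c)) as
    [h2 [h2' [Q1 [Q2 [Q3 [Q4 [Q5 [Q6 [Q7 Q8]]]]]]]]]; try lra.
  { now apply global_diffeo_reflect. } { now apply global_diffeo_reflect. }
  { rewrite Ropp_0, HK0. ring. } { rewrite Ropp_0, HL0. ring. }
  { now apply (HKd F). } { now apply (HKd G). }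
  { now apply quadratic_contact_reflect with (s := s) (F := F). }
  { now apply quadratic_contact_reflect with (s := s) (F := G). }
  assert (Hal : 0 < al) by apply HFq. assert (Hbe : 0 < be) by apply HGq.
  set (kp := al / be) in *. assert (Hkp : 0 < kp) by now apply Rdiv_lt_0_compat.
  set (glue := fun (u v : R -> R) w x =>
    if Rlt_dec 0 x then u x else if Rlt_dec x 0 then v x else w : R).
  assert (gp : forall u v w x, 0 < x -> glue u v w x = u x).
  { intros. unfold glue. destruct (Rlt_dec 0 x); [reflexivity|lra]. }
  assert (gn : forall u v w x, x < 0 -> glue u v w x = v x).
  { intros. unfold glue. destruct (Rlt_dec 0 x); [lra|].
    destruct (Rlt_dec x 0); [reflexivity|lra]. }
  assert (g0 : forall u v w, glue u v w 0 = w).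
  { intros. unfold glue. destruct (Rlt_dec 0 0); [lra|]. reflexivity. }
  set (h := glue h1 (fun x => - h2 (- x)) 0).
  set (h' := glue h1' (fun x => h2' (- x)) kp).
  assert (Hd : forall x, is_derive h x (h' x)).
  { intros x. destruct (Rtotal_order x 0) as [Hx|[Hx|Hx]].
    - unfold h'. rewrite gn by auto.
      apply is_derive_ext_loc with (f := fun x => - h2 (- x)).
      + apply filter_imp with (2 := open_lt 0 x Hx). intros t Ht.
        unfold h. now rewrite gn.
      + eapply is_derive_eq.
        * apply (derive_opp (fun x => h2 (- x))).
          apply (derive_comp h2 (fun x => - x)); [apply Q2; lra|].
          apply (derive_opp (fun x => x)).
          apply derive_id.
        * ring.
    - subst x. unfold h'. rewrite g0. apply is_derive_Reals. intros eps He.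
      destruct (P8 eps He) as [d1 [Hd1 Hd1']]. destruct (Q8 eps He) as [d2 [Hd2 Hd2']].
      exists (mkposreal _ (Rmin_pos d1 d2 Hd1 Hd2)). simpl. intros t Ht0 Ht.
      destruct (Rmin_Rgt_l _ _ _ Ht) as [Ht1 Ht2].
      apply Rabs_def2 in Ht1. apply Rabs_def2 in Ht2.
      unfold h. rewrite g0, Rplus_0_l, Rminus_0_r.
      destruct (Rlt_dec 0 t).
      + rewrite gp by auto. apply Hd1'. lra.
      + rewrite gn by lra. replace (- h2 (- t) / t) with (h2 (- t) / - t) by (field; lra).
        apply Hd2'. lra.
    - unfold h'. rewrite gp by auto.
      apply is_derive_ext_loc with (f := h1); [|now apply P2].
      apply filter_imp with (2 := open_gt 0 x Hx). intros t Ht.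
      unfold h. now rewrite gp. }
  assert (Hp : forall x, 0 < h' x).
  { intros x. unfold h'. destruct (Rtotal_order x 0) as [Hx|[Hx|Hx]].
    - rewrite gn by auto. apply Q3. lra.
    - subst x. now rewrite g0.
    - rewrite gp by auto. now apply P3. }
  assert (Hc : forall x, continuous h' x).
  { intros x. destruct (Rtotal_order x 0) as [Hx|[Hx|Hx]].
    - apply continuous_ext_loc with (g := fun x => h2' (- x)).
      + apply filter_imp with (2 := open_lt 0 x Hx). intros t Ht.
        unfold h'. now rewrite gn.
      + apply (continuous_comp (fun x => - x) h2').
        * apply cont_opp. apply continuous_id.
        * apply Q4. lra.
    - subst x. apply continuous_eps. intros eps He.
      destruct (P8 eps He) as [d1 [Hd1 Hd1']]. destruct (Q8 eps He) as [d2 [Hd2 Hd2']].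
      exists (Rmin d1 d2). split; [now apply Rmin_pos|]. intros t Ht.
      rewrite Rminus_0_r in Ht.
      destruct (Rmin_Rgt_l _ _ _ Ht) as [Ht1 Ht2].
      apply Rabs_def2 in Ht1. apply Rabs_def2 in Ht2.
      unfold h'. rewrite g0. destruct (Rtotal_order t 0) as [Hx|[Hx|Hx]].
      + rewrite gn by auto. apply Hd2'. lra.
      + subst t. rewrite g0, Rminus_diag, Rabs_R0. exact He.
      + rewrite gp by auto. apply Hd1'. lra.
    - apply continuous_ext_loc with (g := h1'); [|now apply P4].
      apply filter_imp with (2 := open_gt 0 x Hx). intros t Ht.
      unfold h'. now rewrite gp. }
  assert (Hinc : increasing_on whole h).
  { apply increasing_of_derive with (f' := h'); auto. intros ? ? ? _ _ _; exact Logic.I. }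
  assert (HD : forall x, Derive h x = h' x)
    by (intros x; exact (is_derive_unique _ _ _ (Hd x))).
  destruct (choice_on whole whole h) as [k Hk].
  { intros y _. destruct (Rtotal_order y 0) as [Hy|[Hy|Hy]].
    - destruct (Q5 (- y)) as [x [Hx E]]; [lra|]. exists (- x). split; auto.
      unfold h. rewrite gn, Ropp_involutive by lra. lra.
    - exists 0. split; auto. subst y. apply g0.
    - destruct (P5 y Hy) as [x [Hx E]]. exists x. split; auto.
      unfold h. now rewrite gp. }
  exists h. split; [|split; [|split; [|split]]]; auto.
  - apply diffeo_of_increasing with (K := k); auto.
    + apply Cn_of_derive with (h' := h'); auto. apply Cn_0. auto.
    + intros x _. rewrite HD. apply Rgt_not_eq, Hp.
  - unfold h. rewrite gn by lra. rewrite Q6. ring.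
  - unfold h. rewrite gp by lra. exact P6.
  - intros x. unfold h. destruct (Rtotal_order x 0) as [Hx|[Hx|Hx]].
    + assert (HFx : F x < 0) by (rewrite <- HF0; now apply HF).
      rewrite !gn by auto.
      pose proof (Q7 (- F x) ltac:(lra)) as E.
      rewrite Ropp_involutive, (gd_KF _ _ _ HF) in E. rewrite E, Ropp_involutive.
      now rewrite (gd_FK _ _ _ HG).
    + subst x. now rewrite HF0, !g0, HG0.
    + assert (HFx : 0 < F x) by (rewrite <- HF0; now apply HF).
      rewrite !gp by auto. now apply P7.
Qed.

(** * Conjugacy without fixed points *)

(** The window [(-l, 0)] where [ramp] increases is longer than every jump, so
    that no orbit steps over it. *)
Definition ramp (s : nat) (l x : R) : R := step (S s) (x / l + 1).

Lemma ramp_range s l x : 0 <= ramp s l x <= 1.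
Proof. apply step_range. Qed.

Lemma ramp_1 s l x : 0 < l -> 0 <= x -> ramp s l x = 1.
Proof.
  intros Hl Hx. apply step_1. assert (0 <= x / l) by (apply Rdiv_le_0_compat; lra). lra.
Qed.

Lemma ramp_0 s l x : 0 < l -> x <= - l -> ramp s l x = 0.
Proof.
  intros Hl Hx. apply step_0.
  assert (x / l <= -1).
  { apply Rmult_le_reg_r with l; [lra|]. unfold Rdiv.
    rewrite Rmult_assoc, Rinv_l by lra. lra. }
  lra.
Qed.

Lemma ramp_mono s l x y : 0 < l -> x <= y -> ramp s l x <= ramp s l y.
Proof.
  intros Hl H. apply step_mono. apply Rplus_le_compat_r.
  apply Rmult_le_compat_r; auto. left. now apply Rinv_0_lt_compat.
Qed.

Lemma ramp_window l x : 0 < l -> - l < x < 0 -> 0 < x / l + 1 < 1.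
Proof.
  intros Hl Hx. split.
  - apply Rmult_lt_reg_r with l; [lra|].
    replace ((x / l + 1) * l) with (x + l) by (field; lra). lra.
  - apply Rmult_lt_reg_r with l; [lra|].
    replace ((x / l + 1) * l) with (x + l) by (field; lra). lra.
Qed.

Lemma ramp_strict s l x y : 0 < l -> - l < x < 0 -> x < y -> ramp s l x < ramp s l y.
Proof.
  intros Hl Hx H. apply step_strict; [now apply ramp_window|].
  apply Rplus_lt_compat_r. apply Rmult_lt_compat_r; auto. now apply Rinv_0_lt_compat.
Qed.

Lemma Cn_ramp s l : 0 < l -> Cn_on (S s) whole (ramp s l).
Proof.
  intros Hl. unfold ramp.
  apply (Cn_comp (S s) whole whole (fun x => x / l + 1) (step (S s))); auto.
  - apply Cn_step.
  - apply Cn_plus; auto; [|now apply Cn_const].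
    apply Cn_mult; auto; [now apply Cn_id|now apply Cn_const].
Qed.

Lemma is_derive_ramp s l x : 0 < l ->
  is_derive (ramp s l) x (/ l * step' s (x / l + 1)).
Proof.
  intros Hl. unfold ramp.
  apply (derive_comp (step (S s)) (fun x => x / l + 1)); [apply is_derive_step|].
  auto_derive; [exact Logic.I|unfold Rdiv; ring].
Qed.

Lemma birkhoff_le psi1 psi2 F1 F2 m x1 x2 :
  (forall n, (n < m)%nat -> psi1 (Nat.iter n F1 x1) <= psi2 (Nat.iter n F2 x2)) ->
  birkhoff psi1 F1 m x1 <= birkhoff psi2 F2 m x2.
Proof.
  induction m as [|m IH]; intros H; simpl; [lra|].
  apply Rplus_le_compat; [apply IH; intros; apply H|apply H]; lia.
Qed.

Lemma birkhoff_lt psi1 psi2 F1 F2 m x1 x2 :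
  (forall n, (n < m)%nat -> psi1 (Nat.iter n F1 x1) <= psi2 (Nat.iter n F2 x2)) ->
  (exists n, (n < m)%nat /\ psi1 (Nat.iter n F1 x1) < psi2 (Nat.iter n F2 x2)) ->
  birkhoff psi1 F1 m x1 < birkhoff psi2 F2 m x2.
Proof.
  induction m as [|m IH]; intros H [n [Hn Hlt]]; simpl; [lia|].
  destruct (Nat.eq_dec n m) as [->|Hne].
  - apply Rplus_le_lt_compat; auto. apply birkhoff_le. intros; apply H; lia.
  - apply Rplus_lt_le_compat; [|apply H; lia]. apply IH.
    + intros; apply H; lia.
    + exists n. split; [lia|auto].
Qed.

Lemma birkhoff_const F m x c : birkhoff (fun _ => c) F m x = INR m * c.
Proof. induction m as [|m IH]; simpl birkhoff; [simpl; ring|]. rewrite IH, S_INR. ring. Qed.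

Lemma first_below (u : nat -> R) c m :
  c <= u 0%nat -> u m < c -> exists n, (n < m)%nat /\ c <= u n /\ u (S n) < c.
Proof.
  intros H0. induction m as [|m IH]; intros Hm; [lra|].
  destruct (Rlt_le_dec (u m) c) as [H|H].
  - destruct (IH H) as [n [Hn Hc]]. exists n. split; [lia|auto].
  - exists m. split; [lia|auto].
Qed.

Lemma iter_derive_pos s (G L : R -> R) n x :
  global_diffeo (S s) G L -> 0 < Derive (Nat.iter n G) x.
Proof.
  intros HG. induction n as [|n IH].
  - replace (Derive (Nat.iter 0 G) x) with 1; [lra|]. symmetry. apply Derive_id.
  - replace (Derive (Nat.iter (S n) G) x)
      with (Derive (Nat.iter n G) x * Derive G (Nat.iter n G x)).
    + apply Rmult_lt_0_compat; auto. apply HG.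
    + symmetry. apply is_derive_unique. apply (derive_comp G (Nat.iter n G)).
      * eapply gd_derive; eauto.
      * apply Cn_derivable with (s := s) (U := whole); auto. apply Cn_iter, HG.
Qed.

Section Drift.
Variables (s : nat) (l : R) (F K : R -> R).
Hypothesis Hl : 0 < l.
Hypothesis HF : global_diffeo (S s) F K.
Hypothesis Hdown : forall x, F x < x.
Hypothesis Hjump : forall x, x - F x < l.

Lemma drift_down x B : exists N, forall n, (N <= n)%nat -> Nat.iter n F x < B.
Proof using HF Hdown.
  assert (Hdec : forall n, Nat.iter (S n) F x <= Nat.iter n F x) by (intros n; left; apply Hdown).
  apply NNPP. intros Hno.
  assert (Hmono : forall k n, Nat.iter (k + n) F x <= Nat.iter n F x).
  { induction k as [|k IH]; intros n; [simpl; lra|].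
    eapply Rle_trans; [apply Hdec|apply IH]. }
  assert (HB : forall n, B <= Nat.iter n F x).
  { intros n. apply Rnot_lt_le. intros Hn. apply Hno. exists n. intros m Hm.
    replace m with ((m - n) + n)%nat by lia. apply Rle_lt_trans with (2 := Hn), Hmono. }
  destruct (ex_finite_lim_seq_decr _ B Hdec HB) as [q Hq].
  assert (H1 : is_lim_seq (fun n => Nat.iter (S n) F x) q)
    by (apply (is_lim_seq_incr_1 (fun n => Nat.iter n F x)); exact Hq).
  assert (H2 : is_lim_seq (fun n => Nat.iter (S n) F x) (F q)).
  { simpl. apply is_lim_seq_continuous; auto.
    apply continuity_pt_filterlim. eapply gd_cont; eauto. }
  apply is_lim_seq_unique in H1. apply is_lim_seq_unique in H2.
  rewrite H1 in H2. injection H2 as H2. specialize (Hdown q). lra.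
Qed.

Lemma drift_cross x m : 0 <= x -> Nat.iter m F x < 0 ->
  exists n, (n < m)%nat /\ - l < Nat.iter (S n) F x < 0.
Proof using Hjump.
  intros Hx Hm.
  destruct (first_below (fun n => Nat.iter n F x) 0 m) as [n [Hn [H1 H2]]]; auto.
  exists n. split; auto. split; auto. simpl. specialize (Hjump (Nat.iter n F x)). lra.
Qed.

(** Every term of the sum is nondecreasing, and the term of an iterate that falls
    into the window of [ramp] is strictly increasing. *)
Lemma birkhoff_ramp_derive m (x : R) : exists d : R,
  is_derive (birkhoff (ramp s l) F m) x d /\ 0 <= d /\
  ((exists n, (n < m)%nat /\ - l < Nat.iter n F x < 0) -> 0 < d).
Proof using Hl HF.
  induction m as [|m [d [H1 [H2 H3]]]].
  - exists 0. split; [|split; [lra|]].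
    + apply derive_const.
    + intros [n [Hn _]]. lia.
  - assert (HCi : Cn_on (S s) whole (Nat.iter m F)) by apply Cn_iter, HF.
    pose proof (iter_derive_pos s F K m x HF) as Hip.
    exists (d + Derive (Nat.iter m F) x * (/ l * step' s (Nat.iter m F x / l + 1))).
    assert (Hil : 0 < / l) by now apply Rinv_0_lt_compat.
    pose proof (step'_nonneg s (Nat.iter m F x / l + 1)) as Hs.
    assert (Hge : 0 <= Derive (Nat.iter m F) x * (/ l * step' s (Nat.iter m F x / l + 1))).
    { apply Rmult_le_pos; [lra|]. apply Rmult_le_pos; lra. }
    split; [|split; [lra|]].
    + simpl. apply derive_plus; auto.
      apply (derive_comp (ramp s l) (Nat.iter m F)).
      * now apply is_derive_ramp.
      * apply Cn_derivable with (s := s) (U := whole); auto.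
    + intros [n [Hn Hw]]. destruct (Nat.eq_dec n m) as [->|Hne].
      * apply Rplus_le_lt_0_compat; auto.
        apply Rmult_lt_0_compat; auto. apply Rmult_lt_0_compat; auto.
        apply step'_pos. now apply ramp_window.
      * apply Rplus_lt_le_0_compat; auto. apply H3. exists n. split; [lia|auto].
Qed.
End Drift.

Section Abel.
Variables (s : nat) (l : R) (F K : R -> R).
Hypothesis Hl : 0 < l.
Hypothesis HF : global_diffeo (S s) F K.
Hypothesis Hdown : forall x, F x < x.
Hypothesis Hjump : forall x, x - F x < l.

Let ps := ramp s l.

Lemma drift_up x B : exists N, forall n, (N <= n)%nat -> B < Nat.iter n K x.
Proof using HF Hdown.
  destruct (drift_down s (fun x => - K (- x)) (fun x => - F (- x))
    (global_diffeo_reflect _ _ _ HF)) with (x := - x) (B := - B)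
    as [N HN].
  - intros y. pose proof (Hdown (K (- y))) as H. rewrite (gd_FK _ _ _ HF) in H. lra.
  - exists N. intros n Hn. specialize (HN n Hn). rewrite iter_opp, Ropp_involutive in HN. lra.
Qed.

(** An Abel function [sum_n ps (F^n x)], regularised by subtracting [1] from
    the infinitely many terms with negative [n] that equal [1]. *)
Definition abel_sum (k m : nat) (x : R) : R :=
  birkhoff ps F m (Nat.iter k K x) - INR k.

Definition abel (x : R) : R := real (Lim_seq (fun k => abel_sum k (2 * k) x)).

(** Starting one step further back adds a term [1], which the subtraction of [k]
    compensates; going one step further forward adds a term [0]. *)
Lemma abel_sum_stable k0 m0 x :
  0 <= Nat.iter k0 K x -> Nat.iter m0 F x <= - l ->
  forall k m, abel_sum (k + k0) (k + m + (k0 + m0)) x = abel_sum k0 (k0 + m0) x.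
Proof using Hl HF Hdown.
  intros Hk0 Hm0.
  assert (Hup : forall k, 0 <= Nat.iter (k + k0) K x).
  { induction k as [|k IH]; auto. simpl.
    pose proof (Hdown (K (Nat.iter (k + k0) K x))) as H.
    rewrite (gd_FK _ _ _ HF) in H. lra. }
  assert (Hlow : forall m, Nat.iter (m + m0) F x <= - l).
  { induction m as [|m IH]; auto. simpl.
    pose proof (Hdown (Nat.iter (m + m0) F x)). lra. }
  induction k as [|k IH]; intros m.
  - simpl plus. induction m as [|m IHm]; [reflexivity|].
    rewrite <- IHm. unfold abel_sum. simpl. unfold ps at 2.
    replace (m + (k0 + m0))%nat with ((m + m0) + k0)%nat by lia.
    rewrite (Nat.iter_add (m + m0) k0 R F), (iter_cancel K F) by exact (gd_FK _ _ _ HF).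
    rewrite ramp_0; auto. ring.
  - rewrite <- (IH m). unfold abel_sum.
    change (S k + m + (k0 + m0))%nat with (S (k + m + (k0 + m0))).
    rewrite birkhoff_S. unfold ps at 1. rewrite ramp_1 by (auto; apply (Hup (S k))).
    replace (F (Nat.iter (S k + k0) K x)) with (Nat.iter (k + k0) K x)
      by (symmetry; apply (gd_FK _ _ _ HF)).
    change (S k + k0)%nat with (S (k + k0)). rewrite S_INR. ring.
Qed.

Lemma abel_eq k0 m0 x :
  0 <= Nat.iter k0 K x -> Nat.iter m0 F x <= - l ->
  abel x = abel_sum k0 (k0 + m0) x.
Proof using Hl HF Hdown.
  intros Hk0 Hm0. unfold abel.
  rewrite (is_lim_seq_unique _ (abel_sum k0 (k0 + m0) x)); [reflexivity|].
  apply is_lim_seq_ext_loc with (u := fun _ => abel_sum k0 (k0 + m0) x);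
    [|apply is_lim_seq_const].
  exists (k0 + m0)%nat. intros n Hn.
  rewrite <- (abel_sum_stable k0 m0 x Hk0 Hm0 (n - k0) (n - m0)). f_equal; lia.
Qed.

Lemma abel_near x : exists k0 m0,
  0 < Nat.iter k0 K x /\ Nat.iter m0 F x < - l.
Proof using HF Hdown.
  destruct (drift_up x 0) as [k0 Hk]. destruct (drift_down s F K HF Hdown x (- l)) as [m0 Hm].
  exists k0, m0. auto.
Qed.

Lemma Cn_birkhoff m : Cn_on (S s) whole (birkhoff ps F m).
Proof using Hl HF.
  induction m as [|m IH]; simpl; [now apply Cn_const|].
  apply Cn_plus; auto.
  apply (Cn_comp (S s) whole whole (Nat.iter m F) ps); auto.
  - now apply Cn_ramp.
  - apply Cn_iter, HF.
Qed.

Lemma abel_local x : exists k0 m0, 0 < Nat.iter k0 K x /\ Nat.iter m0 F x < - l /\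
  locally x (fun y => abel_sum k0 (k0 + m0) y = abel y).
Proof using Hl HF Hdown.
  destruct (abel_near x) as [k0 [m0 [H1 H2]]]. exists k0, m0.
  split; [|split]; auto.
  assert (Hc1 : continuous (Nat.iter k0 K) x).
  { apply Cn_continuous with (s := S s) (U := whole); auto. apply Cn_iter, HF. }
  assert (Hc2 : continuous (Nat.iter m0 F) x).
  { apply Cn_continuous with (s := S s) (U := whole); auto. apply Cn_iter, HF. }
  assert (L1 : locally x (fun y => 0 < Nat.iter k0 K y))
    by exact (Hc1 _ (open_gt 0 _ H1)).
  assert (L2 : locally x (fun y => Nat.iter m0 F y < - l))
    by exact (Hc2 _ (open_lt (- l) _ H2)).
  generalize (filter_and _ _ L1 L2). apply filter_imp.
  intros y [Hy1 Hy2]. symmetry. apply abel_eq; lra.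
Qed.

Lemma Cn_abel : Cn_on (S s) whole abel.
Proof using Hl HF Hdown.
  apply Cn_local. intros x _.
  destruct (abel_local x) as [k0 [m0 [H1 [H2 H3]]]].
  destruct H3 as [d Hd].
  exists (fun y => x - d < y < x + d). split.
  { pose proof (cond_pos d). lra. }
  apply Cn_ext with (f := abel_sum k0 (k0 + m0)); auto.
  - intros y Hy. apply Hd. apply (Rabs_def1 (y - x)); lra.
  - unfold abel_sum. apply Cn_minus; auto; [|now apply Cn_const].
    apply Cn_subset with (U := whole); auto.
    apply (Cn_comp (S s) whole whole (Nat.iter k0 K) (birkhoff ps F (k0 + m0))); auto.
    + apply Cn_birkhoff.
    + apply Cn_iter, HF.
Qed.

Lemma abel_derive_pos x : 0 < Derive abel x.
Proof using Hl HF Hdown Hjump.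
  destruct (abel_local x) as [k0 [m0 [H1 [H2 H3]]]].
  assert (Hend : Nat.iter (k0 + m0) F (Nat.iter k0 K x) = Nat.iter m0 F x).
  { rewrite Nat.add_comm, Nat.iter_add, (iter_cancel K F); auto. apply HF. }
  destruct (drift_cross l F Hjump (Nat.iter k0 K x) (k0 + m0)) as [n [Hn Hw]];
    [lra|rewrite Hend; lra|].
  assert (HnS : (S n < k0 + m0)%nat).
  { destruct (Nat.eq_dec (S n) (k0 + m0)) as [E|E]; [|lia].
    rewrite E, Hend in Hw. lra. }
  destruct (birkhoff_ramp_derive s l F K Hl HF (k0 + m0) (Nat.iter k0 K x))
    as [d [Hd1 [_ Hd2]]].
  assert (Hd : 0 < d) by (apply Hd2; eauto).
  assert (Hda : is_derive abel x (Derive (Nat.iter k0 K) x * d)).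
  { apply is_derive_ext_loc with (1 := H3). unfold abel_sum. eapply is_derive_eq.
    - apply derive_minus.
      + apply (derive_comp (birkhoff ps F (k0 + m0)) (Nat.iter k0 K)); [exact Hd1|].
        apply Cn_derivable with (s := s) (U := whole); auto. apply Cn_iter, HF.
      + apply derive_const.
    - ring. }
  rewrite (is_derive_unique _ _ _ Hda).
  apply Rmult_lt_0_compat; auto. apply (iter_derive_pos s K F), global_diffeo_sym, HF.
Qed.

Lemma abel_F x : abel (F x) = abel x - 1.
Proof using Hl HF Hdown.
  destruct (abel_near x) as [k0 [m0 [H1 H2]]].
  assert (HK : Nat.iter (S k0) K (F x) = Nat.iter k0 K x).
  { rewrite iter_S_r. now rewrite (gd_KF _ _ _ HF). }
  rewrite (abel_eq k0 m0 x) by lra.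
  rewrite (abel_eq (S k0) m0 (F x)).
  - unfold abel_sum. rewrite HK, S_INR. simpl birkhoff.
    rewrite (Nat.add_comm k0 m0), Nat.iter_add, (iter_cancel K F) by exact (gd_FK _ _ _ HF).
    unfold ps at 2. rewrite ramp_0; auto; [ring|lra].
  - rewrite HK. lra.
  - rewrite <- iter_S_r. simpl. pose proof (Hdown (Nat.iter m0 F x)). lra.
Qed.

Lemma abel_increasing : increasing_on whole abel.
Proof using Hl HF Hdown Hjump.
  apply increasing_of_derive with (f' := Derive abel).
  - intros ? ? ? _ _ _. exact Logic.I.
  - intros t _. apply Cn_derivable with (s := s) (U := whole); auto. apply Cn_abel.
  - intros t _. apply abel_derive_pos.
Qed.

Lemma abel_onto y : exists x, whole x /\ abel x = y.
Proof using Hl HF Hdown Hjump.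
  assert (Hn : forall n, abel (Nat.iter n F 0) = abel 0 - INR n).
  { induction n as [|n IH]; [simpl; ring|]. simpl Nat.iter. rewrite abel_F, IH, S_INR. ring. }
  assert (Hp : forall n, abel (Nat.iter n K 0) = abel 0 + INR n).
  { induction n as [|n IH]; [simpl; ring|]. simpl Nat.iter.
    rewrite S_INR. pose proof (abel_F (K (Nat.iter n K 0))) as E.
    rewrite (gd_FK _ _ _ HF) in E. lra. }
  destruct (INR_unbounded (Rabs (y - abel 0))) as [n Hny].
  apply Rgt_lt, Rabs_def2 in Hny.
  specialize (Hn n). specialize (Hp n).
  destruct (IVT_on abel (Nat.iter n F 0) (Nat.iter n K 0) y) as [t [_ Et]].
  - apply Rnot_lt_le. intros H. apply abel_increasing in H; auto. pose proof (pos_INR n). lra.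
  - intros t _. apply Cn_continuous with (s := S s) (U := whole); auto. apply Cn_abel.
  - lra.
  - exists t. auto.
Qed.

(** The transit time from [l] to [-l], in Abel coordinates.  It splits into
    forward iterates of [l] and backward iterates of [-l]: both contributions
    increase with [F], which is what makes the time monotone in a parameter. *)
Lemma transit_eq m :
  Nat.iter m F l <= - l -> 0 <= Nat.iter m K (- l) ->
  abel l - abel (- l) =
    birkhoff ps F m l + birkhoff (fun x => 1 - ps x) K m (K (- l)).
Proof using Hl HF Hdown.
  intros H1 H2.
  rewrite (abel_eq 0 m l), (abel_eq m 0 (- l)); auto; try (simpl; lra).
  assert (E : forall j x, birkhoff ps F j (Nat.iter j K x) = birkhoff ps K j (K x)).
  { induction j as [|j IH]; intros x; [reflexivity|].
    rewrite birkhoff_S. simpl Nat.iter. rewrite (gd_FK _ _ _ HF), IH. simpl.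
    rewrite <- (iter_S_r K j x). simpl. ring. }
  assert (E2 : forall j x, birkhoff (fun x => 1 - ps x) K j x = INR j - birkhoff ps K j x).
  { induction j as [|j IH]; intros x; [simpl; ring|]. rewrite S_INR. simpl birkhoff.
    rewrite IH. ring. }
  unfold abel_sum. rewrite Nat.add_0_r, E, E2. simpl. ring.
Qed.
End Abel.

Definition transit (s : nat) (l : R) (F K : R -> R) : R :=
  abel s l F K l - abel s l F K (- l).

(** With Abel functions [P] and [Q], every [Q^-1 (P + c)] is a conjugacy.  The
    constant is determined by the image of [l]; equality of the transit times then
    gives the right image to [- l]. *)
Lemma passage_conjugacy s l l' F K G L :
  0 < l -> 0 < l' -> global_diffeo (S s) F K -> global_diffeo (S s) G L ->
  (forall x, F x < x) -> (forall x, G x < x) ->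
  (forall x, x - F x < l) -> (forall x, x - G x < l') ->
  transit s l F K = transit s l' G L ->
  exists h : R -> R, diffeo_on (S s) whole whole h /\ increasing_on whole h /\
    h (- l) = - l' /\ h l = l' /\ forall x, h (F x) = G (h x).
Proof.
  intros Hl Hl' HF HG HFd HGd HFj HGj Ht.
  set (P := abel s l F K). set (Q := abel s l' G L).
  fold P Q in Ht. unfold transit in Ht. fold P Q in Ht.
  assert (HPi : increasing_on whole P) by (apply abel_increasing; auto).
  assert (HQi : increasing_on whole Q) by (apply abel_increasing; auto).
  destruct (choice_on whole whole P) as [P' HP']; [intros y _; apply abel_onto; auto|].
  destruct (choice_on whole whole Q) as [Q' HQ']; [intros y _; apply abel_onto; auto|].
  assert (HPD : diffeo_on (S s) whole whole P).
  { apply diffeo_of_increasing with (K := P'); auto.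
    - apply Cn_abel; auto.
    - intros x _. apply Rgt_not_eq, abel_derive_pos; auto. }
  assert (HQD : diffeo_on (S s) whole whole Q).
  { apply diffeo_of_increasing with (K := Q'); auto.
    - apply Cn_abel; auto.
    - intros x _. apply Rgt_not_eq, abel_derive_pos; auto. }
  destruct HPD as [P1 [A1 [A2 [A3 A4]]]]. destruct HQD as [Q1 [B1 [B2 [B3 B4]]]].
  set (c := Q l' - P l).
  assert (Hinc : increasing_on whole (fun x => Q1 (P x + c))).
  { intros x y _ _ Hxy. apply HPi in Hxy; auto.
    destruct (B2 (P x + c) Logic.I) as [_ E1]. destruct (B2 (P y + c) Logic.I) as [_ E2].
    apply Rnot_le_lt. intros [H|H].
    - apply HQi in H; auto. lra.
    - rewrite H in E2. lra. }
  exists (fun x => Q1 (P x + c)). split; [|split; [|split; [|split]]]; auto.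
  - exists (fun y => P1 (Q y - c)). split; [|split; [|split]].
    + intros x _. split; auto. rewrite (proj2 (B2 _ Logic.I)).
      replace (P x + c - c) with (P x) by ring. now apply A1.
    + intros x _. split; auto. rewrite (proj2 (A2 _ Logic.I)).
      replace (Q x - c + c) with (Q x) by ring. now apply B1.
    + apply (Cn_comp (S s) whole whole (fun x => P x + c) Q1); auto.
      apply Cn_plus; auto. now apply Cn_const.
    + apply (Cn_comp (S s) whole whole (fun x => Q x - c) P1); auto.
      apply Cn_minus; auto. now apply Cn_const.
  - replace (P (- l) + c) with (Q (- l')) by (unfold c; lra). now apply B1.
  - replace (P l + c) with (Q l') by (unfold c; lra). now apply B1.
  - intros x. unfold P at 1. rewrite abel_F by auto. fold P.
    replace (P x - 1 + c) with (Q (Q1 (P x + c)) - 1)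
      by (rewrite (proj2 (B2 _ Logic.I)); ring).
    unfold Q at 1. rewrite <- abel_F by auto. fold Q. now apply B1.
Qed.

(** * Matching transit times of two families *)

Section Family.
Variables (s : nat) (l dl : R) (F K : R -> R -> R).
Hypothesis Hl : 0 < l.
Hypothesis Hdl : 0 < dl.
Hypothesis HF : forall mu, Rabs mu < dl -> global_diffeo (S s) (F mu) (K mu).
Hypothesis HF2 : forall mu x, Rabs mu < dl -> Derive (F mu) x <= 2.
Hypothesis HK2 : forall mu x, Rabs mu < dl -> Derive (K mu) x <= 2.
Hypothesis Hjump : forall mu x, Rabs mu < dl -> x - F mu x < l.
Hypothesis Hdown : forall mu x, - dl < mu < 0 -> F mu x < x.
Hypothesis Hcont : forall mu x, Rabs mu < dl -> continuous (fun mu => F mu x) mu.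
Hypothesis Hmono : forall mu1 mu2 x, - dl < mu1 < mu2 -> mu2 < dl -> F mu1 x <= F mu2 x.
Hypothesis Hstrict : forall mu1 mu2, - dl < mu1 < mu2 -> mu2 < dl -> F mu1 l < F mu2 l.
Hypothesis HF00 : F 0 0 = 0.

Lemma lipschitz_2 (G : R -> R) x y :
  (forall z, is_derive G z (Derive G z)) -> (forall z, 0 < Derive G z <= 2) ->
  Rabs (G x - G y) <= 2 * Rabs (x - y).
Proof using.
  intros Hd HG.
  assert (Hc : convex whole) by (intros ? ? ? _ _ _; exact Logic.I).
  assert (H : forall a b, a < b -> Rabs (G b - G a) <= 2 * Rabs (b - a)).
  { intros a b Hab.
    destruct (MVT_on whole G (Derive G) a b) as [c [_ E]]; auto.
    rewrite E, Rabs_mult. apply Rmult_le_compat_r; [apply Rabs_pos|].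
    rewrite Rabs_right; specialize (HG c); lra. }
  destruct (Rtotal_order x y) as [Hxy|[->|Hxy]]; auto.
  - rewrite Rabs_minus_sym, (Rabs_minus_sym x). auto.
  - rewrite !Rminus_diag, Rabs_R0. lra.
Qed.

Lemma open_band mu : Rabs mu < dl -> locally mu (fun m => Rabs m < dl).
Proof using.
  intros H.
  apply (open_comp Rabs (fun y => y < dl)); [|apply open_lt|exact H].
  intros y _. apply continuous_Rabs.
Qed.

Lemma band_neg mu : - dl < mu < 0 -> Rabs mu < dl.
Proof using. intros H. rewrite Rabs_left; lra. Qed.

(** The Lipschitz bound, uniform in the parameter, makes up for the lack of joint
    continuity. *)
Lemma apply_continuous (G : R -> R -> R) (y : R -> R) mu :
  (forall m, Rabs m < dl -> forall a b, Rabs (G m a - G m b) <= 2 * Rabs (a - b)) ->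
  Rabs mu < dl -> continuous (fun m => G m (y mu)) mu -> continuous y mu ->
  continuous (fun m => G m (y m)) mu.
Proof using.
  intros HG Hmu H1 H2. apply continuous_eps. intros eps He.
  destruct (proj1 (continuous_eps _ _) H1 (eps / 2)) as [d1 [Hd1 Hd1']]; [lra|].
  destruct (proj1 (continuous_eps _ _) H2 (eps / 4)) as [d2 [Hd2 Hd2']]; [lra|].
  destruct (open_band mu Hmu) as [d3 Hd3].
  exists (Rmin d1 (Rmin d2 d3)). split.
  { apply Rmin_pos; auto. apply Rmin_pos; auto. apply cond_pos. }
  intros m Hm.
  destruct (Rmin_Rgt_l _ _ _ Hm) as [Hm1 Hm2].
  assert (Hm3 : Rabs (m - mu) < d2) by (eapply Rlt_le_trans; [exact Hm2|apply Rmin_l]).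
  assert (Hm4 : Rabs m < dl) by (apply Hd3; eapply Rlt_le_trans; [exact Hm2|apply Rmin_r]).
  replace (G m (y m) - G mu (y mu))
    with ((G m (y m) - G m (y mu)) + (G m (y mu) - G mu (y mu))) by ring.
  eapply Rle_lt_trans; [apply Rabs_triang|].
  pose proof (HG m Hm4 (y m) (y mu)). specialize (Hd1' m Hm1). specialize (Hd2' m Hm3). lra.
Qed.

Lemma F_lipschitz m : Rabs m < dl -> forall a b, Rabs (F m a - F m b) <= 2 * Rabs (a - b).
Proof using HF HF2.
  intros Hm a b. apply lipschitz_2.
  - intros z. eapply gd_derive. now apply HF.
  - intros z. split; [|now apply HF2]. apply (gd_F' _ _ _ (HF m Hm)).
Qed.

Lemma K_lipschitz m : Rabs m < dl -> forall a b, Rabs (K m a - K m b) <= 2 * Rabs (a - b).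
Proof using HF HK2.
  intros Hm a b. apply lipschitz_2.
  - intros z. eapply gd_derive. apply global_diffeo_sym. now apply HF.
  - intros z. split; [|now apply HK2]. apply (gd_K' _ _ _ (HF m Hm)).
Qed.

Lemma K_continuous mu x : Rabs mu < dl -> continuous (fun m => K m x) mu.
Proof using HF HK2 Hcont.
  intros Hmu. apply continuous_eps. intros eps He.
  set (z := K mu x).
  assert (Hz : F mu z = x) by apply (gd_FK _ _ _ (HF mu Hmu)).
  destruct (proj1 (continuous_eps _ _) (Hcont mu z Hmu) (eps / 2)) as [d1 [Hd1 Hd1']]; [lra|].
  destruct (open_band mu Hmu) as [d3 Hd3].
  exists (Rmin d1 d3). split.
  { apply Rmin_pos; auto. apply cond_pos. }
  intros m Hm.
  assert (Hm1 : Rabs (m - mu) < d1) by (eapply Rlt_le_trans; [exact Hm|apply Rmin_l]).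
  assert (Hm4 : Rabs m < dl) by (apply Hd3; eapply Rlt_le_trans; [exact Hm|apply Rmin_r]).
  fold z. rewrite <- (gd_KF _ _ _ (HF m Hm4) z).
  pose proof (K_lipschitz m Hm4 x (F m z)) as HL. specialize (Hd1' m Hm1).
  rewrite Hz in Hd1'. rewrite Rabs_minus_sym in Hd1'. lra.
Qed.

Lemma iter_F_continuous n x mu :
  Rabs mu < dl -> continuous (fun m => Nat.iter n (F m) x) mu.
Proof using HF HF2 Hcont.
  intros Hmu. induction n as [|n IH]; simpl; [apply continuous_const|].
  apply (apply_continuous F (fun m => Nat.iter n (F m) x)); auto. apply F_lipschitz.
Qed.

Lemma iter_K_continuous n x mu :
  Rabs mu < dl -> continuous (fun m => Nat.iter n (K m) x) mu.
Proof using HF HK2 Hcont.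
  intros Hmu. induction n as [|n IH]; simpl; [apply continuous_const|].
  apply (apply_continuous K (fun m => Nat.iter n (K m) x)); auto.
  - apply K_lipschitz.
  - now apply K_continuous.
Qed.

Let T := fun mu => transit s l (F mu) (K mu).
Let Tsum := fun m mu => birkhoff (ramp s l) (F mu) m l
  + birkhoff (fun x => 1 - ramp s l x) (K mu) m (K mu (- l)).

Lemma Tsum_continuous m mu : Rabs mu < dl -> continuous (Tsum m) mu.
Proof using Hl HF HF2 HK2 Hcont.
  intros Hmu.
  assert (Hr : forall x, continuous (ramp s l) x).
  { intros x. apply Cn_continuous with (s := S s) (U := whole); auto. now apply Cn_ramp. }
  apply cont_plus.
  - induction m as [|m IH]; simpl; [apply continuous_const|].
    apply cont_plus; auto.
    apply (continuous_comp (fun mu => Nat.iter m (F mu) l) (ramp s l)); auto.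
    now apply iter_F_continuous.
  - induction m as [|m IH]; simpl; [apply continuous_const|].
    apply cont_plus; auto.
    apply cont_minus; [apply continuous_const|].
    apply (continuous_comp (fun mu => Nat.iter m (K mu) (K mu (- l))) (ramp s l)); auto.
    apply continuous_ext with (f := fun mu => Nat.iter (S m) (K mu) (- l)).
    { intros t. apply iter_S_r. }
    now apply iter_K_continuous.
Qed.

Lemma T_eq m mu : - dl < mu < 0 ->
  Nat.iter m (F mu) l < - l -> 0 < Nat.iter m (K mu) (- l) -> T mu = Tsum m mu.
Proof using Hl HF Hdown.
  intros Hmu H1 H2. unfold T, transit, Tsum.
  apply transit_eq; auto; try lra. apply HF. now apply band_neg.
Qed.

Lemma T_large mu : - dl < mu < 0 -> exists M, forall m, (M <= m)%nat ->
  Nat.iter m (F mu) l < - l /\ 0 < Nat.iter m (K mu) (- l).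
Proof using HF Hdown.
  intros Hmu. pose proof (HF mu (band_neg mu Hmu)) as HFm.
  destruct (drift_down s (F mu) (K mu) HFm (fun x => Hdown mu x Hmu) l (- l)) as [M1 HM1].
  destruct (drift_up s (F mu) (K mu) HFm (fun x => Hdown mu x Hmu) (- l) 0) as [M2 HM2].
  exists (M1 + M2)%nat. intros m Hm. split; [apply HM1|apply HM2]; lia.
Qed.

Lemma T_continuous mu : - dl < mu < 0 -> continuous T mu.
Proof using Hl HF HF2 HK2 Hdown Hcont.
  intros Hmu. destruct (T_large mu Hmu) as [m Hm].
  destruct (Hm m (le_n m)) as [H1 H2].
  assert (Hb := band_neg mu Hmu).
  apply continuous_ext_loc with (g := Tsum m); [|now apply Tsum_continuous].
  assert (L0 : locally mu (fun m => - dl < m < 0)) by exact (open_itv (- dl) 0 mu Hmu).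
  assert (L1 : locally mu (fun mu => Nat.iter m (F mu) l < - l))
    by exact (iter_F_continuous m l mu Hb _ (open_lt (- l) _ H1)).
  assert (L2 : locally mu (fun mu => 0 < Nat.iter m (K mu) (- l)))
    by exact (iter_K_continuous m (- l) mu Hb _ (open_gt 0 _ H2)).
  generalize (filter_and _ _ L0 (filter_and _ _ L1 L2)). apply filter_imp.
  intros y [Hy0 [Hy1 Hy2]]. symmetry. now apply T_eq.
Qed.

Lemma iter_F_mono mu1 mu2 n x : - dl < mu1 < mu2 -> mu2 < dl ->
  Nat.iter n (F mu1) x <= Nat.iter n (F mu2) x.
Proof using HF Hmono.
  intros H1 H2. induction n as [|n IH]; simpl; [lra|].
  apply Rle_trans with (F mu2 (Nat.iter n (F mu1) x)); [now apply Hmono|].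
  apply increasing_le; auto. apply HF. apply Rabs_def1; lra.
Qed.

Lemma K_antimono mu1 mu2 x : - dl < mu1 < mu2 -> mu2 < dl -> K mu2 x <= K mu1 x.
Proof using HF Hmono.
  intros H1 H2.
  pose proof (HF mu1 ltac:(apply Rabs_def1; lra)) as G1.
  pose proof (HF mu2 ltac:(apply Rabs_def1; lra)) as G2.
  rewrite <- (gd_KF _ _ _ G2 (K mu1 x)). apply increasing_le; [apply G2|].
  rewrite <- (gd_FK _ _ _ G1 x) at 1. now apply Hmono.
Qed.

Lemma iter_K_antimono mu1 mu2 n x : - dl < mu1 < mu2 -> mu2 < dl ->
  Nat.iter n (K mu2) x <= Nat.iter n (K mu1) x.
Proof using HF Hmono.
  intros H1 H2. induction n as [|n IH]; simpl; [lra|].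
  apply Rle_trans with (K mu1 (Nat.iter n (K mu2) x)); [now apply K_antimono|].
  apply increasing_le; auto. apply HF. apply Rabs_def1; lra.
Qed.

(** A strict increase of [F l] is carried along by the monotone iterates, and is
    seen by the sum at the iterate that falls into the window of [ramp], which no
    orbit steps over. *)
Lemma T_strict mu1 mu2 : - dl < mu1 < mu2 -> mu2 < 0 -> T mu1 < T mu2.
Proof using Hl Hdl HF Hjump Hdown Hmono Hstrict.
  intros H1 H2.
  destruct (T_large mu1) as [M1 HM1]; [lra|]. destruct (T_large mu2) as [M2 HM2]; [lra|].
  set (m := (M1 + M2)%nat).
  destruct (HM1 m ltac:(unfold m; lia)) as [A1 A2].
  destruct (HM2 m ltac:(unfold m; lia)) as [B1 B2].
  rewrite (T_eq m mu1), (T_eq m mu2) by (auto; lra). unfold Tsum.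
  apply Rplus_lt_le_compat.
  - apply birkhoff_lt.
    + intros n _. apply ramp_mono; auto. apply iter_F_mono; lra.
    + destruct (drift_cross l (F mu1) (fun x => Hjump mu1 x (band_neg mu1 ltac:(lra))) l m)
        as [n [Hn Hw]]; [lra|lra|].
      exists (S n). split.
      * destruct (Nat.eq_dec (S n) m) as [E|E]; [|lia]. rewrite E in Hw. lra.
      * apply ramp_strict; auto. rewrite !iter_S_r.
        apply Rlt_le_trans with (Nat.iter n (F mu1) (F mu2 l)).
        -- apply iter_increasing; auto; [|apply Hstrict; lra].
           apply HF. apply band_neg. lra.
        -- apply iter_F_mono; lra.
  - apply birkhoff_le. intros n _.
    assert (Hr : ramp s l (Nat.iter n (K mu2) (K mu2 (- l)))
              <= ramp s l (Nat.iter n (K mu1) (K mu1 (- l)))).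
    { apply ramp_mono; auto. rewrite <- !iter_S_r. apply iter_K_antimono; lra. }
    lra.
Qed.

(** At the bifurcation value the orbit of [l] never leaves [(0, l]]; nearby
    it spends arbitrarily many steps there. *)
Lemma T_unbounded B : exists e, 0 < e /\ forall mu, - e < mu < 0 -> B < T mu.
Proof using Hl Hdl HF HF2 Hdown Hcont HF00.
  destruct (INR_unbounded B) as [M HM].
  assert (H0 : Rabs 0 < dl) by (rewrite Rabs_R0; lra).
  assert (Hpos : 0 < Nat.iter M (F 0) l).
  { clear - Hl HF HF00 H0. induction M as [|M IH]; simpl; auto.
    rewrite <- HF00 at 1. now apply HF. }
  destruct (proj1 (continuous_eps _ _) (iter_F_continuous M l 0 H0)
              (Nat.iter M (F 0) l) Hpos) as [d [Hd Hd']].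
  exists (Rmin d dl). split; [now apply Rmin_pos|]. intros mu Hmu.
  assert (Hm1 : - d < mu) by (pose proof (Rmin_l d dl); lra).
  assert (Hm2 : - dl < mu < 0) by (pose proof (Rmin_r d dl); lra).
  specialize (Hd' mu ltac:(apply Rabs_def1; lra)). apply Rabs_def2 in Hd'.
  destruct (T_large mu Hm2) as [N HN].
  destruct (HN (N + M)%nat ltac:(lia)) as [A1 A2].
  rewrite (T_eq (N + M) mu) by auto. unfold Tsum.
  assert (Hn : 0 <= birkhoff (fun x => 1 - ramp s l x) (K mu) (N + M) (K mu (- l))).
  { rewrite <- (Rmult_0_r (INR (N + M))), <- (birkhoff_const (K mu) (N + M) (K mu (- l)) 0).
    apply birkhoff_le. intros n _.
    pose proof (ramp_range s l (Nat.iter n (K mu) (K mu (- l)))). lra. }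
  assert (Hge : forall k n, Nat.iter (k + n) (F mu) l <= Nat.iter n (F mu) l).
  { induction k as [|k IH]; intros n; [simpl; lra|].
    apply Rle_trans with (2 := IH n). simpl. left. now apply Hdown. }
  assert (Hi : INR M <= birkhoff (ramp s l) (F mu) M l).
  { rewrite <- (Rmult_1_r (INR M)), <- (birkhoff_const (F mu) M l 1).
    apply birkhoff_le. intros n Hn'. right. symmetry. apply ramp_1; auto.
    specialize (Hge (M - n)%nat n). replace (M - n + n)%nat with M in Hge by lia. lra. }
  assert (Hi2 : forall k, birkhoff (ramp s l) (F mu) M l
                          <= birkhoff (ramp s l) (F mu) (k + M) l).
  { induction k as [|k IH]; [simpl; lra|]. simpl.
    pose proof (ramp_range s l (Nat.iter (k + M) (F mu) l)). lra. }
  specialize (Hi2 N). lra.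
Qed.
End Family.

(** [nu mu] solves [T2 nu = T1 mu]: it exists because [T2] is unbounded, and
    depends continuously on [mu] because [T2] is strictly monotone.  As [T1] is
    unbounded near [0] while [T2] is bounded by [T2 (- c)] on the left of [- c], the
    solution tends to [0]. *)
Lemma match_increasing (T1 T2 : R -> R) d1 d2 :
  0 < d1 -> 0 < d2 ->
  (forall mu, - d1 < mu < 0 -> continuous T1 mu) ->
  (forall B, exists e, 0 < e /\ forall mu, - e < mu < 0 -> B < T1 mu) ->
  (forall nu, - d2 < nu < 0 -> continuous T2 nu) ->
  (forall x y, - d2 < x < y -> y < 0 -> T2 x < T2 y) ->
  (forall B, exists e, 0 < e /\ forall nu, - e < nu < 0 -> B < T2 nu) ->
  exists (e : R) (nu : R -> R), 0 < e <= d1 /\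
    (forall mu, - e < mu < 0 -> - d2 < nu mu < 0 /\ T2 (nu mu) = T1 mu) /\
    (forall mu, - e < mu < 0 -> continuous nu mu) /\
    (forall c, 0 < c -> exists d, 0 < d /\ forall mu, - d < mu < 0 -> - c < nu mu < 0).
Proof.
  intros Hd1 Hd2 HT1 HT1u HT2 HT2i HT2u.
  destruct (HT1u (T2 (- (d2 / 2)))) as [e0 [He0 He0']].
  set (e := Rmin e0 d1).
  assert (He : 0 < e /\ e <= e0 /\ e <= d1).
  { unfold e. solve_min. }
  assert (Hex : forall mu, - e < mu < 0 -> exists nu, - d2 < nu < 0 /\ T2 nu = T1 mu).
  { intros mu Hmu. destruct (HT2u (T1 mu)) as [e1 [He1 He1']].
    set (z := - Rmin (e1 / 2) (d2 / 4)).
    assert (Hz : - e1 < z < 0 /\ - (d2 / 2) < z).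
    { unfold z. solve_min. }
    destruct (IVT_on T2 (- (d2 / 2)) z (T1 mu)) as [t [Ht E]].
    - lra.
    - intros t Ht. apply HT2. lra.
    - specialize (He1' z ltac:(lra)). specialize (He0' mu ltac:(lra)). lra.
    - exists t. split; [lra|exact E]. }
  set (nu := fun mu => epsilon (inhabits 0) (fun nu => - d2 < nu < 0 /\ T2 nu = T1 mu)).
  assert (Hnu : forall mu, - e < mu < 0 -> - d2 < nu mu < 0 /\ T2 (nu mu) = T1 mu).
  { intros mu Hmu. unfold nu. apply epsilon_spec. now apply Hex. }
  assert (Hlt : forall x y, - d2 < x < 0 -> - d2 < y < 0 -> T2 x < T2 y -> x < y).
  { intros x y Hx Hy H. apply Rnot_le_lt. intros [H'|H'].
    - pose proof (HT2i y x ltac:(lra) ltac:(lra)). lra.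
    - subst y. lra. }
  exists e, nu. split; [lra|]. split; [exact Hnu|]. split.
  - intros mu Hmu. apply continuous_eps. intros eps Heps.
    destruct (Hnu mu Hmu) as [H1 H2].
    set (c := Rmin (eps / 2) (Rmin ((nu mu + d2) / 2) (- nu mu / 2))).
    assert (Hc : 0 < c /\ c < eps /\ - d2 < nu mu - c /\ nu mu + c < 0).
    { unfold c. solve_min. }
    assert (HA : T2 (nu mu - c) < T1 mu) by (rewrite <- H2; apply HT2i; lra).
    assert (HB : T1 mu < T2 (nu mu + c)) by (rewrite <- H2; apply HT2i; lra).
    assert (Hcm : continuous T1 mu) by (apply HT1; lra).
    destruct (proj1 (continuous_eps _ _) Hcm
      (Rmin (T1 mu - T2 (nu mu - c)) (T2 (nu mu + c) - T1 mu))) as [d [Hd Hd']].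
    { apply Rmin_pos; lra. }
    destruct (open_eps _ mu (open_itv (- e) 0) Hmu) as [d' [Hd2p Hd2']].
    exists (Rmin d d'). split; [now apply Rmin_pos|]. intros m Hm.
    destruct (Rmin_Rgt_l _ _ _ Hm) as [Hm1 Hm2].
    specialize (Hd' m Hm1). specialize (Hd2' m Hm2). cbv beta in Hd2'.
    destruct (Hnu m Hd2') as [G1 G2].
    pose proof (Rmin_l (T1 mu - T2 (nu mu - c)) (T2 (nu mu + c) - T1 mu)).
    pose proof (Rmin_r (T1 mu - T2 (nu mu - c)) (T2 (nu mu + c) - T1 mu)).
    apply Rabs_def2 in Hd'.
    assert (nu mu - c < nu m) by (apply Hlt; lra).
    assert (nu m < nu mu + c) by (apply Hlt; lra).
    apply Rabs_def1; lra.
  - intros c Hc.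
    set (c' := Rmin c (d2 / 2)).
    assert (Hc' : 0 < c' /\ c' <= c /\ c' <= d2 / 2).
    { unfold c'. solve_min. }
    destruct (HT1u (T2 (- c'))) as [d [Hd Hd']].
    exists (Rmin d e). split; [apply Rmin_pos; lra|]. intros mu Hmu.
    pose proof (Rmin_l d e). pose proof (Rmin_r d e).
    destruct (Hnu mu ltac:(lra)) as [G1 G2]. specialize (Hd' mu ltac:(lra)).
    assert (- c' < nu mu) by (apply Hlt; lra). lra.
Qed.

(** * Restriction to the given neighbourhoods *)

Lemma diffeo_restrict s t (I I' U V : R -> Prop) h :
  (t <= s)%nat -> diffeo_on s I I' h ->
  (forall x, U x -> I x) -> (forall y, V y -> I' y) ->
  (forall x, I x -> (U x <-> V (h x))) -> diffeo_on t U V h.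
Proof.
  intros Hts [k [H1 [H2 [H3 H4]]]] HU HV HUV. exists k. split; [|split; [|split]].
  - intros x Hx. split; [|apply H1; auto]. apply HUV; auto.
  - intros y Hy. destruct (H2 y (HV y Hy)) as [E1 E2]. split; auto.
    apply HUV; auto. now rewrite E2.
  - apply Cn_subset with (U := I); auto. now apply Cn_le with (s := s).
  - apply Cn_subset with (U := I'); auto. now apply Cn_le with (s := s).
Qed.

Lemma increasing_lt_iff (I : R -> Prop) h x y :
  increasing_on I h -> I x -> I y -> (x < y <-> h x < h y).
Proof.
  intros H Hx Hy. split; [now apply H|]. intros Hlt. apply Rnot_le_lt. intros [H'|H'].
  - apply H in H'; auto. lra.
  - subst. lra.
Qed.

Definition sym_itv (l : R) : R -> Prop := fun x => - l < x < l.

(** An increasing map that sends the ends of one interval to the ends of the other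
    sends the interval onto the other one. *)
Lemma restrict_conjugacy s h (F G Fh Gh : R -> R) l l' :
  0 < l -> diffeo_on s whole whole h -> increasing_on whole h ->
  h (- l) = - l' -> h l = l' -> (forall x, h (Fh x) = Gh (h x)) ->
  (forall x, sym_itv l x -> Fh x = F x) -> (forall x, sym_itv l' x -> Gh x = G x) ->
  conjugate s F (sym_itv l) G (sym_itv l').
Proof.
  intros Hl Hd Hi H1 H2 Hc HF HG. exists h.
  assert (HU : forall x, sym_itv l x <-> sym_itv l' (h x)).
  { intros x. unfold sym_itv. rewrite <- H1, <- H2 at 1.
    rewrite <- (increasing_lt_iff whole h (- l) x), <- (increasing_lt_iff whole h x l); auto.
    tauto. }
  split.
  - apply diffeo_restrict with (s := s) (I := whole) (I' := whole); auto.
  - intros x Hx HFx. rewrite <- HF by auto. rewrite Hc. apply HG. now apply HU.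
Qed.

Lemma ext_derive_eq n e l F x : 0 < l -> Rabs x < l ->
  Derive (ext n e l F) x = Derive F x.
Proof.
  intros Hl Hx. apply Derive_ext_loc.
  assert (Ho : open (fun x : R => Rabs x < l)).
  { apply (open_comp Rabs (fun y => y < l)); [|apply open_lt].
    intros y _. apply continuous_Rabs. }
  apply filter_imp with (2 := Ho x Hx). intros t Ht. apply ext_eq; lra.
Qed.

(** * Fixed points of a tame map above the bifurcation *)

Lemma tame_derive r e l F x : tame (S r) e l F -> Rabs x < 3 * l ->
  is_derive F x (Derive F x).
Proof.
  intros H Hx. apply Cn_derivable with (s := r) (U := fun x => - (3 * l) < x < 3 * l).
  - apply H.
  - apply Rabs_def2 in Hx. lra.
Qed.

Lemma tame_derive_decreasing r e l F x y : tame (S (S r)) e l F ->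
  - (3 * l) < x -> x < y -> y < 3 * l -> Derive F y < Derive F x.
Proof.
  intros H Hx Hxy Hy.
  assert (HC : Cn_on (S r) (fun x => - (3 * l) < x < 3 * l) (Derive F))
    by (apply Cn_Derive, H).
  destruct (MVT_on (fun x => - (3 * l) < x < 3 * l) (Derive F) (Derive (Derive F)) x y)
    as [c [Hc E]]; try lra.
  - intros a b d; lra.
  - intros t Ht. eapply Cn_derivable; eauto.
  - assert (Hn : Derive (Derive F) c < 0).
    { change (Derive_n F 2 c < 0). apply (tame_F'' _ _ _ _ H). apply Rabs_def1; lra. }
    assert (0 < - Derive (Derive F) c * (y - x)) by (apply Rmult_lt_0_compat; lra). lra.
Qed.

Record fixed_pair (l : R) (F : R -> R) (x1 x2 : R) : Prop := {
  fp_1 : - l < x1;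
  fp_12 : x1 < x2;
  fp_2 : x2 < l;
  fp_F1 : F x1 = x1;
  fp_F2 : F x2 = x2;
  fp_between : forall x, x1 < x < x2 -> x < F x;
  fp_left : forall x, - l <= x < x1 -> F x < x;
  fp_right : forall x, x2 < x <= l -> F x < x;
  fp_D1 : 1 < Derive F x1;
  fp_D2 : Derive F x2 < 1 }.

(** The displacement is concave, positive at [0] and negative at the ends. *)
Lemma tame_fixed_pair r e l F : tame (S (S r)) e l F -> 0 < F 0 ->
  exists x1 x2, x1 < 0 < x2 /\ fixed_pair l F x1 x2.
Proof.
  intros H H0. pose proof (tame_l _ _ _ _ H) as Hl.
  set (ph := fun x => F x - x).
  assert (Hd : forall t, - (3 * l) < t < 3 * l -> is_derive ph t (Derive F t - 1)).
  { intros t Ht. apply derive_minus.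
    - eapply tame_derive; [exact H|]. apply Rabs_def1; lra.
    - apply derive_id. }
  assert (Hc : forall t, - (3 * l) < t < 3 * l -> continuous ph t).
  { intros t Ht. apply (ex_derive_continuous ph t). eexists. now apply Hd. }
  assert (Hpl : ph l < 0).
  { unfold ph. pose proof (tame_below _ _ _ _ H l). rewrite Rabs_right in H1 by lra. lra. }
  assert (Hpm : ph (- l) < 0).
  { unfold ph. pose proof (tame_below _ _ _ _ H (- l)). rewrite Rabs_left in H1 by lra. lra. }
  assert (Hp0 : 0 < ph 0) by (unfold ph; lra).
  destruct (IVT_on ph (- l) 0 0) as [x1 [Hx1 E1]]; [lra| |lra|].
  { intros t Ht. apply Hc. lra. }
  destruct (IVT_on (fun x => - ph x) 0 l 0) as [x2 [Hx2 E2]]; [lra| |lra|].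
  { intros t Ht. apply cont_opp. apply Hc. lra. }
  assert (Hx1' : - l < x1 < 0).
  { split; apply Rnot_le_lt; intros Hle.
    - replace x1 with (- l) in E1 by lra. lra.
    - replace x1 with 0 in E1 by lra. lra. }
  assert (Hx2' : 0 < x2 < l).
  { split; apply Rnot_le_lt; intros Hle.
    - replace x2 with 0 in E2 by lra. lra.
    - replace x2 with l in E2 by lra. lra. }
  assert (HU : convex (fun x => - (3 * l) < x < 3 * l)) by (intros a b d; lra).
  assert (Hdec := fun x y => tame_derive_decreasing r e l F x y H).
  destruct (MVT_on _ ph _ x1 0 HU Hd) as [c1 [Hc1 C1]]; try lra.
  destruct (MVT_on _ ph _ 0 x2 HU Hd) as [c2 [Hc2 C2]]; try lra.
  assert (HD1 : 1 < Derive F c1).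
  { apply Rnot_le_lt. intros Hle.
    assert (0 <= (1 - Derive F c1) * (0 - x1)) by (apply Rmult_le_pos; lra). lra. }
  assert (HD2 : Derive F c2 < 1).
  { apply Rnot_le_lt. intros Hle.
    assert (0 <= (Derive F c2 - 1) * (x2 - 0)) by (apply Rmult_le_pos; lra). lra. }
  assert (HDx1 : 1 < Derive F x1) by (pose proof (Hdec x1 c1); lra).
  assert (HDx2 : Derive F x2 < 1) by (pose proof (Hdec c2 x2); lra).
  exists x1, x2. split; [lra|]. constructor; try lra; unfold ph in *; try lra.
  - (* If [ph x <= 0] with [x] between [x1] and [0], then [ph] descends from [x1]
       to [x] and climbs from [x] to [0], against concavity; likewise with [x]
       between [0] and [x2]. *)
    intros x Hx. apply Rnot_le_lt. intros Hle.
    destruct (Rle_lt_dec x 0) as [Hx0|Hx0].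
    + destruct (Rle_lt_or_eq_dec _ _ Hx0) as [Hx0'|Hx0']; [|subst x; lra].
      destruct (MVT_on _ ph _ x1 x HU Hd) as [a [Ha A]]; try lra.
      destruct (MVT_on _ ph _ x 0 HU Hd) as [b [Hb B]]; try lra.
      unfold ph in A, B. pose proof (Hdec a b ltac:(lra) ltac:(lra) ltac:(lra)).
      assert (0 < Derive F b - 1).
      { apply Rnot_le_lt. intros Hn.
        assert (0 <= (1 - Derive F b) * (0 - x)) by (apply Rmult_le_pos; lra). lra. }
      assert (0 < (Derive F a - 1) * (x - x1)) by (apply Rmult_lt_0_compat; lra). lra.
    + destruct (MVT_on _ ph _ 0 x HU Hd) as [a [Ha A]]; try lra.
      destruct (MVT_on _ ph _ x x2 HU Hd) as [b [Hb B]]; try lra.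
      unfold ph in A, B. pose proof (Hdec a b ltac:(lra) ltac:(lra) ltac:(lra)).
      assert (Derive F a - 1 < 0).
      { apply Rnot_le_lt. intros Hn.
        assert (0 <= (Derive F a - 1) * (x - 0)) by (apply Rmult_le_pos; lra). lra. }
      assert (0 < (1 - Derive F b) * (x2 - x)) by (apply Rmult_lt_0_compat; lra). lra.
  - intros x Hx. destruct (MVT_on _ ph _ x x1 HU Hd) as [a [Ha A]]; try lra.
    unfold ph in A. pose proof (Hdec a x1 ltac:(lra) ltac:(lra) ltac:(lra)).
    assert (0 < (Derive F a - 1) * (x1 - x)) by (apply Rmult_lt_0_compat; lra). lra.
  - intros x Hx. destruct (MVT_on _ ph _ x2 x HU Hd) as [a [Ha A]]; try lra.
    unfold ph in A. pose proof (Hdec x2 a ltac:(lra) ltac:(lra) ltac:(lra)).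
    assert (0 < (1 - Derive F a) * (x - x2)) by (apply Rmult_lt_0_compat; lra). lra.
Qed.

Lemma fixed_pair_iff l F x1 x2 x : fixed_pair l F x1 x2 ->
  (fixed_in F (sym_itv l) x <-> x = x1 \/ x = x2).
Proof.
  intros [H1 H2 H3 H4 H5 H6 H7 H8 _ _]. unfold fixed_in, sym_itv. split.
  - intros [Hx HFx].
    destruct (Rtotal_order x x1) as [A|[A|A]]; auto.
    { specialize (H7 x ltac:(lra)). lra. }
    destruct (Rtotal_order x x2) as [B|[B|B]]; auto.
    { specialize (H6 x ltac:(lra)). lra. }
    specialize (H8 x ltac:(lra)). lra.
  - intros [->| ->]; split; lra.
Qed.

Section Basins.
Variables (n : nat) (e l : R) (F : R -> R) (x1 x2 : R) (K : R -> R).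
Hypothesis Hs : slack (S n) e.
Hypothesis HF : tame (S n) e l F.
Hypothesis HK : global_diffeo (S n) (ext (S n) e l F) K.
Hypothesis Hp : fixed_pair l F x1 x2.

Let Fh := ext (S n) e l F.

Let Hl : 0 < l := tame_l _ _ _ _ HF.

Lemma Fh_eq x : - l <= x <= l -> Fh x = F x.
Proof using Hl HF. intros H. apply ext_eq; auto. apply Rabs_le. lra. Qed.

Lemma Fh_1 : Fh x1 = x1.
Proof using Hl HF Hp. rewrite Fh_eq; [apply Hp|]. destruct Hp; lra. Qed.

Lemma Fh_2 : Fh x2 = x2.
Proof using Hl HF Hp. rewrite Fh_eq; [apply Hp|]. destruct Hp; lra. Qed.

Lemma Fh_right x : x2 < x -> Fh x < x.
Proof using Hl Hs HF Hp.
  intros Hx. destruct (Rle_lt_dec x l) as [H|H].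
  - rewrite Fh_eq by (destruct Hp; lra). apply (fp_right _ _ _ _ Hp). lra.
  - apply ext_below; auto. rewrite Rabs_right; lra.
Qed.

Lemma Fh_left x : x < x1 -> Fh x < x.
Proof using Hl Hs HF Hp.
  intros Hx. destruct (Rle_lt_dec (- l) x) as [H|H].
  - rewrite Fh_eq by (destruct Hp; lra). apply (fp_left _ _ _ _ Hp). lra.
  - apply ext_below; auto. rewrite Rabs_left; lra.
Qed.

Lemma Fh_between x : x1 < x < x2 -> x < Fh x.
Proof using Hl HF Hp.
  intros Hx. rewrite Fh_eq by (destruct Hp; lra). now apply (fp_between _ _ _ _ Hp).
Qed.

Lemma Fh_inc x y : x < y -> Fh x < Fh y.
Proof using HK. intros H. now apply (gd_Finc _ _ _ HK). Qed.

Lemma K_inc x y : x < y -> K x < K y.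
Proof using HK. intros H. now apply (gd_Kinc _ _ _ HK). Qed.

Lemma K_1 : K x1 = x1.
Proof using Hl HF HK Hp. rewrite <- Fh_1 at 1. apply (gd_KF _ _ _ HK). Qed.

Lemma K_2 : K x2 = x2.
Proof using Hl HF HK Hp. rewrite <- Fh_2 at 1. apply (gd_KF _ _ _ HK). Qed.

Lemma FhK x : Fh (K x) = x.
Proof using HK. apply (gd_FK _ _ _ HK). Qed.

Lemma Fh_basin x : x1 < x -> x1 < Fh x.
Proof using Hl HF HK Hp. intros Hx. apply Fh_inc in Hx. now rewrite Fh_1 in Hx. Qed.

Lemma K_basin x : x1 < x -> x1 < K x.
Proof using Hl HF HK Hp. intros Hx. apply K_inc in Hx. now rewrite K_1 in Hx. Qed.

Lemma Fh_lower x : x < x2 -> Fh x < x2.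
Proof using Hl HF HK Hp. intros Hx. apply Fh_inc in Hx. now rewrite Fh_2 in Hx. Qed.

Lemma K_lower x : x < x2 -> K x < x2.
Proof using Hl HF HK Hp. intros Hx. apply K_inc in Hx. now rewrite K_2 in Hx. Qed.

Lemma Fh_limit x : x1 < x -> is_lim_seq (fun n => Nat.iter n Fh x) x2.
Proof using Hl Hs HF HK Hp.
  intros Hx.
  assert (Hc : forall y, continuous Fh y) by (intros; eapply gd_cont; exact HK).
  destruct (Rtotal_order x x2) as [H|[H|H]].
  - apply iter_lim_below; auto. intros y Hy. split; [apply Fh_between; lra|].
    apply Fh_lower; lra.
  - subst x. apply is_lim_seq_ext with (u := fun _ => x2); [|apply is_lim_seq_const].
    intros m. induction m as [|m IH]; simpl; auto. now rewrite <- IH, Fh_2.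
  - apply iter_lim_above; auto. intros y Hy. split; [|apply Fh_right; lra].
    rewrite <- Fh_2. apply Fh_inc. lra.
Qed.

Lemma K_limit x : x < x2 -> is_lim_seq (fun n => Nat.iter n K x) x1.
Proof using Hl Hs HF HK Hp.
  intros Hx.
  assert (Hc : forall y, continuous K y)
    by (intros; eapply gd_cont; apply global_diffeo_sym; exact HK).
  destruct (Rtotal_order x x1) as [H|[H|H]].
  - apply iter_lim_below; auto. intros y Hy.
    assert (HKy : K y < x1) by (rewrite <- K_1; apply K_inc; lra).
    split; auto. pose proof (Fh_left (K y) HKy) as E. now rewrite FhK in E.
  - subst x. apply is_lim_seq_ext with (u := fun _ => x1); [|apply is_lim_seq_const].
    intros m. induction m as [|m IH]; simpl; auto. now rewrite <- IH, K_1.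
  - apply iter_lim_above; auto. intros y Hy.
    assert (HKy : x1 < K y < x2) by (split; [apply K_basin|apply K_lower]; lra).
    split; [lra|]. pose proof (Fh_between (K y) HKy) as E. now rewrite FhK in E.
Qed.

Lemma basin_stable x : x1 < x < l -> x1 < Fh x < l.
Proof using Hl Hs HF HK Hp.
  intros Hx. pose proof (fp_2 _ _ _ _ Hp) as H2. split; [now apply Fh_basin|].
  destruct (Rle_lt_dec x x2) as [H|H].
  - apply Rle_lt_trans with x2; auto. rewrite <- Fh_2.
    destruct H as [H|H]; [left; now apply Fh_inc|right; now rewrite H].
  - pose proof (Fh_right x H). lra.
Qed.

Lemma iter_F_eq x m : x1 < x < l ->
  Nat.iter m F x = Nat.iter m Fh x /\ x1 < Nat.iter m F x < l.
Proof using Hl Hs HF HK Hp.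
  intros Hx. induction m as [|m [E IH]]; simpl; [auto|].
  pose proof (fp_1 _ _ _ _ Hp). rewrite <- E, Fh_eq by lra. split; auto.
  rewrite <- (Fh_eq (Nat.iter m F x)) by lra. now apply basin_stable.
Qed.

(** Points at or below [x1] stay there by monotonicity; above [x1] the orbits
    approach [x2] monotonically. *)
Lemma basin_attraction_iff x :
  basin_attraction F (sym_itv l) x2 x <-> x1 < x < l.
Proof using Hl Hs HF HK Hp.
  pose proof (fp_1 _ _ _ _ Hp) as H1. split.
  - intros [HN Hlim]. pose proof (HN 0%nat) as H0. unfold sym_itv in H0. simpl in H0.
    split; [|lra]. apply Rnot_le_lt. intros Hle.
    assert (Hi : forall m, Nat.iter m F x <= x1).
    { induction m as [|m IH]; simpl; auto.
      pose proof (HN m) as Hm. unfold sym_itv in Hm. rewrite <- Fh_eq by lra.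
      rewrite <- Fh_1. destruct IH as [IH|IH]; [left; now apply Fh_inc|right; now rewrite IH]. }
    pose proof (is_lim_seq_le _ (fun _ => x1) _ (Finite _) Hi Hlim (is_lim_seq_const x1)) as H.
    simpl in H. pose proof (fp_12 _ _ _ _ Hp). lra.
  - intros Hx. split.
    + intros m. destruct (iter_F_eq x m Hx) as [_ H]. unfold sym_itv. lra.
    + apply is_lim_seq_ext with (u := fun m => Nat.iter m Fh x).
      * intros m. symmetry. now apply iter_F_eq.
      * apply Fh_limit. lra.
Qed.

Lemma basin_repulsion_iff x :
  basin_repulsion F (sym_itv l) x1 x <-> - l < x < x2.
Proof using Hl Hs HF HK Hp.
  pose proof (fp_1 _ _ _ _ Hp) as H1. pose proof (fp_2 _ _ _ _ Hp) as H2.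
  pose proof (fp_12 _ _ _ _ Hp) as H12. split.
  - intros [u [Hu0 [Hu Hlim]]].
    destruct (Hu 0%nat) as [HN _]. rewrite Hu0 in HN. unfold sym_itv in HN.
    split; [lra|]. apply Rnot_le_lt. intros Hle.
    assert (Hi : forall m, x2 <= u m).
    { induction m as [|m IH]; [lra|].
      destruct (Hu m) as [_ E]. destruct (Hu (S m)) as [Hm _]. unfold sym_itv in Hm.
      rewrite <- Fh_eq in E by lra. apply Rnot_lt_le. intros Hlt.
      apply Fh_lower in Hlt. lra. }
    pose proof (is_lim_seq_le (fun _ => x2) _ (Finite _) _ Hi (is_lim_seq_const x2) Hlim) as H.
    simpl in H. lra.
  - intros Hx. exists (fun m => Nat.iter m K x).
    assert (Hin : forall m, - l < Nat.iter m K x < x2).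
    { induction m as [|m IH]; simpl; auto. split; [|apply K_lower; lra].
      destruct (Rlt_le_dec x1 (Nat.iter m K x)) as [H|H].
      - apply K_basin in H. lra.
      - assert (HKy : K (Nat.iter m K x) <= x1).
        { rewrite <- K_1. destruct H as [H|H]; [left; now apply K_inc|right; now rewrite H]. }
        destruct HKy as [HKy|HKy]; [|lra].
        pose proof (Fh_left _ HKy) as E. rewrite FhK in E. lra. }
    split; [reflexivity|]. split; [|apply K_limit; lra].
    intros m. split; [unfold sym_itv; pose proof (Hin m); lra|].
    pose proof (Hin (S m)). rewrite <- Fh_eq by lra. apply FhK.
Qed.

Lemma stable_2 : stable F x2.
Proof using Hl Hs HF HK Hp.
  intros eps He. pose proof (fp_1 _ _ _ _ Hp) as H1.
  pose proof (fp_2 _ _ _ _ Hp) as H2. pose proof (fp_12 _ _ _ _ Hp) as H12.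
  set (d := Rmin eps (Rmin (x2 - x1) (l - x2))).
  assert (Hd : 0 < d /\ d <= eps /\ d <= x2 - x1 /\ d <= l - x2).
  { unfold d. solve_min. }
  exists d. split; [lra|]. intros x m Hx.
  apply Rlt_le_trans with d; [|lra].
  induction m as [|m IH]; simpl; auto.
  set (y := Nat.iter m F x) in *. apply Rabs_def2 in IH.
  rewrite <- Fh_eq by lra.
  destruct (Rtotal_order y x2) as [H|[H|H]].
  - pose proof (Fh_between y ltac:(lra)). pose proof (Fh_lower y H). apply Rabs_def1; lra.
  - rewrite H, Fh_2, Rminus_diag, Rabs_R0. lra.
  - pose proof (Fh_right y H). pose proof (Fh_inc _ _ H) as Hi. rewrite Fh_2 in Hi.
    apply Rabs_def1; lra.
Qed.

Lemma unstable_1 : ~ stable F x1.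
Proof using Hl Hs HF HK Hp.
  intros Hst. pose proof (fp_1 _ _ _ _ Hp) as H1.
  pose proof (fp_2 _ _ _ _ Hp) as H2. pose proof (fp_12 _ _ _ _ Hp) as H12.
  destruct (Hst ((x2 - x1) / 2)) as [d [Hd Hd']]; [lra|].
  set (c := Rmin (d / 2) ((x2 - x1) / 2)). set (x := x1 + c).
  assert (Hc : 0 < c /\ c <= d / 2 /\ c <= (x2 - x1) / 2) by (unfold c; solve_min).
  assert (Hx : x1 < x < l) by (unfold x; lra).
  assert (Hlim : is_lim_seq (fun m => Nat.iter m F x) x2) by (apply basin_attraction_iff; auto).
  assert (Hb : forall m, Nat.iter m F x <= x1 + (x2 - x1) / 2).
  { intros m. specialize (Hd' x m ltac:(unfold x; apply Rabs_def1; lra)).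
    apply Rabs_def2 in Hd'. lra. }
  pose proof (is_lim_seq_le _ (fun _ => x1 + (x2 - x1) / 2) _ (Finite _) Hb Hlim
    (is_lim_seq_const _)) as H'.
  simpl in H'. lra.
Qed.
End Basins.

Section TwoMaps.
Variables (k : nat) (e l l' : R) (F G : R -> R) (x1 x2 y1 y2 : R).
Hypothesis Hs : slack (S (S k)) e.
Hypothesis HF : tame (S (S k)) e l F.
Hypothesis HG : tame (S (S k)) e l' G.
Hypothesis HpF : fixed_pair l F x1 x2.
Hypothesis HpG : fixed_pair l' G y1 y2.

Let Hl : 0 < l := tame_l _ _ _ _ HF.
Let Hl' : 0 < l' := tame_l _ _ _ _ HG.

(** The extensions have the half-lines [(x1, +oo)] and [(y1, +oo)] as basins; a
    conjugacy of these that sends [l] to [l'] maps [(x1, l)] onto [(y1, l')], and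
    these are the basins in the two neighbourhoods. *)
Lemma attracting_conjugacy t : (t <= S (S k))%nat -> Derive F x2 = Derive G y2 ->
  exists h, h x2 = y2 /\ stable F x2 /\ stable G y2 /\
    conjugacy t F (basin_attraction F (sym_itv l) x2)
      G (basin_attraction G (sym_itv l') y2) h.
Proof using Hl Hl' Hs HF HG HpF HpG.
  intros Ht Hmul.
  destruct (ext_global (S k) e l F Hs HF) as [K [HK _]].
  destruct (ext_global (S k) e l' G Hs HG) as [L [HL _]].
  set (Fh := ext (S (S k)) e l F) in *. set (Gh := ext (S (S k)) e l' G) in *.
  pose proof (fp_1 _ _ _ _ HpF). pose proof (fp_12 _ _ _ _ HpF). pose proof (fp_2 _ _ _ _ HpF).
  pose proof (fp_1 _ _ _ _ HpG). pose proof (fp_12 _ _ _ _ HpG). pose proof (fp_2 _ _ _ _ HpG).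
  assert (HDF : Derive Fh x2 = Derive F x2) by (apply ext_derive_eq; auto; apply Rabs_def1; lra).
  assert (HDG : Derive Gh y2 = Derive G y2) by (apply ext_derive_eq; auto; apply Rabs_def1; lra).
  destruct (basin_conjugacy k Fh K Gh L x2 y2 (fun x => x1 < x) (fun y => y1 < y) l l')
    as [h [Hh1 [Hh2 [Hh3 [Hh4 Hh5]]]]]; auto; try apply open_gt; try lra.
  - now apply (Fh_2 (S k) e l F x1 x2).
  - now apply (Fh_2 (S k) e l' G y1 y2).
  - rewrite HDF. apply HpF.
  - intros x. now apply (K_basin (S k) e l F x1 x2).
  - intros x. now apply (K_basin (S k) e l' G y1 y2).
  - intros x. now apply (Fh_basin (S k) e l F x1 x2 K).
  - intros x. now apply (Fh_basin (S k) e l' G y1 y2 L).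
  - intros x Hx. now apply (Fh_limit (S k) e l F x1 x2 K).
  - intros x Hx. now apply (Fh_limit (S k) e l' G y1 y2 L).
  - exists h. split; [exact Hh3|].
    split; [now apply (stable_2 (S k) e l F x1 x2 K)|].
    split; [now apply (stable_2 (S k) e l' G y1 y2 L)|].
    assert (HbF := fun x => basin_attraction_iff (S k) e l F x1 x2 K Hs HF HK HpF x).
    assert (HbG := fun x => basin_attraction_iff (S k) e l' G y1 y2 L Hs HG HL HpG x).
    assert (HI' : forall x, x1 < x -> y1 < h x).
    { intros x Hx. destruct Hh1 as [h' [Hh1 _]]. now apply Hh1. }
    assert (HUV : forall x, x1 < x -> (x1 < x < l <-> y1 < h x < l')).
    { intros x Hx. rewrite <- Hh4.
      pose proof (increasing_lt_iff _ h x l Hh2 Hx ltac:(lra)). pose proof (HI' x Hx). tauto. }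
    split.
    + apply diffeo_ext with (U := fun x => x1 < x < l) (V := fun y => y1 < y < l'); auto.
      apply diffeo_restrict with (s := S (S k)) (I := fun x => x1 < x) (I' := fun y => y1 < y);
        auto; intros; lra.
    + intros x Hx HFx. apply HbF in Hx.
      assert (Hx1 : x1 < x) by lra.
      rewrite <- (Fh_eq (S k) e l F) by (auto; lra). fold Fh. rewrite Hh5 by lra.
      apply (Fh_eq (S k) e l' G); auto. apply (HUV x Hx1) in Hx. lra.
Qed.

(** A repelling point attracts under the inverse map, with the inverse
    multiplier. *)
Lemma repelling_conjugacy t : (t <= S (S k))%nat -> Derive F x1 = Derive G y1 ->
  exists h, h x1 = y1 /\ ~ stable F x1 /\ ~ stable G y1 /\
    conjugacy t F (basin_repulsion F (sym_itv l) x1)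
      G (basin_repulsion G (sym_itv l') y1) h.
Proof using Hl Hl' Hs HF HG HpF HpG.
  intros Ht Hmul.
  destruct (ext_global (S k) e l F Hs HF) as [K [HK _]].
  destruct (ext_global (S k) e l' G Hs HG) as [L [HL _]].
  set (Fh := ext (S (S k)) e l F) in *. set (Gh := ext (S (S k)) e l' G) in *.
  pose proof (fp_1 _ _ _ _ HpF). pose proof (fp_12 _ _ _ _ HpF). pose proof (fp_2 _ _ _ _ HpF).
  pose proof (fp_1 _ _ _ _ HpG). pose proof (fp_12 _ _ _ _ HpG). pose proof (fp_2 _ _ _ _ HpG).
  assert (HDF : Derive Fh x1 = Derive F x1) by (apply ext_derive_eq; auto; apply Rabs_def1; lra).
  assert (HDG : Derive Gh y1 = Derive G y1) by (apply ext_derive_eq; auto; apply Rabs_def1; lra).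
  assert (EF : K x1 = x1) by now apply (K_1 (S k) e l F x1 x2).
  assert (EG : L y1 = y1) by now apply (K_1 (S k) e l' G y1 y2).
  assert (DK : Derive K x1 = / Derive F x1).
  { rewrite (gd_inverse_derive _ _ _ _ HK), EF. now rewrite HDF. }
  assert (DL : Derive L y1 = / Derive G y1).
  { rewrite (gd_inverse_derive _ _ _ _ HL), EG. now rewrite HDG. }
  destruct (basin_conjugacy k K Fh L Gh x1 y1 (fun x => x < x2) (fun y => y < y2) (- l) (- l'))
    as [h [Hh1 [Hh2 [Hh3 [Hh4 Hh5]]]]]; auto; try apply open_lt; try lra;
    try (apply global_diffeo_sym; assumption).
  - now rewrite DK, DL, Hmul.
  - rewrite DK. rewrite <- Rinv_1. pose proof (fp_D1 _ _ _ _ HpF).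
    apply Rinv_lt_contravar; lra.
  - intros x. now apply (Fh_lower (S k) e l F x1 x2 K).
  - intros x. now apply (Fh_lower (S k) e l' G y1 y2 L).
  - intros x. now apply (K_lower (S k) e l F x1 x2).
  - intros x. now apply (K_lower (S k) e l' G y1 y2).
  - intros x Hx. now apply (K_limit (S k) e l F x1 x2 K).
  - intros x Hx. now apply (K_limit (S k) e l' G y1 y2 L).
  - exists h. split; [exact Hh3|].
    split; [now apply (unstable_1 (S k) e l F x1 x2 K)|].
    split; [now apply (unstable_1 (S k) e l' G y1 y2 L)|].
    assert (HbF := fun x => basin_repulsion_iff (S k) e l F x1 x2 K Hs HF HK HpF x).
    assert (HbG := fun x => basin_repulsion_iff (S k) e l' G y1 y2 L Hs HG HL HpG x).
    assert (HI' : forall x, x < x2 -> h x < y2).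
    { intros x Hx. destruct Hh1 as [h' [Hh1 _]]. now apply Hh1. }
    assert (HUV : forall x, x < x2 -> (- l < x < x2 <-> - l' < h x < y2)).
    { intros x Hx. rewrite <- Hh4.
      pose proof (increasing_lt_iff _ h (- l) x Hh2 ltac:(lra) Hx).
      pose proof (HI' x Hx). tauto. }
    split.
    + apply diffeo_ext with (U := fun x => - l < x < x2) (V := fun y => - l' < y < y2); auto.
      apply diffeo_restrict with (s := S (S k)) (I := fun x => x < x2) (I' := fun y => y < y2);
        auto; intros; lra.
    + intros x Hx HFx. apply HbF in Hx. apply HbF in HFx.
      assert (Hx2 : x < x2) by lra.
      rewrite <- (Fh_eq (S k) e l F) in HFx |- * by (auto; lra). fold Fh in HFx |- *.
      pose proof (Hh5 (Fh x) ltac:(lra)) as E. rewrite (gd_KF _ _ _ HK) in E.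
      apply (HUV x Hx2) in Hx.
      rewrite <- (Fh_eq (S k) e l' G) by (auto; lra). fold Gh. rewrite E.
      symmetry. apply (gd_FK _ _ _ HL).
Qed.
End TwoMaps.

(** * The family near the bifurcation point *)

Definition DX (f : R -> R -> R) (j : nat) (x mu : R) : R :=
  Derive_n (fun z => f z mu) j x.
Definition Dmu (f : R -> R -> R) (x mu : R) : R := Derive (fun m => f x m) mu.

(** The consequences of joint smoothness on a square that the proof relies on: the
    class of the sections in [x], and continuity of the partial derivatives that
    occur in the expansions at the bifurcation point. *)
Record smooth_rect (k : nat) (rho : R) (f : R -> R -> R) : Prop := {
  sr_rho : 0 < rho;
  sr_section : forall mu, Rabs mu < rho ->
    Cn_on (S (S (S k))) (fun x => - rho < x < rho) (fun x => f x mu);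
  sr_DX : forall j x mu, (j <= 3)%nat -> Rabs x < rho -> Rabs mu < rho ->
    continuity_2d_pt (DX f j) x mu;
  sr_ex_mu : forall x mu, Rabs x < rho -> Rabs mu < rho -> ex_derive (fun m => f x m) mu;
  sr_Dmu : forall x mu, Rabs x < rho -> Rabs mu < rho -> continuity_2d_pt (Dmu f) x mu;
  sr_ex_xmu : forall x mu, Rabs x < rho -> Rabs mu < rho ->
    ex_derive (fun m => DX f 1 x m) mu;
  sr_Dxmu : forall x mu, Rabs x < rho -> Rabs mu < rho ->
    continuity_2d_pt (Dmu (DX f 1)) x mu }.

Lemma Cn2_DX n U f j : (j <= n)%nat -> Cn2_on n U f -> Cn2_on (n - j) U (DX f j).
Proof.
  revert n. induction j as [|j IH]; intros n Hj H.
  - now rewrite Nat.sub_0_r.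
  - intros x mu Hx. specialize (IH n ltac:(lia) H x mu Hx).
    replace (n - j)%nat with (S (n - S j)) in IH by lia.
    destruct IH as [_ [_ [_ [H1 _]]]]. exact H1.
Qed.

Lemma Cn2_continuity n U f x mu : Cn2_on n U f -> U (x, mu) -> continuity_2d_pt f x mu.
Proof. intros H Hx. specialize (H x mu Hx). destruct n; apply H. Qed.

Lemma Cn2_section n U f mu : Cn2_on n U f ->
  Cn_on n (fun x => U (x, mu)) (fun x => f x mu).
Proof.
  revert f. induction n as [|n IH]; intros f H.
  - apply Cn_0. intros x Hx. apply continuous_eps. intros eps He.
    destruct (Cn2_continuity _ _ _ _ _ H Hx (mkposreal eps He)) as [d Hd].
    exists d. split; [apply cond_pos|]. intros y Hy. apply Hd; auto.
    rewrite Rminus_diag, Rabs_R0. apply cond_pos.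
  - apply Cn_S. split.
    + intros x Hx. apply (H x mu Hx).
    + apply (IH (fun u v => Derive (fun z => f z v) u)).
      intros x m Hx. apply (H x m Hx).
Qed.

Lemma Cn2_smooth_rect k U f : open U -> U (0, 0) -> Cn2_on (S (S (S k))) U f ->
  exists rho, smooth_rect k rho f /\
    forall x mu, Rabs x < rho -> Rabs mu < rho -> U (x, mu).
Proof.
  intros HU H0 Hf. destruct (HU (0, 0) H0) as [d Hd].
  assert (HUd : forall x mu, Rabs x < d -> Rabs mu < d -> U (x, mu)).
  { intros x mu Hx Hmu. apply Hd. split.
    - change (Rabs (x - 0) < d). now rewrite Rminus_0_r.
    - change (Rabs (mu - 0) < d). now rewrite Rminus_0_r. }
  exists d. split; auto. constructor.
  - apply cond_pos.
  - intros mu Hmu. apply Cn_subset with (U := fun x => U (x, mu)).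
    + intros x Hx. cbv beta in Hx. apply HUd; auto. apply Rabs_def1; lra.
    + now apply Cn2_section.
  - intros j x mu Hj Hx Hmu.
    apply (Cn2_continuity (S (S (S k)) - j) U); auto. apply Cn2_DX; auto. lia.
  - intros x mu Hx Hmu. apply (Hf x mu). auto.
  - intros x mu Hx Hmu. apply (Hf x mu). auto.
  - intros x mu Hx Hmu.
    pose proof (Cn2_DX (S (S (S k))) U f 1 ltac:(lia) Hf x mu (HUd x mu Hx Hmu)) as H. apply H.
  - intros x mu Hx Hmu.
    pose proof (Cn2_DX (S (S (S k))) U f 1 ltac:(lia) Hf x mu (HUd x mu Hx Hmu)) as H. apply H.
Qed.

Lemma cont2_eps g x y eps : continuity_2d_pt g x y -> 0 < eps -> exists d, 0 < d /\
  forall u v, Rabs (u - x) < d -> Rabs (v - y) < d -> Rabs (g u v - g x y) < eps.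
Proof.
  intros H He. destruct (H (mkposreal eps He)) as [d Hd].
  exists d. split; [apply cond_pos|]. exact Hd.
Qed.

Lemma cont2_0_eps g eps : continuity_2d_pt g 0 0 -> 0 < eps -> exists d, 0 < d /\
  forall u v, Rabs u < d -> Rabs v < d -> Rabs (g u v - g 0 0) < eps.
Proof.
  intros H He. destruct (cont2_eps g 0 0 eps H He) as [d [Hd Hd']].
  exists d. split; auto. intros u v Hu Hv. apply Hd'; now rewrite Rminus_0_r.
Qed.

Section Family.
Variables (k : nat) (rho : R) (f : R -> R -> R).
Hypothesis Hsr : smooth_rect k rho f.
Hypothesis Hf0 : f 0 0 = 0.
Hypothesis Hfx : DX f 1 0 0 = 1.
Hypothesis Hfmu : 0 < Dmu f 0 0.
Hypothesis Hfxx : DX f 2 0 0 < 0.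

Let Hrho : 0 < rho := sr_rho _ _ _ Hsr.

Lemma DX_derive j x mu : (j <= 2)%nat -> Rabs x < rho -> Rabs mu < rho ->
  is_derive (fun z => DX f j z mu) x (DX f (S j) x mu).
Proof using Hsr.
  intros Hj Hx Hmu. apply Derive_correct.
  apply Rabs_def2 in Hx.
  exact (proj1 (sr_section _ _ _ Hsr mu Hmu x (S j) ltac:(lra) ltac:(lia))).
Qed.

Lemma f_mu_continuous x mu : Rabs x < rho -> Rabs mu < rho ->
  continuous (fun m => f x m) mu.
Proof using Hsr.
  intros Hx Hmu. apply (ex_derive_continuous (fun m => f x m)).
  now apply (sr_ex_mu _ _ _ Hsr).
Qed.

Lemma good_rect e : 0 < e -> exists d, 0 < d <= rho /\
  forall x mu, Rabs x < d -> Rabs mu < d ->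
    Rabs (DX f 1 x mu - 1) < e /\ DX f 2 x mu < 0 /\ 0 < Dmu f x mu.
Proof using Hsr Hfx Hfmu Hfxx.
  intros He. assert (H0 : Rabs 0 < rho) by (rewrite Rabs_R0; apply Hsr).
  destruct (cont2_0_eps _ e (sr_DX _ _ _ Hsr 1 0 0 ltac:(lia) H0 H0) He) as [d1 [Hd1 H1]].
  destruct (cont2_0_eps _ (- DX f 2 0 0) (sr_DX _ _ _ Hsr 2 0 0 ltac:(lia) H0 H0))
    as [d2 [Hd2 H2]]; [lra|].
  destruct (cont2_0_eps _ (Dmu f 0 0) (sr_Dmu _ _ _ Hsr 0 0 H0 H0) Hfmu) as [d3 [Hd3 H3]].
  set (d := Rmin rho (Rmin d1 (Rmin d2 d3))).
  assert (Hd : 0 < d /\ d <= rho /\ d <= d1 /\ d <= d2 /\ d <= d3).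
  { unfold d. solve_min. }
  exists d. split; [lra|]. intros x mu Hx Hmu.
  specialize (H1 x mu ltac:(lra) ltac:(lra)). specialize (H2 x mu ltac:(lra) ltac:(lra)).
  specialize (H3 x mu ltac:(lra) ltac:(lra)). rewrite Hfx in H1.
  apply Rabs_def2 in H2. apply Rabs_def2 in H3. split; [auto|]. split; lra.
Qed.

(** At [mu = 0] concavity puts [f] strictly below the diagonal, with slope less
    than [1] at [l] and greater than [1] at [- l].  These four strict inequalities
    persist for small [mu], and concavity of [f (., mu)] carries them from the two
    points to everything beyond. *)
Lemma family_tame e : 0 < e <= / 10 -> exists l dl, 0 < l /\ 0 < dl /\
  3 * l < rho /\ dl <= rho /\
  (forall mu, Rabs mu < dl -> tame (S (S (S k))) e l (fun x => f x mu)) /\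
  (forall x mu1 mu2, Rabs x < 3 * l -> - dl < mu1 < mu2 -> mu2 < dl -> f x mu1 < f x mu2) /\
  (forall x, Rabs x < 3 * l -> x <> 0 -> f x 0 < x).
Proof using Hsr Hf0 Hfx Hfmu Hfxx Hrho.
  intros He. destruct (good_rect e) as [d [Hd H]]; [lra|].
  set (l := d / 6).
  assert (Hl : 0 < l /\ 3 * l < d /\ 3 * l < rho) by (unfold l; lra).
  assert (H0 : Rabs 0 < d) by (rewrite Rabs_R0; lra).
  assert (Hcv : convex (fun x => - (3 * l) < x < 3 * l)) by (intros a b c; lra).
  assert (HD1 : forall mu, Rabs mu < d -> forall t, - (3 * l) < t < 3 * l ->
    is_derive (fun z => f z mu - z) t (DX f 1 t mu - 1)).
  { intros mu Hmu t Ht. apply derive_minus.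
    - apply (DX_derive 0); [lia| |lra]. apply Rabs_def1; lra.
    - apply derive_id. }
  assert (Hdec : forall mu x y, Rabs mu < d -> - (3 * l) < x < y -> y < 3 * l ->
    DX f 1 y mu < DX f 1 x mu).
  { intros mu x y Hmu Hx Hy.
    destruct (MVT_on _ (fun z => DX f 1 z mu) (fun z => DX f 2 z mu) x y Hcv) as [c [Hc E]];
      try lra.
    - intros t Ht. apply DX_derive; [lia| |lra]. apply Rabs_def1; lra.
    - destruct (H c mu) as [_ [Hn _]]; auto; [apply Rabs_def1; lra|].
      assert (0 < - DX f 2 c mu * (y - x)) by (apply Rmult_lt_0_compat; lra). lra. }
  assert (Hbelow0 : forall x, Rabs x < 3 * l -> x <> 0 -> f x 0 < x).
  { intros x Hx Hx0. apply Rabs_def2 in Hx.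
    destruct (Rdichotomy _ _ Hx0) as [Hn|Hp].
    - destruct (MVT_on _ _ _ x 0 Hcv (HD1 0 H0)) as [c [Hc E]]; try lra.
      rewrite Hf0 in E. pose proof (Hdec 0 c 0 H0 ltac:(lra) ltac:(lra)) as Hs.
      rewrite Hfx in Hs.
      assert (0 < (DX f 1 c 0 - 1) * (0 - x)) by (apply Rmult_lt_0_compat; lra). lra.
    - destruct (MVT_on _ _ _ 0 x Hcv (HD1 0 H0)) as [c [Hc E]]; try lra.
      rewrite Hf0 in E. pose proof (Hdec 0 0 c H0 ltac:(lra) ltac:(lra)) as Hs.
      rewrite Hfx in Hs.
      assert (0 < (1 - DX f 1 c 0) * (x - 0)) by (apply Rmult_lt_0_compat; lra). lra. }
  assert (Hpert : forall g v c, continuity_2d_pt g v 0 -> g v 0 < c ->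
    exists q, 0 < q /\ forall mu, Rabs mu < q -> g v mu < c).
  { intros g v c Hg Hlt. destruct (cont2_eps g v 0 (c - g v 0) Hg) as [q [Hq Hq']]; [lra|].
    exists q. split; auto. intros mu Hmu.
    specialize (Hq' v mu). rewrite Rminus_diag, Rabs_R0, Rminus_0_r in Hq'.
    specialize (Hq' Hq Hmu). apply Rabs_def2 in Hq'. lra. }
  assert (Hr0 : Rabs 0 < rho) by (rewrite Rabs_R0; lra).
  assert (Hal : Rabs l = l) by (apply Rabs_right; lra).
  assert (Hal' : Rabs (- l) = l) by (rewrite Rabs_Ropp; lra).
  destruct (Hpert (DX f 0) l l) as [q1 [Hq1 Q1]].
  { apply (sr_DX _ _ _ Hsr); first [lia | lra | assumption]. } { apply Hbelow0; lra. }
  destruct (Hpert (DX f 0) (- l) (- l)) as [q2 [Hq2 Q2]].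
  { apply (sr_DX _ _ _ Hsr); first [lia | lra | assumption]. } { apply Hbelow0; lra. }
  destruct (Hpert (DX f 1) l 1) as [q3 [Hq3 Q3]].
  { apply (sr_DX _ _ _ Hsr); first [lia | lra | assumption]. }
  { rewrite <- Hfx. apply Hdec; auto; lra. }
  destruct (Hpert (fun x mu => - DX f 1 x mu) (- l) (- 1)) as [q4 [Hq4 Q4]].
  { apply continuity_2d_pt_opp. apply (sr_DX _ _ _ Hsr); first [lia | lra | assumption]. }
  { pose proof (Hdec 0 (- l) 0 H0 ltac:(lra) ltac:(lra)) as Hs. rewrite Hfx in Hs. lra. }
  destruct (proj1 (continuous_eps _ _) (f_mu_continuous 0 0 Hr0 Hr0) (e * l))
    as [q5 [Hq5 Q5]].
  { apply Rmult_lt_0_compat; lra. }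
  set (dl := Rmin d (Rmin q1 (Rmin q2 (Rmin q3 (Rmin q4 q5))))).
  assert (Hdl : 0 < dl /\ dl <= d /\ dl <= q1 /\ dl <= q2 /\ dl <= q3 /\ dl <= q4 /\ dl <= q5).
  { unfold dl. solve_min. }
  exists l, dl. split; [lra|]. split; [lra|]. split; [lra|]. split; [lra|].
  split; [|split; auto].
  - intros mu Hmu. constructor.
    + lra.
    + apply Cn_subset with (U := fun x => - rho < x < rho); [intros; lra|].
      apply (sr_section _ _ _ Hsr). lra.
    + intros x Hx. left. apply (H x mu); lra.
    + intros x Hx. apply (H x mu); lra.
    + specialize (Q5 mu). rewrite Rminus_0_r, Hf0, Rminus_0_r in Q5.
      left. apply Q5. lra.
    + intros x Hx. specialize (Q1 mu ltac:(lra)). specialize (Q2 mu ltac:(lra)).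
      specialize (Q3 mu ltac:(lra)). specialize (Q4 mu ltac:(lra)).
      unfold DX at 1 in Q1. unfold DX at 1 in Q2. simpl in Q1, Q2.
      destruct (Rle_lt_dec 0 x) as [Hx0|Hx0].
      * rewrite Rabs_right in Hx by lra.
        destruct (Rle_lt_or_eq_dec _ _ (proj1 Hx)) as [Hx1|Hx1]; [|subst x; lra].
        destruct (MVT_on _ _ _ l x Hcv (HD1 mu ltac:(lra))) as [c [Hc E]]; try lra.
        pose proof (Hdec mu l c ltac:(lra) ltac:(lra) ltac:(lra)).
        assert (0 < (1 - DX f 1 c mu) * (x - l)) by (apply Rmult_lt_0_compat; lra). lra.
      * rewrite Rabs_left in Hx by lra.
        destruct (Rle_lt_or_eq_dec _ _ (proj1 Hx)) as [Hx1|Hx1];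
          [|replace x with (- l) by lra; lra].
        destruct (MVT_on _ _ _ x (- l) Hcv (HD1 mu ltac:(lra))) as [c [Hc E]]; try lra.
        pose proof (Hdec mu c (- l) ltac:(lra) ltac:(lra) ltac:(lra)).
        assert (0 < (DX f 1 c mu - 1) * (- l - x)) by (apply Rmult_lt_0_compat; lra). lra.
  - intros x mu1 mu2 Hx Hmu1 Hmu2.
    destruct (MVT_on (fun m => - d < m < d) (fun m => f x m) (fun m => Dmu f x m) mu1 mu2)
      as [c [Hc E]]; try lra.
    + intros a b c; lra.
    + intros t Ht. apply Derive_correct. apply (sr_ex_mu _ _ _ Hsr); [lra|].
      apply Rlt_le_trans with d; [apply Rabs_def1|]; lra.
    + destruct (H x c) as [_ [_ Hp]]; [lra|apply Rabs_def1; lra|].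
      assert (0 < Dmu f x c * (mu2 - mu1)) by (apply Rmult_lt_0_compat; lra). lra.
Qed.
End Family.

Lemma g_derive a nu y : is_derive (fun y => g y nu a) y (1 - 2 * y + 3 * a * y ^ 2).
Proof. unfold g. auto_derive; [exact Logic.I|ring]. Qed.

Lemma Derive_g a nu (y : R) : Derive (fun y => g y nu a) y = 1 - 2 * y + 3 * a * y ^ 2.
Proof. exact (is_derive_unique _ _ _ (g_derive a nu y)). Qed.

Lemma g_derive2 a nu y : Derive_n (fun y => g y nu a) 2 y = - 2 + 6 * a * y.
Proof.
  simpl. rewrite (Derive_ext (fun x => Derive (fun y => g y nu a) x)
    (fun y => 1 - 2 * y + 3 * a * y ^ 2)).
  - apply is_derive_unique. auto_derive; [exact Logic.I|ring].
  - intros t. apply Derive_g.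
Qed.

Lemma Cn_g s (U : R -> Prop) nu a : open U -> Cn_on s U (fun y => g y nu a).
Proof.
  intros HU. unfold g. apply Cn_plus; auto.
  - apply Cn_minus; auto.
    + apply Cn_plus; auto; [now apply Cn_id|now apply Cn_const].
    + apply Cn_pow; auto. now apply Cn_id.
  - apply Cn_scal; auto. apply Cn_pow; auto. now apply Cn_id.
Qed.

(** The interval is chosen for a bound [B] on [a] rather than for [a] itself, since
    [a] will vary with the parameter on a fixed neighbourhood. *)
Lemma g_tame r e B : 0 < e <= / 10 -> 0 <= B -> exists l nu0, 0 < l /\ 0 < nu0 /\
  3 * l < 1 /\ B * l <= / 27 /\
  forall nu a, Rabs nu < nu0 -> Rabs a <= B -> tame r e l (fun y => g y nu a).
Proof.
  intros He HB.
  set (l := Rmin (e / 7) (/ (27 * (B + 1)))).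
  assert (Hi : 0 < / (27 * (B + 1))) by (apply Rinv_0_lt_compat; lra).
  assert (Hl : 0 < l /\ l <= e / 7 /\ B * l <= / 27).
  { split; [unfold l; apply Rmin_pos; lra|]. split; [apply Rmin_l|].
    apply Rle_trans with ((B + 1) * / (27 * (B + 1))).
    - apply Rmult_le_compat; try lra; [unfold l; apply Rmin_glb; lra|apply Rmin_r].
    - right. field. lra. }
  set (nu0 := Rmin (e * l) (l * l / 2)).
  assert (Hll : 0 < l * l) by (apply Rmult_lt_0_compat; lra).
  assert (Hel : 0 < e * l) by (apply Rmult_lt_0_compat; lra).
  assert (Hnu0 : 0 < nu0 /\ nu0 <= e * l /\ nu0 <= l * l / 2).
  { unfold nu0. solve_min. }
  exists l, nu0. repeat (split; [lra|]). intros nu a Hnu Ha.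
  assert (Hal : forall x, Rabs x < 3 * l -> Rabs (a * x) <= / 9).
  { intros x Hx. rewrite Rabs_mult. apply Rle_trans with (B * (3 * l)); [|lra].
    apply Rmult_le_compat; try apply Rabs_pos; lra. }
  constructor.
  - lra.
  - apply Cn_g. apply open_itv.
  - intros x Hx. rewrite Derive_g.
    replace (1 - 2 * x + 3 * a * x ^ 2 - 1) with (x * (- 2 + 3 * (a * x))) by ring.
    rewrite Rabs_mult. apply Rle_trans with (3 * l * (7 / 3)); [|lra].
    apply Rmult_le_compat; try apply Rabs_pos; [lra|].
    specialize (Hal x Hx). apply Rabs_le_between in Hal. apply Rabs_le. lra.
  - intros x Hx. rewrite g_derive2. specialize (Hal x Hx).
    apply Rabs_le_between in Hal. lra.
  - unfold g. replace (0 + nu - 0 ^ 2 + a * 0 ^ 3) with nu by ring. lra.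
  - intros x Hx. unfold g. specialize (Hal x (proj2 Hx)).
    apply Rabs_le_between in Hal. apply Rabs_def2 in Hnu.
    replace (x + nu - x ^ 2 + a * x ^ 3) with (x + (nu - x * x * (1 - a * x))) by ring.
    assert (Hxx : l * l <= x * x).
    { replace (x * x) with (Rabs x * Rabs x) by (rewrite <- Rabs_mult; apply Rabs_right; nra).
      apply Rmult_le_compat; lra. }
    assert (l * l * (8 / 9) <= x * x * (1 - a * x)) by (apply Rmult_le_compat; lra).
    lra.
Qed.

(** * Limits from the right at the bifurcation value *)

Definition lim0 (A : R -> R) (L : R) : Prop := filterlim A (at_right 0) (locally L).

Lemma lim0_eps A L : lim0 A L <->
  forall eps, 0 < eps -> exists d, 0 < d /\ forall mu, 0 < mu < d -> Rabs (A mu - L) < eps.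
Proof.
  split.
  - intros H eps He.
    destruct (proj1 (filterlim_locally _ _) H (mkposreal eps He)) as [d Hd].
    exists d. split; [apply cond_pos|]. intros mu Hmu.
    apply (Hd mu); [|lra]. change (Rabs (mu - 0) < d). rewrite Rminus_0_r, Rabs_right; lra.
  - intros H. apply filterlim_locally. intros eps.
    destruct (H eps (cond_pos eps)) as [d [Hd Hd']]. exists (mkposreal d Hd).
    intros mu Hmu Hp. apply Hd'. split; auto.
    change (Rabs (mu - 0) < d) in Hmu. rewrite Rminus_0_r, Rabs_right in Hmu; lra.
Qed.

Lemma lim0_ext A B L d : 0 < d -> (forall mu, 0 < mu < d -> A mu = B mu) ->
  lim0 A L -> lim0 B L.
Proof.
  intros Hd H HA. apply lim0_eps. intros eps He.
  destruct (proj1 (lim0_eps _ _) HA eps He) as [d' [Hd' Hd'']].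
  exists (Rmin d d'). split; [now apply Rmin_pos|]. intros mu Hmu.
  pose proof (Rmin_l d d'). pose proof (Rmin_r d d').
  rewrite <- H by lra. apply Hd''. lra.
Qed.

Lemma lim0_const c : lim0 (fun _ => c) c.
Proof. apply filterlim_const. Qed.

Lemma lim0_plus A B a b : lim0 A a -> lim0 B b -> lim0 (fun m => A m + B m) (a + b).
Proof.
  intros HA HB. unfold lim0. eapply filterlim_comp_2; [exact HA|exact HB|].
  apply (filterlim_plus (V := R_NormedModule) a b).
Qed.

Lemma lim0_mult A B a b : lim0 A a -> lim0 B b -> lim0 (fun m => A m * B m) (a * b).
Proof.
  intros HA HB. unfold lim0. eapply filterlim_comp_2; [exact HA|exact HB|].
  apply (filterlim_mult (K := R_AbsRing) a b).
Qed.

Lemma lim0_comp A a g : lim0 A a -> continuous g a -> lim0 (fun m => g (A m)) (g a).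
Proof. intros HA Hg. unfold lim0. eapply filterlim_comp; [exact HA|exact Hg]. Qed.

Lemma lim0_opp A a : lim0 A a -> lim0 (fun m => - A m) (- a).
Proof.
  intros HA. apply (lim0_comp A a Ropp HA).
  apply cont_opp. apply continuous_id.
Qed.

Lemma lim0_minus A B a b : lim0 A a -> lim0 B b -> lim0 (fun m => A m - B m) (a - b).
Proof. intros HA HB. apply lim0_plus; auto. now apply lim0_opp. Qed.

Lemma lim0_div A B a b : b <> 0 -> lim0 A a -> lim0 B b -> lim0 (fun m => A m / B m) (a / b).
Proof.
  intros Hb HA HB. apply lim0_mult; auto. apply (lim0_comp B b Rinv HB).
  now apply continuous_Rinv.
Qed.

Lemma lim0_gt A L c : lim0 A L -> c < L -> exists d, 0 < d /\
  forall mu, 0 < mu < d -> c < A mu.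
Proof.
  intros H Hc. destruct (proj1 (lim0_eps _ _) H (L - c)) as [d [Hd Hd']]; [lra|].
  exists d. split; auto. intros mu Hmu. specialize (Hd' mu Hmu). apply Rabs_def2 in Hd'. lra.
Qed.

Lemma lim0_val A a b : lim0 A a -> a = b -> lim0 A b.
Proof. now intros H <-. Qed.

(** * Differentiation along a curve *)

Lemma C1_differentiable g gx x y gy :
  locally_2d (fun u v => is_derive (fun z => g z v) u (gx u v)) x y ->
  is_derive (fun z => g x z) y gy -> continuity_2d_pt gx x y ->
  differentiable_pt_lim g x y (gx x y) gy.
Proof.
  intros H1 H2 H3. apply filterdiff_differentiable_pt_lim.
  eapply filterdiff_ext_lin.
  - apply (is_derive_filterdiff g x y gx gy).
    + destruct H1 as [d Hd]. exists d. intros [u v] [Hu Hv]. apply Hd; [exact Hu|exact Hv].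
    + exact H2.
    + now apply continuity_2d_pt_filterlim.
  - intros [u v]. reflexivity.
Qed.

(** Continuity of [y] first gives the crude bound [y (m + h) - y m = O(h)] from the
    expansion of [g], and this bound turns the error of the expansion into
    [o(h)]. *)
Lemma implicit_derive g (y : R -> R) m A B :
  differentiable_pt_lim g (y m) m A B -> A <> 0 -> continuous y m ->
  locally m (fun t => g (y t) t = 0) -> is_derive y m (- B / A).
Proof.
  intros Hg HA Hy H0. apply is_derive_Reals. intros eps He.
  assert (HaA : 0 < Rabs A) by now apply Rabs_pos_lt.
  set (C := 2 / Rabs A * (Rabs B + Rabs A / 2)).
  assert (HC : 0 <= C).
  { unfold C. apply Rmult_le_pos; [apply Rdiv_le_0_compat; lra|].
    pose proof (Rabs_pos B). lra. }
  set (eta := Rmin (Rabs A / 2) (eps * Rabs A / (2 * (C + 1)))).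
  assert (Heta : 0 < eta /\ eta <= Rabs A / 2 /\ eta <= eps * Rabs A / (2 * (C + 1))).
  { assert (0 < eps * Rabs A / (2 * (C + 1))).
    { apply Rdiv_lt_0_compat; [apply Rmult_lt_0_compat; lra|lra]. }
    unfold eta. split; [apply Rmin_pos; lra|]. split; [apply Rmin_l|apply Rmin_r]. }
  destruct (Hg (mkposreal eta (proj1 Heta))) as [d1 Hd1]. simpl in Hd1.
  destruct (proj1 (continuous_eps y m) Hy d1 (cond_pos d1)) as [d2 [Hd2 Hd2']].
  destruct H0 as [d3 Hd3].
  assert (Hm : 0 < Rmin d1 (Rmin d2 d3)).
  { repeat apply Rmin_pos; auto; apply cond_pos. }
  exists (mkposreal _ Hm). simpl. intros h Hh0 Hh.
  destruct (Rmin_Rgt_l _ _ _ Hh) as [Hh1 Hh2].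
  destruct (Rmin_Rgt_l _ _ _ Hh2) as [Hh3 Hh4].
  assert (E1 : g (y (m + h)) (m + h) = 0).
  { apply Hd3. change (Rabs (m + h - m) < d3). now replace (m + h - m) with h by ring. }
  assert (E0 : g (y m) m = 0).
  { apply Hd3. change (Rabs (m - m) < d3). rewrite Rminus_diag, Rabs_R0. apply cond_pos. }
  set (dy := y (m + h) - y m).
  specialize (Hd1 (y (m + h)) (m + h)).
  replace (m + h - m) with h in Hd1 by ring. fold dy in Hd1.
  rewrite E1, E0 in Hd1.
  assert (Hdy : Rabs dy < d1).
  { apply Hd2'. now replace (m + h - m) with h by ring. }
  specialize (Hd1 Hdy Hh1).
  assert (Hmax : Rmax (Rabs dy) (Rabs h) <= Rabs dy + Rabs h).
  { pose proof (Rabs_pos dy). pose proof (Rabs_pos h). apply Rmax_lub; lra. }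
  assert (Hlin : Rabs (A * dy + B * h) <= eta * (Rabs dy + Rabs h)).
  { replace (A * dy + B * h) with (- (0 - 0 - (A * dy + B * h))) by ring.
    rewrite Rabs_Ropp. apply Rle_trans with (1 := Hd1).
    apply Rmult_le_compat_l; lra. }
  assert (Hah : 0 < Rabs h) by now apply Rabs_pos_lt.
  assert (Hdyb : Rabs dy <= C * Rabs h).
  { assert (Ht : Rabs A * Rabs dy <= Rabs (A * dy + B * h) + Rabs B * Rabs h).
    { rewrite <- !Rabs_mult.
      replace (A * dy) with ((A * dy + B * h) + - (B * h)) at 1 by ring.
      eapply Rle_trans; [apply Rabs_triang|]. rewrite Rabs_Ropp. lra. }
    assert (eta * (Rabs dy + Rabs h) <= Rabs A / 2 * (Rabs dy + Rabs h)).
    { apply Rmult_le_compat_r; [pose proof (Rabs_pos dy); lra|lra]. }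
    assert (Rabs A / 2 * Rabs dy <= (Rabs B + Rabs A / 2) * Rabs h) by lra.
    apply Rmult_le_reg_l with (Rabs A / 2); [lra|].
    apply Rle_trans with (1 := H0). unfold C. right. field. lra. }
  replace (dy / h - - B / A) with ((A * dy + B * h) / (A * h)) by (field; auto).
  rewrite Rabs_div, Rabs_mult by (apply Rmult_integral_contrapositive; auto).
  apply Rle_lt_trans with (eta * ((C + 1) * Rabs h) / (Rabs A * Rabs h)).
  { apply Rmult_le_compat_r.
    - left. apply Rinv_0_lt_compat, Rmult_lt_0_compat; lra.
    - apply Rle_trans with (1 := Hlin). apply Rmult_le_compat_l; lra. }
  replace (eta * ((C + 1) * Rabs h) / (Rabs A * Rabs h)) with (eta * ((C + 1) / Rabs A))
    by (field; split; lra).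
  apply Rle_lt_trans with (eps * Rabs A / (2 * (C + 1)) * ((C + 1) / Rabs A)).
  { apply Rmult_le_compat_r; [apply Rdiv_le_0_compat; lra|lra]. }
  replace (eps * Rabs A / (2 * (C + 1)) * ((C + 1) / Rabs A)) with (eps / 2)
    by (field; split; lra).
  lra.
Qed.

Lemma quadratic_form_pos a b : 0 < a -> 0 < a * a + a * b + b * b.
Proof.
  intros Ha. replace (a * a + a * b + b * b) with ((a + 2 * b) ^ 2 / 4 + 3 / 4 * (a * a)) by field.
  pose proof (pow2_ge_0 (a + 2 * b)). assert (0 < a * a) by now apply Rmult_lt_0_compat. lra.
Qed.

(** * The two fixed points as functions of the parameter *)

Section Curves.
Variables (k : nat) (rho l dl : R) (f : R -> R -> R) (x1 x2 : R -> R).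
Hypothesis Hsr : smooth_rect k rho f.
Hypothesis Hfx : DX f 1 0 0 = 1.
Hypothesis Hfxx : DX f 2 0 0 < 0.
Hypothesis Hl : 0 < l.
Hypothesis Hdl : 0 < dl.
Hypothesis Hlr : 3 * l < rho.
Hypothesis Hdr : dl <= rho.
Hypothesis Hbelow : forall x, Rabs x < 3 * l -> x <> 0 -> f x 0 < x.
Hypothesis Hsign : forall mu, 0 < mu < dl -> x1 mu < 0 < x2 mu.
Hypothesis Hfix : forall mu, 0 < mu < dl -> fixed_pair l (fun x => f x mu) (x1 mu) (x2 mu).

Let e1 := fun mu => DX f 1 (x1 mu) mu - 1.
Let e2 := fun mu => DX f 1 (x2 mu) mu - 1.

Lemma above_between mu z : 0 < mu < dl -> - l <= z <= l -> z < f z mu -> x1 mu < z < x2 mu.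
Proof using Hfix.
  intros Hmu Hz H. destruct (Hfix mu Hmu) as [H1 H2 H3 H4 H5 H6 H7 H8 _ _].
  split; apply Rnot_le_lt; intros [Hle|Hle].
  - specialize (H7 z ltac:(lra)). lra.
  - subst z. lra.
  - specialize (H8 z ltac:(lra)). lra.
  - subst z. lra.
Qed.

Lemma below_outside mu z : 0 < mu < dl -> f z mu < z -> z < x1 mu \/ x2 mu < z.
Proof using Hfix.
  intros Hmu H. destruct (Hfix mu Hmu) as [H1 H2 H3 H4 H5 H6 H7 H8 _ _].
  destruct (Rtotal_order z (x1 mu)) as [A|[A|A]]; auto; [subst z; lra|].
  destruct (Rtotal_order z (x2 mu)) as [B|[B|B]]; auto; [|subst z; lra].
  specialize (H6 z ltac:(lra)). lra.
Qed.

Lemma in_rect mu x : 0 < mu < dl -> - l <= x <= l -> Rabs x < rho /\ Rabs mu < rho.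
Proof using Hl Hlr Hdr. intros Hmu Hx. split; apply Rabs_def1; lra. Qed.

Lemma sign_persist mu z c : 0 < mu < dl -> - l <= z <= l ->
  (f z mu < c -> exists d, 0 < d /\ forall m, Rabs (m - mu) < d -> f z m < c) /\
  (c < f z mu -> exists d, 0 < d /\ forall m, Rabs (m - mu) < d -> c < f z m).
Proof using Hsr Hl Hlr Hdr.
  intros Hmu Hz. destruct (in_rect mu z Hmu Hz) as [R1 R2].
  pose proof (f_mu_continuous k rho f Hsr z mu R1 R2) as Hc.
  split; intros H.
  - destruct (proj1 (continuous_eps _ _) Hc (c - f z mu)) as [d [Hd Hd']]; [lra|].
    exists d. split; auto. intros m Hm. specialize (Hd' m Hm). apply Rabs_def2 in Hd'. lra.
  - destruct (proj1 (continuous_eps _ _) Hc (f z mu - c)) as [d [Hd Hd']]; [lra|].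
    exists d. split; auto. intros m Hm. specialize (Hd' m Hm). apply Rabs_def2 in Hd'. lra.
Qed.

(** The signs of [f z mu - z] at points close to the fixed points on either side
    persist for nearby parameters and trap the fixed points. *)
Lemma fixed_continuous mu : 0 < mu < dl -> continuous x1 mu /\ continuous x2 mu.
Proof using Hsr Hl Hlr Hdr Hfix.
  intros Hmu.
  destruct (Hfix mu Hmu) as [H1 H2 H3 H4 H5 H6 H7 H8 _ _].
  destruct (open_eps _ mu (open_itv 0 dl) Hmu) as [d0 [Hd0 Hd0']].
  assert (Hgen : forall eps, 0 < eps -> exists d, 0 < d /\ forall m, Rabs (m - mu) < d ->
    Rabs (x1 m - x1 mu) < eps /\ Rabs (x2 m - x2 mu) < eps).
  { intros eps He.
    set (c := Rmin (eps / 2) (Rmin ((x2 mu - x1 mu) / 2) (Rmin (x1 mu + l) (l - x2 mu)))).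
    assert (Hc : 0 < c /\ c <= eps / 2 /\ c <= (x2 mu - x1 mu) / 2
                 /\ c <= x1 mu + l /\ c <= l - x2 mu).
    { unfold c. solve_min. }
    destruct (proj1 (sign_persist mu (x1 mu - c) (x1 mu - c) Hmu ltac:(lra))) as [d1 [Hd1 D1]].
    { apply H7. lra. }
    destruct (proj2 (sign_persist mu (x1 mu + c) (x1 mu + c) Hmu ltac:(lra))) as [d2 [Hd2 D2]].
    { destruct (Rle_lt_or_eq_dec c ((x2 mu - x1 mu) / 2)); [lra|apply H6; lra|apply H6; lra]. }
    destruct (proj2 (sign_persist mu (x2 mu - c) (x2 mu - c) Hmu ltac:(lra))) as [d3 [Hd3 D3]].
    { apply H6; lra. }
    destruct (proj1 (sign_persist mu (x2 mu + c) (x2 mu + c) Hmu ltac:(lra))) as [d4 [Hd4 D4]].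
    { apply H8. lra. }
    set (d := Rmin d0 (Rmin d1 (Rmin d2 (Rmin d3 d4)))).
    assert (Hd : 0 < d /\ d <= d0 /\ d <= d1 /\ d <= d2 /\ d <= d3 /\ d <= d4).
    { unfold d. solve_min. }
    exists d. split; [lra|]. intros m Hm.
    assert (Hm0 : 0 < m < dl) by (apply Hd0'; lra).
    pose proof (above_between m (x1 mu + c) Hm0 ltac:(lra) (D2 m ltac:(lra))).
    pose proof (above_between m (x2 mu - c) Hm0 ltac:(lra) (D3 m ltac:(lra))).
    pose proof (below_outside m (x1 mu - c) Hm0 (D1 m ltac:(lra))).
    pose proof (below_outside m (x2 mu + c) Hm0 (D4 m ltac:(lra))).
    split; apply Rabs_def1; lra. }
  split; apply continuous_eps; intros eps He; destruct (Hgen eps He) as [d [Hd Hd']];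
    exists d; (split; [auto|]); intros m Hm; now apply Hd'.
Qed.

Lemma fixed_limit eps : 0 < eps -> exists d, 0 < d <= dl /\ forall mu, 0 < mu < d ->
  - eps < x1 mu < 0 /\ 0 < x2 mu < eps.
Proof using Hsr Hl Hdl Hlr Hdr Hbelow Hsign Hfix.
  intros He. set (c := Rmin (eps / 2) l).
  assert (Hc : 0 < c /\ c < eps /\ c <= l).
  { unfold c. solve_min. }
  assert (Hper : forall z, Rabs z = c -> exists d, 0 < d /\ forall mu, Rabs mu < d -> f z mu < z).
  { intros z Hz. assert (Hlt : f z 0 < z).
    { apply Hbelow; [lra|]. intros ->. rewrite Rabs_R0 in Hz. lra. }
    pose proof (f_mu_continuous k rho f Hsr z 0 ltac:(lra) ltac:(rewrite Rabs_R0; lra)) as Hcz.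
    destruct (proj1 (continuous_eps _ _) Hcz (z - f z 0)) as [d [Hd Hd']]; [lra|].
    exists d. split; auto. intros mu Hmu. specialize (Hd' mu). rewrite Rminus_0_r in Hd'.
    specialize (Hd' Hmu). apply Rabs_def2 in Hd'. lra. }
  destruct (Hper c) as [d1 [Hd1 D1]]; [apply Rabs_right; lra|].
  destruct (Hper (- c)) as [d2 [Hd2 D2]]; [rewrite Rabs_Ropp; apply Rabs_right; lra|].
  exists (Rmin dl (Rmin d1 d2)).
  assert (Hm : 0 < Rmin dl (Rmin d1 d2)) by (repeat apply Rmin_pos; lra).
  pose proof (Rmin_l dl (Rmin d1 d2)). pose proof (Rmin_r dl (Rmin d1 d2)).
  pose proof (Rmin_l d1 d2). pose proof (Rmin_r d1 d2).
  split; [lra|]. intros mu Hmu.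
  assert (Hmu' : 0 < mu < dl) by lra.
  specialize (Hsign mu Hmu').
  pose proof (below_outside mu c Hmu' (D1 mu ltac:(rewrite Rabs_right; lra))).
  pose proof (below_outside mu (- c) Hmu' (D2 mu ltac:(rewrite Rabs_right; lra))).
  lra.
Qed.

Lemma curve_limit (G : R -> R -> R) (A : R -> R) :
  continuity_2d_pt G 0 0 ->
  (forall mu, 0 < mu < dl -> exists xi, x1 mu <= xi <= x2 mu /\ A mu = G xi mu) ->
  lim0 A (G 0 0).
Proof using Hsr Hl Hdl Hlr Hdr Hbelow Hsign Hfix.
  intros HG HA. apply lim0_eps. intros eps He.
  destruct (cont2_0_eps G eps HG He) as [d [Hd Hd']].
  destruct (fixed_limit d Hd) as [d1 [Hd1 D1]].
  exists (Rmin d d1). split; [apply Rmin_pos; lra|]. intros mu Hmu.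
  pose proof (Rmin_l d d1). pose proof (Rmin_r d d1).
  destruct (HA mu) as [xi [Hxi ->]]; [lra|].
  specialize (D1 mu ltac:(lra)). apply Hd'; apply Rabs_def1; lra.
Qed.

Lemma e1_pos mu : 0 < mu < dl -> 0 < e1 mu.
Proof using Hfix.
  intros Hmu. pose proof (fp_D1 _ _ _ _ (Hfix mu Hmu)) as H.
  unfold e1. change (DX f 1 (x1 mu) mu) with (Derive (fun x => f x mu) (x1 mu)). lra.
Qed.

Lemma e2_neg mu : 0 < mu < dl -> e2 mu < 0.
Proof using Hfix.
  intros Hmu. pose proof (fp_D2 _ _ _ _ (Hfix mu Hmu)) as H.
  unfold e2. change (DX f 1 (x2 mu) mu) with (Derive (fun x => f x mu) (x2 mu)). lra.
Qed.

(** Implicit differentiation of [f (x mu) mu = x mu], then the chain rule for the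
    multiplier. *)
Lemma branch_derive (x : R -> R) mu :
  0 < mu < dl -> continuous x mu ->
  (forall m, 0 < m < dl -> - l < x m < l /\ f (x m) m = x m) ->
  DX f 1 (x mu) mu - 1 <> 0 ->
  is_derive x mu (- Dmu f (x mu) mu / (DX f 1 (x mu) mu - 1)) /\
  is_derive (fun m => DX f 1 (x m) m - 1) mu
    (DX f 2 (x mu) mu * (- Dmu f (x mu) mu / (DX f 1 (x mu) mu - 1))
     + Dmu (DX f 1) (x mu) mu).
Proof using Hsr Hl Hlr Hdr.
  intros Hmu Hc Hx Hne.
  destruct (in_rect mu (x mu) Hmu ltac:(specialize (Hx mu Hmu); lra)) as [R1 R2].
  assert (Hloc : forall j, (j <= 2)%nat ->
    locally_2d (fun u v => is_derive (fun z => DX f j z v) u (DX f (S j) u v)) (x mu) mu).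
  { intros j Hj.
    assert (Hm : 0 < Rmin (rho - Rabs (x mu)) (rho - Rabs mu)) by (apply Rmin_pos; lra).
    exists (mkposreal _ Hm). simpl. intros u v Hu Hv.
    pose proof (Rmin_l (rho - Rabs (x mu)) (rho - Rabs mu)).
    pose proof (Rmin_r (rho - Rabs (x mu)) (rho - Rabs mu)).
    pose proof (Rabs_triang (u - x mu) (x mu)) as T1.
    pose proof (Rabs_triang (v - mu) mu) as T2.
    replace (u - x mu + x mu) with u in T1 by ring.
    replace (v - mu + mu) with v in T2 by ring.
    apply (DX_derive k rho f Hsr); auto; lra. }
  assert (Hxd : is_derive x mu (- Dmu f (x mu) mu / (DX f 1 (x mu) mu - 1))).
  { apply (implicit_derive (fun u v => f u v - u)); auto.
    - apply (C1_differentiable (fun u v => f u v - u) (fun u v => DX f 1 u v - 1)).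
      + destruct (Hloc 0%nat ltac:(lia)) as [d Hd]. exists d. intros u v Hu Hv.
        apply derive_minus; [exact (Hd u v Hu Hv)|].
        apply derive_id.
      + eapply is_derive_eq.
        * apply derive_minus.
          -- apply Derive_correct. now apply (sr_ex_mu _ _ _ Hsr).
          -- apply derive_const.
        * change (Dmu f (x mu) mu - 0 = Dmu f (x mu) mu). ring.
      + apply continuity_2d_pt_minus; [|apply continuity_2d_pt_const].
        apply (sr_DX _ _ _ Hsr); auto; lia.
    - apply filter_imp with (2 := open_itv 0 dl mu Hmu). intros t Ht.
      destruct (Hx t Ht) as [_ E]. lra. }
  split; auto.
  eapply is_derive_eq.
  - apply derive_minus.
    + apply is_derive_Reals.
      apply (derivable_pt_lim_comp_2d (DX f 1) x (fun m => m)).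
      * apply (C1_differentiable (DX f 1) (DX f 2)).
        -- apply (Hloc 1%nat). lia.
        -- apply Derive_correct. now apply (sr_ex_xmu _ _ _ Hsr).
        -- apply (sr_DX _ _ _ Hsr); auto.
      * apply is_derive_Reals. exact Hxd.
      * apply derivable_pt_lim_id.
    + apply derive_const.
  - change (DX f 2 (x mu) mu * (- Dmu f (x mu) mu / (DX f 1 (x mu) mu - 1))
      + Dmu (DX f 1) (x mu) mu * 1 - 0
      = DX f 2 (x mu) mu * (- Dmu f (x mu) mu / (DX f 1 (x mu) mu - 1))
      + Dmu (DX f 1) (x mu) mu). ring.
Qed.

Let P := Dmu f 0 0 * DX f 2 0 0.

Lemma on_branch (x : R -> R) G : (forall mu, 0 < mu < dl -> x1 mu <= x mu <= x2 mu) ->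
  continuity_2d_pt G 0 0 -> lim0 (fun mu => G (x mu) mu) (G 0 0).
Proof using Hsr Hl Hdl Hlr Hdr Hbelow Hsign Hfix.
  intros Hx HG. apply curve_limit; auto. intros mu Hmu. exists (x mu). auto.
Qed.

Lemma Hr0 : Rabs 0 < rho.
Proof using Hsr. rewrite Rabs_R0. apply Hsr. Qed.

Lemma cont_at_0 : continuity_2d_pt (DX f 1) 0 0 /\ continuity_2d_pt (DX f 2) 0 0 /\
  continuity_2d_pt (DX f 3) 0 0 /\ continuity_2d_pt (Dmu f) 0 0 /\
  continuity_2d_pt (Dmu (DX f 1)) 0 0.
Proof using Hsr.
  pose proof Hr0 as H0.
  repeat split; try (apply (sr_DX _ _ _ Hsr); auto; lia).
  - now apply (sr_Dmu _ _ _ Hsr).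
  - now apply (sr_Dxmu _ _ _ Hsr).
Qed.

(** The derivative of the multiplier has the singular part
    [- f_xx f_mu / e], which the factor [e] cancels. *)
Lemma multiplier_limits (x : R -> R) :
  (forall mu, 0 < mu < dl -> x1 mu <= x mu <= x2 mu /\ f (x mu) mu = x mu) ->
  (forall mu, 0 < mu < dl -> continuous x mu) ->
  (forall mu, 0 < mu < dl -> DX f 1 (x mu) mu - 1 <> 0) ->
  let e := fun mu => DX f 1 (x mu) mu - 1 in
  (forall mu, 0 < mu < dl -> ex_derive e mu) /\ lim0 e 0 /\
  lim0 (fun mu => e mu * Derive e mu) (- P).
Proof using Hsr Hl Hdl Hlr Hdr Hbelow Hsign Hfix Hfx.
  intros Hx Hc Hne e. destruct cont_at_0 as [C1 [C2 [_ [C4 C5]]]].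
  assert (Hon := fun G => on_branch x G (fun mu Hmu => proj1 (Hx mu Hmu))).
  assert (Hd : forall mu, 0 < mu < dl ->
    is_derive e mu (DX f 2 (x mu) mu * (- Dmu f (x mu) mu / e mu) + Dmu (DX f 1) (x mu) mu)).
  { intros mu Hmu. apply (branch_derive x mu Hmu); auto.
    intros m Hm. destruct (Hx m Hm) as [H1 H2]. destruct (Hfix m Hm). lra. }
  assert (He : lim0 e 0).
  { apply lim0_val with (1 - 1); [|ring]. apply lim0_minus; [|apply lim0_const].
    rewrite <- Hfx. now apply Hon. }
  split; [intros mu Hmu; eexists; now apply Hd|]. split; [exact He|].
  apply lim0_ext with (d := dl)
    (A := fun mu => - (Dmu f (x mu) mu * DX f 2 (x mu) mu) + e mu * Dmu (DX f 1) (x mu) mu); auto.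
  - intros mu Hmu. pose proof (Hne mu Hmu). fold (e mu) in H.
    rewrite (is_derive_unique _ _ _ (Hd mu Hmu)). field. lra.
  - apply lim0_val with (- P + 0 * Dmu (DX f 1) 0 0); [|ring].
    apply lim0_plus; [apply lim0_opp|]; apply lim0_mult; auto.
Qed.

Lemma e1_limits : (forall mu, 0 < mu < dl -> ex_derive e1 mu) /\ lim0 e1 0 /\
  lim0 (fun mu => e1 mu * Derive e1 mu) (- P).
Proof using Hsr Hl Hdl Hlr Hdr Hbelow Hsign Hfix Hfx.
  apply (multiplier_limits x1).
  - intros mu Hmu. destruct (Hfix mu Hmu). lra.
  - apply fixed_continuous.
  - intros mu Hmu. pose proof (e1_pos mu Hmu). fold (e1 mu). lra.
Qed.

Lemma e2_limits : (forall mu, 0 < mu < dl -> ex_derive e2 mu) /\ lim0 e2 0 /\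
  lim0 (fun mu => e2 mu * Derive e2 mu) (- P).
Proof using Hsr Hl Hdl Hlr Hdr Hbelow Hsign Hfix Hfx.
  apply (multiplier_limits x2).
  - intros mu Hmu. destruct (Hfix mu Hmu). lra.
  - apply fixed_continuous.
  - intros mu Hmu. pose proof (e2_neg mu Hmu). fold (e2 mu). lra.
Qed.

Lemma Derive_n_Derive_rev (h : R -> R) (n : nat) (x : R) :
  Derive_n (Derive h) n x = Derive_n h (S n) x.
Proof using. symmetry. apply Derive_n_Derive. Qed.

(** Taylor expansion at [x1], with [w = x2 - x1]: the conditions
    [f - x = 0] at both ends determine [e1 / w] to first order and
    [(e1 + e2) / w^2] from the third derivative alone. *)
Lemma taylor_pair mu : 0 < mu < dl ->
  exists z1 z2, x1 mu <= z1 <= x2 mu /\ x1 mu <= z2 <= x2 mu /\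
  e1 mu = - (x2 mu - x1 mu) * (DX f 2 (x1 mu) mu / 2 + (x2 mu - x1 mu) * DX f 3 z2 mu / 6) /\
  e1 mu + e2 mu = (x2 mu - x1 mu) ^ 2 * (DX f 3 z1 mu / 2 - DX f 3 z2 mu / 3).
Proof using Hsr Hl Hlr Hdr Hfix.
  intros Hmu. destruct (Hfix mu Hmu) as [H1 H2 H3 H4 H5 _ _ _ _ _].
  assert (Hsec : Cn_on (S (S (S k))) (fun x => - rho < x < rho) (fun x => f x mu)).
  { apply (sr_section _ _ _ Hsr). apply Rabs_def1; lra. }
  destruct (Taylor_Lagrange (fun x => f x mu) 2 (x1 mu) (x2 mu)) as [z2 [Hz2 T2]]; auto.
  { intros t Ht j Hj. apply Hsec; [lra|lia]. }
  destruct (Taylor_Lagrange (Derive (fun x => f x mu)) 1 (x1 mu) (x2 mu)) as [z1 [Hz1 T1]]; auto.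
  { intros t Ht j Hj. apply Cn_Derive in Hsec. apply (Hsec t j); [lra|lia]. }
  exists z1, z2. split; [lra|]. split; [lra|].
  cbv beta in H4, H5.
  unfold sum_f_R0 in T1, T2. rewrite !Derive_n_Derive_rev in T1.
  change (Derive_n (fun x => f x mu) 0 (x1 mu)) with (f (x1 mu) mu) in T2.
  rewrite H4, H5 in T2.
  change (Derive_n (fun x => f x mu) 1 (x1 mu)) with (DX f 1 (x1 mu) mu) in T2.
  change (Derive_n (fun x => f x mu) 2 (x1 mu)) with (DX f 2 (x1 mu) mu) in T2.
  change (Derive_n (fun x => f x mu) 3 z2) with (DX f 3 z2 mu) in T2.
  change (Derive (fun x => f x mu) (x2 mu)) with (DX f 1 (x2 mu) mu) in T1.
  change (Derive_n (fun x => f x mu) 1 (x1 mu)) with (DX f 1 (x1 mu) mu) in T1.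
  change (Derive_n (fun x => f x mu) 2 (x1 mu)) with (DX f 2 (x1 mu) mu) in T1.
  change (Derive_n (fun x => f x mu) 3 z1) with (DX f 3 z1 mu) in T1.
  simpl in T1, T2.
  unfold e1, e2.
  set (w := x2 mu - x1 mu) in *.
  assert (Hw : 0 < w) by (unfold w; lra).
  assert (E1 : DX f 1 (x1 mu) mu - 1 = - w * (DX f 2 (x1 mu) mu / 2 + w * DX f 3 z2 mu / 6)).
  { apply Rmult_eq_reg_l with w; [|lra].
    assert (Hw2 : x2 mu = x1 mu + w) by (unfold w; ring).
    clearbody w. rewrite Hw2 in T2. lra. }
  split; auto.
  replace (DX f 1 (x1 mu) mu - 1 + (DX f 1 (x2 mu) mu - 1))
    with (2 * (DX f 1 (x1 mu) mu - 1) + (DX f 1 (x2 mu) mu - DX f 1 (x1 mu) mu)) by ring.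
  rewrite E1, T1. field.
Qed.

(** The third derivatives at the two intermediate points of the expansion are
    recovered as [T1] and [T2] from [e1], [e2] and [w], so that no choice of these
    points as functions of [mu] is involved. *)
Lemma pair_limits :
  lim0 (fun mu => e1 mu / (x2 mu - x1 mu)) (- DX f 2 0 0 / 2) /\
  lim0 (fun mu => x2 mu - x1 mu) 0 /\
  lim0 (fun mu => (e1 mu + e2 mu) / (x2 mu - x1 mu) ^ 2) (DX f 3 0 0 / 6).
Proof using Hsr Hl Hdl Hlr Hdr Hbelow Hsign Hfix Hfx.
  destruct cont_at_0 as [_ [C2 [C3 _]]].
  set (w := fun mu => x2 mu - x1 mu).
  assert (Hw0 : forall mu, 0 < mu < dl -> 0 < w mu).
  { intros mu Hmu. specialize (Hsign mu Hmu). unfold w. lra. }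
  assert (Hw : lim0 w 0).
  { apply lim0_val with (0 - 0); [|ring].
    apply lim0_minus.
    - apply (on_branch x2 (fun u _ => u)); [|apply continuity_2d_pt_id1].
      intros mu Hmu. specialize (Hsign mu Hmu). lra.
    - apply (on_branch x1 (fun u _ => u)); [|apply continuity_2d_pt_id1].
      intros mu Hmu. specialize (Hsign mu Hmu). lra. }
  set (T2 := fun mu => (- e1 mu / w mu - DX f 2 (x1 mu) mu / 2) * 6 / w mu).
  set (T1 := fun mu => 2 * ((e1 mu + e2 mu) / w mu ^ 2 + T2 mu / 3)).
  assert (HT2 : lim0 T2 (DX f 3 0 0)).
  { apply curve_limit; auto. intros mu Hmu. specialize (Hw0 mu Hmu).
    destruct (taylor_pair mu Hmu) as [z1 [z2 [_ [Hz2 [E1 _]]]]].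
    exists z2. split; auto. unfold T2. rewrite E1. fold (w mu). field. lra. }
  assert (HT1 : lim0 T1 (DX f 3 0 0)).
  { apply curve_limit; auto. intros mu Hmu. specialize (Hw0 mu Hmu).
    destruct (taylor_pair mu Hmu) as [z1 [z2 [Hz1 [Hz2 [E1 E2]]]]].
    exists z1. split; auto. unfold T1, T2. rewrite E2, E1. fold (w mu). field. lra. }
  split; [|split; auto].
  - apply lim0_ext with (d := dl) (A := fun mu => - (DX f 2 (x1 mu) mu / 2 + w mu * T2 mu / 6));
      auto.
    + intros mu Hmu. specialize (Hw0 mu Hmu). unfold T2. fold (w mu). field. lra.
    + apply lim0_val with (- (DX f 2 0 0 / 2 + 0 * DX f 3 0 0 / 6)); [|field].
      apply lim0_opp, lim0_plus.
      * apply lim0_div; [lra| |apply lim0_const]. apply on_branch; auto.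
        intros mu Hmu. specialize (Hsign mu Hmu). lra.
      * apply lim0_div; [lra| |apply lim0_const]. now apply lim0_mult.
  - apply lim0_ext with (d := dl) (A := fun mu => T1 mu / 2 - T2 mu / 3); auto.
    + intros mu Hmu. specialize (Hw0 mu Hmu). unfold T1. fold (w mu). field. lra.
    + apply lim0_val with (DX f 3 0 0 / 2 - DX f 3 0 0 / 3); [|field].
      apply lim0_minus; apply lim0_div; try lra; try apply lim0_const; auto.
Qed.

Lemma ratio_limit : lim0 (fun mu => e2 mu / e1 mu) (-1).
Proof using Hsr Hl Hdl Hlr Hdr Hbelow Hsign Hfix Hfx Hfxx.
  destruct pair_limits as [L1 [L2 L3]].
  apply lim0_ext with (d := dl) (A := fun mu =>
    ((x2 mu - x1 mu) * ((e1 mu + e2 mu) / (x2 mu - x1 mu) ^ 2) - e1 mu / (x2 mu - x1 mu))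
    / (e1 mu / (x2 mu - x1 mu))); auto.
  - intros mu Hmu. specialize (Hsign mu Hmu). pose proof (e1_pos mu Hmu). field. lra.
  - apply lim0_val with ((0 * (DX f 3 0 0 / 6) - (- DX f 2 0 0 / 2)) / (- DX f 2 0 0 / 2));
      [|field; lra].
    apply lim0_div; [lra| |exact L1]. apply lim0_minus; [|exact L1]. now apply lim0_mult.
Qed.

(** Dividing numerator and denominator by [w^2]: with [e1 / w -> s],
    [e2 / w -> - s] and [(e1 + e2) / w^2 -> t] the limit is [t / s^2]. *)
Lemma cubic_coefficient_limit :
  lim0 (fun mu => (e1 mu + e2 mu) / (e1 mu ^ 2 + e1 mu * e2 mu + e2 mu ^ 2))
    (2 * DX f 3 0 0 / (3 * DX f 2 0 0 ^ 2)).
Proof using Hsr Hl Hdl Hlr Hdr Hbelow Hsign Hfix Hfx Hfxx.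
  destruct pair_limits as [L1 [L2 L3]].
  set (w := fun mu => x2 mu - x1 mu) in *.
  set (A := fun mu => e1 mu / w mu) in *. set (S := fun mu => (e1 mu + e2 mu) / w mu ^ 2) in *.
  apply lim0_ext with (d := dl) (A := fun mu =>
    S mu / (A mu * A mu + A mu * (w mu * S mu - A mu) + (w mu * S mu - A mu) * (w mu * S mu - A mu)));
    auto.
  - intros mu Hmu. specialize (Hsign mu Hmu).
    pose proof (e1_pos mu Hmu) as H1. pose proof (e2_neg mu Hmu) as H2.
    assert (Hw : 0 < w mu) by (unfold w; lra).
    assert (Hq : e1 mu * e1 mu + e1 mu * e2 mu + e2 mu * e2 mu <> 0)
      by now apply Rgt_not_eq, quadratic_form_pos.
    replace (w mu * S mu - A mu) with (e2 mu / w mu) by (unfold S, A; field; lra).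
    unfold S, A. field. repeat split; lra.
  - set (s := - DX f 2 0 0 / 2) in *. set (t := DX f 3 0 0 / 6) in *.
    assert (Hs : 0 < s) by (unfold s; lra).
    apply lim0_val with (t / (s * s + s * (0 * t - s) + (0 * t - s) * (0 * t - s))).
    2:{ replace (s * s + s * (0 * t - s) + (0 * t - s) * (0 * t - s)) with (s * s) by ring.
        unfold s, t. field. lra. }
    assert (LB : lim0 (fun mu => w mu * S mu - A mu) (0 * t - s)).
    { apply lim0_minus; auto. now apply lim0_mult. }
    apply lim0_div; auto; [nra|].
    apply lim0_plus; [apply lim0_plus|]; apply lim0_mult; auto.
Qed.
End Curves.

(** * The parameters of the normal form *)

Lemma Cn_sqrt s : Cn_on s half_line sqrt.
Proof.
  induction s as [|s IH].
  - apply Cn_0. intros x Hx. apply continuity_pt_filterlim, continuity_pt_sqrt.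
    unfold half_line in Hx. lra.
  - apply Cn_of_derive with (h' := fun x => 1 / (2 * sqrt x)); auto.
    + intros x Hx. apply (is_derive_sqrt (fun x => x)); [|exact Hx].
      apply derive_id.
    + apply Cn_div; auto.
      * intros x Hx. pose proof (sqrt_lt_R0 x Hx). lra.
      * now apply Cn_const.
      * now apply Cn_scal.
Qed.

(** With [kp = e2 / e1] and [D = e1 * width kp], the fixed points of the normal
    form having multipliers [1 + e1] and [1 + e2] are at distance [D], and equal
    [e1 * lower kp] and [e1 * upper kp]: they solve
    [e1 = a (y1 - y2) (y1 - y3)], [e2 = a (y2 - y1) (y2 - y3)] with third fixed
    point [y3 = 1 / a - y1 - y2].  Adding the two equations gives
    [e1 + e2 = a D^2], and eliminating [y1 + y2] gives
    [D^2 = e1^2 + e1 e2 + e2^2]. *)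
Definition width (kp : R) : R := sqrt (1 + kp + kp ^ 2).
Definition upper (kp : R) : R :=
  width kp * (width kp + 1) / (2 * width kp + 1 - kp).
Definition lower (kp : R) : R :=
  - (width kp * (width kp - kp)) / (2 * width kp + 1 - kp).
Definition height (kp : R) : R :=
  upper kp ^ 2 - (1 + kp) / width kp ^ 2 * upper kp ^ 3.

Lemma width_facts kp : 0 < width kp /\ width kp ^ 2 = 1 + kp + kp ^ 2.
Proof.
  assert (H : 0 < 1 + kp + kp ^ 2) by nra.
  unfold width. split; [now apply sqrt_lt_R0|]. rewrite pow2_sqrt; lra.
Qed.

Lemma den_pos kp : kp < 0 -> 0 < 2 * width kp + 1 - kp.
Proof. intros H. destruct (width_facts kp). lra. Qed.

Lemma upper_multiplier kp : kp < 0 ->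
  - 2 * upper kp + 3 * ((1 + kp) / width kp ^ 2) * upper kp ^ 2 = kp.
Proof.
  intros H. destruct (width_facts kp) as [H1 H2]. pose proof (den_pos kp H) as H3.
  unfold upper. set (d := width kp) in *. set (q := 2 * d + 1 - kp) in *.
  assert (E : - 2 * (d * (d + 1)) * q + 3 * (1 + kp) * (d + 1) ^ 2 = kp * q ^ 2).
  { apply Rminus_diag_uniq.
    match goal with |- ?A = 0 =>
      replace A with ((-4 * d + (kp - 3)) * (d ^ 2 - (1 + kp + kp ^ 2))) by (unfold q; ring) end.
    rewrite H2. ring. }
  transitivity ((- 2 * (d * (d + 1)) * q + 3 * (1 + kp) * (d + 1) ^ 2) / q ^ 2).
  - field. lra.
  - rewrite E. field. lra.
Qed.

Lemma lower_multiplier kp : kp < 0 ->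
  - 2 * lower kp + 3 * ((1 + kp) / width kp ^ 2) * lower kp ^ 2 = 1.
Proof.
  intros H. destruct (width_facts kp) as [H1 H2]. pose proof (den_pos kp H) as H3.
  unfold lower. set (d := width kp) in *. set (q := 2 * d + 1 - kp) in *.
  assert (E : 2 * (d * (d - kp)) * q + 3 * (1 + kp) * (d - kp) ^ 2 = q ^ 2).
  { apply Rminus_diag_uniq.
    match goal with |- ?A = 0 =>
      replace A with ((4 * d + (1 - 3 * kp)) * (d ^ 2 - (1 + kp + kp ^ 2))) by (unfold q; ring) end.
    rewrite H2. ring. }
  transitivity ((2 * (d * (d - kp)) * q + 3 * (1 + kp) * (d - kp) ^ 2) / q ^ 2).
  - field. lra.
  - rewrite E. field. lra.
Qed.

Lemma lower_height kp : kp < 0 ->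
  height kp = lower kp ^ 2 - (1 + kp) / width kp ^ 2 * lower kp ^ 3.
Proof.
  intros H. destruct (width_facts kp) as [H1 H2]. pose proof (den_pos kp H) as H3.
  unfold height, upper, lower. set (d := width kp) in *. set (q := 2 * d + 1 - kp) in *.
  assert (E : d * (d + 1) ^ 2 * q - (1 + kp) * (d + 1) ^ 3
            = d * (d - kp) ^ 2 * q + (1 + kp) * (d - kp) ^ 3).
  { apply Rminus_diag_uniq.
    match goal with |- ?A = 0 =>
      replace A with (((1 + kp) * q) * (d ^ 2 - (1 + kp + kp ^ 2))) by (unfold q; ring) end.
    rewrite H2. ring. }
  transitivity (d * (d * (d + 1) ^ 2 * q - (1 + kp) * (d + 1) ^ 3) / q ^ 3).
  - field. lra.
  - rewrite E. field. lra.
Qed.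

Lemma height_smooth : Cn_on 1 (fun kp => - 2 < kp < 0) height /\ height (-1) = / 4 /\
  Cn_on 1 (fun kp => - 2 < kp < 0) upper /\ Cn_on 1 (fun kp => - 2 < kp < 0) lower.
Proof.
  set (U := fun kp => - 2 < kp < 0).
  assert (HU : open U) by apply open_itv.
  assert (HW : Cn_on 1 U width).
  { apply (Cn_comp 1 U half_line (fun kp => 1 + kp + kp ^ 2) sqrt); auto.
    - intros kp _. unfold half_line. nra.
    - apply Cn_sqrt.
    - apply Cn_plus; auto; [|apply Cn_pow; auto; now apply Cn_id].
      apply Cn_plus; auto; [now apply Cn_const|now apply Cn_id]. }
  assert (HD : Cn_on 1 U (fun kp => 2 * width kp + 1 - kp)).
  { apply Cn_minus; auto; [|now apply Cn_id].
    apply Cn_plus; auto; [now apply Cn_scal|now apply Cn_const]. }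
  assert (HD0 : forall kp, U kp -> 2 * width kp + 1 - kp <> 0).
  { intros kp Hkp. apply Rgt_not_eq, den_pos. unfold U in Hkp. lra. }
  assert (HUp : Cn_on 1 U upper).
  { apply Cn_div; auto. apply Cn_mult; auto. apply Cn_plus; auto. now apply Cn_const. }
  assert (Hw1 : width (-1) = 1).
  { unfold width. replace (1 + -1 + (-1) ^ 2) with 1 by ring. apply sqrt_1. }
  split; [|split; [|split]].
  - apply Cn_minus; auto; [now apply Cn_pow|].
    apply Cn_mult; auto; [|now apply Cn_pow].
    apply Cn_div; auto.
    + intros kp _. apply pow_nonzero, Rgt_not_eq, width_facts.
    + apply Cn_plus; auto; [now apply Cn_const|now apply Cn_id].
    + now apply Cn_pow.
  - unfold height, upper. rewrite Hw1. field.
  - exact HUp.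
  - apply Cn_div; auto. apply Cn_opp; auto. apply Cn_mult; auto.
    apply Cn_minus; auto. now apply Cn_id.
Qed.

Section NormalForm.
Variables (dl P a0 : R) (e1 e2 : R -> R).
Hypothesis Hdl : 0 < dl.
Hypothesis He1 : forall mu, 0 < mu < dl -> 0 < e1 mu.
Hypothesis He2 : forall mu, 0 < mu < dl -> e2 mu < 0.
Hypothesis Hd1 : forall mu, 0 < mu < dl -> ex_derive e1 mu.
Hypothesis Hd2 : forall mu, 0 < mu < dl -> ex_derive e2 mu.
Hypothesis L1 : lim0 e1 0.
Hypothesis L11 : lim0 (fun mu => e1 mu * Derive e1 mu) (- P).
Hypothesis L22 : lim0 (fun mu => e2 mu * Derive e2 mu) (- P).
Hypothesis Lr : lim0 (fun mu => e2 mu / e1 mu) (-1).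
Hypothesis La : lim0 (fun mu => (e1 mu + e2 mu) / (e1 mu ^ 2 + e1 mu * e2 mu + e2 mu ^ 2)) a0.

Let kp := fun mu => e2 mu / e1 mu.

(** [a D^2 = e1 + e2] with [D^2 = e1^2 + e1 e2 + e2^2]; and [nu = y^2 - a y^3] at a
    fixed point [y], which is homogeneous of degree [2] in [(e1, e2)]. *)
Definition nf_a (mu : R) : R := (e1 mu + e2 mu) / (e1 mu ^ 2 + e1 mu * e2 mu + e2 mu ^ 2).
Definition nf_nu (mu : R) : R := e1 mu ^ 2 * height (kp mu).

Lemma kp_neg mu : 0 < mu < dl -> kp mu < 0.
Proof using He1 He2.
  intros Hmu. specialize (He1 mu Hmu). specialize (He2 mu Hmu). unfold kp.
  replace (e2 mu / e1 mu) with (- (- e2 mu / e1 mu)) by (field; lra).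
  assert (0 < - e2 mu / e1 mu) by (apply Rdiv_lt_0_compat; lra). lra.
Qed.

Lemma nf_a_eq mu : 0 < mu < dl -> nf_a mu = (1 + kp mu) / width (kp mu) ^ 2 / e1 mu.
Proof using He1 He2.
  intros Hmu. destruct (width_facts (kp mu)) as [_ E]. rewrite E.
  pose proof (He1 mu Hmu) as H1. pose proof (He2 mu Hmu) as H2. unfold nf_a, kp.
  pose proof (quadratic_form_pos (e1 mu) (e2 mu) H1) as Hq.
  field. repeat split; lra.
Qed.

Lemma nf_fixed mu : 0 < mu < dl ->
  let y1 := e1 mu * lower (kp mu) in let y2 := e1 mu * upper (kp mu) in
  y1 < y2 /\
  g y1 (nf_nu mu) (nf_a mu) = y1 /\ g y2 (nf_nu mu) (nf_a mu) = y2 /\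
  Derive (fun y => g y (nf_nu mu) (nf_a mu)) y1 - 1 = e1 mu /\
  Derive (fun y => g y (nf_nu mu) (nf_a mu)) y2 - 1 = e2 mu.
Proof using He1 He2.
  intros Hmu y1 y2. pose proof (He1 mu Hmu) as H1. pose proof (kp_neg mu Hmu) as Hk.
  destruct (width_facts (kp mu)) as [Hw _].
  assert (Hk2 : e2 mu = e1 mu * kp mu) by (unfold kp; field; lra).
  rewrite !Derive_g. unfold g. rewrite (nf_a_eq mu Hmu).
  set (c := (1 + kp mu) / width (kp mu) ^ 2) in *. unfold nf_nu.
  assert (EU := upper_multiplier (kp mu) Hk). assert (EL := lower_multiplier (kp mu) Hk).
  assert (EH := lower_height (kp mu) Hk). fold c in EU, EL, EH.
  assert (EH2 : height (kp mu) = upper (kp mu) ^ 2 - c * upper (kp mu) ^ 3) by reflexivity.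
  assert (Hlu : lower (kp mu) < upper (kp mu)).
  { pose proof (den_pos (kp mu) Hk) as Hq. unfold lower, upper.
    apply Rmult_lt_compat_r; [now apply Rinv_0_lt_compat|].
    assert (0 < width (kp mu) * (width (kp mu) + 1)) by (apply Rmult_lt_0_compat; lra).
    assert (0 < width (kp mu) * (width (kp mu) - kp mu)) by (apply Rmult_lt_0_compat; lra).
    lra. }
  unfold y1, y2. split; [now apply Rmult_lt_compat_l|]. split; [|split; [|split]].
  - rewrite EH. field. lra.
  - rewrite EH2. field. lra.
  - transitivity (e1 mu * (- 2 * lower (kp mu) + 3 * c * lower (kp mu) ^ 2)).
    + field. lra.
    + rewrite EL. ring.
  - transitivity (e1 mu * (- 2 * upper (kp mu) + 3 * c * upper (kp mu) ^ 2)).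
    + field. lra.
    + rewrite EU. now symmetry.
Qed.

Lemma kp_near : exists d, 0 < d <= dl /\ forall mu, 0 < mu < d -> - 2 < kp mu < 0.
Proof using Hdl He1 He2 Lr.
  destruct (lim0_gt _ _ (-2) Lr) as [d [Hd Hd']]; [lra|].
  exists (Rmin d dl). pose proof (Rmin_l d dl). pose proof (Rmin_r d dl).
  split; [split; [now apply Rmin_pos|auto]|]. intros mu Hmu.
  split; [apply Hd'; lra|apply kp_neg; lra].
Qed.

Lemma nf_a_continuous mu : 0 < mu < dl -> continuous nf_a mu.
Proof using He1 He2 Hd1 Hd2.
  intros Hmu. pose proof (He1 mu Hmu) as H1.
  assert (C1 : continuous e1 mu) by (apply (ex_derive_continuous e1); auto).
  assert (C2 : continuous e2 mu) by (apply (ex_derive_continuous e2); auto).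
  apply continuous_ext with (f := fun mu =>
    (e1 mu + e2 mu) * / (e1 mu * e1 mu + e1 mu * e2 mu + e2 mu * e2 mu)).
  { intros t. unfold nf_a, Rdiv. f_equal. f_equal. ring. }
  apply cont_mult.
  - now apply cont_plus.
  - apply (continuous_Rinv_comp
      (fun mu => e1 mu * e1 mu + e1 mu * e2 mu + e2 mu * e2 mu)).
    + apply cont_plus; [apply cont_plus|];
        now apply cont_mult.
    + now apply Rgt_not_eq, quadratic_form_pos.
Qed.

Lemma nf_nu_derive mu : 0 < mu < dl -> - 2 < kp mu < 0 ->
  is_derive nf_nu mu (2 * (e1 mu * Derive e1 mu) * height (kp mu)
    + Derive height (kp mu)
      * ((e2 mu * Derive e2 mu) / kp mu - kp mu * (e1 mu * Derive e1 mu))).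
Proof using He1 He2 Hd1 Hd2.
  intros Hmu Hk. pose proof (He1 mu Hmu) as H1. pose proof (He2 mu Hmu) as H2.
  assert (D1 := Derive_correct _ _ (Hd1 mu Hmu)). assert (D2 := Derive_correct _ _ (Hd2 mu Hmu)).
  eapply is_derive_eq.
  - apply (derive_mult (fun mu => e1 mu ^ 2) (fun mu => height (kp mu))).
    + apply is_derive_pow. exact D1.
    + apply (derive_comp height kp).
      * eapply Cn_derivable; [apply height_smooth|exact Hk].
      * unfold kp. apply is_derive_div; [exact D2|exact D1|lra].
  - simpl. unfold kp. field. split; lra.
Qed.

Lemma height_limit : lim0 (fun mu => height (kp mu)) (/ 4).
Proof using Lr.
  destruct height_smooth as [HS [<- _]]. apply lim0_comp; auto.
  apply (Cn_continuous _ _ _ _ HS). lra.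
Qed.

Lemma nf_nu_limit : lim0 nf_nu 0.
Proof using L1 Lr.
  apply lim0_val with (0 * 0 * / 4); [|ring].
  apply lim0_ext with (d := 1) (A := fun mu => e1 mu * e1 mu * height (kp mu)); [lra| |].
  - intros mu _. unfold nf_nu. ring.
  - apply lim0_mult; [now apply lim0_mult|apply height_limit].
Qed.

Lemma nf_nu_pos : exists d, 0 < d <= dl /\ forall mu, 0 < mu < d -> 0 < nf_nu mu.
Proof using Hdl He1 Lr.
  destruct (lim0_gt _ _ 0 height_limit) as [d [Hd Hd']]; [lra|].
  exists (Rmin d dl). pose proof (Rmin_l d dl). pose proof (Rmin_r d dl).
  split; [split; [now apply Rmin_pos|auto]|]. intros mu Hmu.
  apply Rmult_lt_0_compat; [|apply Hd'; lra]. apply pow_lt, He1. lra.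
Qed.

(** [e1 e2' - e2 e1'] tends to [0], so that only the variation of [e1^2]
    contributes to [nu']. *)
Lemma nf_nu'_limit : lim0 (Derive nf_nu) (- (P / 2)).
Proof using Hdl He1 He2 Hd1 Hd2 L11 L22 Lr.
  destruct kp_near as [d [Hd Hk]]. destruct height_smooth as [HS _].
  apply lim0_ext with (d := d) (A := fun mu => 2 * (e1 mu * Derive e1 mu) * height (kp mu)
    + Derive height (kp mu)
      * ((e2 mu * Derive e2 mu) / kp mu - kp mu * (e1 mu * Derive e1 mu))); [lra| |].
  - intros mu Hmu. symmetry. apply is_derive_unique, nf_nu_derive; [lra|auto].
  - apply lim0_val with (2 * (- P) * / 4 + Derive height (-1) * (- P / -1 - -1 * - P));
      [|field].
    apply lim0_plus.
    + apply lim0_mult; [|apply height_limit]. apply lim0_mult; [apply lim0_const|exact L11].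
    + apply lim0_mult.
      * apply lim0_comp; auto. apply (Cn_continuous 0 _ _ _ (Cn_Derive _ _ _ HS)). lra.
      * apply lim0_minus; [apply lim0_div; auto; lra|]. now apply lim0_mult.
Qed.

Lemma nf_points_small eps : 0 < eps -> exists d, 0 < d <= dl /\ forall mu, 0 < mu < d ->
  - eps < e1 mu * lower (kp mu) < eps /\ - eps < e1 mu * upper (kp mu) < eps.
Proof using Hdl L1 Lr.
  intros He. destruct height_smooth as [_ [_ [HU HL]]].
  assert (LU : lim0 (fun mu => e1 mu * upper (kp mu)) 0).
  { apply lim0_val with (0 * upper (-1)); [|ring]. apply lim0_mult; auto.
    apply lim0_comp; auto. apply (Cn_continuous _ _ _ _ HU). lra. }
  assert (LL : lim0 (fun mu => e1 mu * lower (kp mu)) 0).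
  { apply lim0_val with (0 * lower (-1)); [|ring]. apply lim0_mult; auto.
    apply lim0_comp; auto. apply (Cn_continuous _ _ _ _ HL). lra. }
  destruct (proj1 (lim0_eps _ _) LU eps He) as [d1 [Hp1 HU']].
  destruct (proj1 (lim0_eps _ _) LL eps He) as [d2 [Hp2 HL']].
  exists (Rmin dl (Rmin d1 d2)).
  pose proof (Rmin_l dl (Rmin d1 d2)). pose proof (Rmin_r dl (Rmin d1 d2)).
  pose proof (Rmin_l d1 d2). pose proof (Rmin_r d1 d2).
  assert (0 < Rmin dl (Rmin d1 d2)) by (repeat apply Rmin_pos; lra).
  split; [lra|]. intros mu Hmu.
  specialize (HU' mu ltac:(lra)). specialize (HL' mu ltac:(lra)).
  apply Rabs_def2 in HU'. apply Rabs_def2 in HL'. lra.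
Qed.
End NormalForm.

(** * The three parameter ranges *)

(** Common to [f], in the parameter [mu], and to the normal form, in the parameter
    [nu]. *)
Record unfolding (n : nat) (e l dl : R) (f : R -> R -> R) : Prop := {
  un_dl : 0 < dl;
  un_tame : forall mu, Rabs mu < dl -> tame (S n) e l (fun x => f x mu);
  un_cont : forall x mu, Rabs x < 3 * l -> Rabs mu < dl -> continuous (fun m => f x m) mu;
  un_mono : forall x mu1 mu2, Rabs x < 3 * l -> - dl < mu1 < mu2 -> mu2 < dl ->
    f x mu1 < f x mu2;
  un_0 : f 0 0 = 0;
  un_below : forall x, Rabs x < 3 * l -> x <> 0 -> f x 0 < x }.

Lemma unfolding_drift n e l dl f : unfolding n e l dl f ->
  forall mu x, - dl < mu < 0 -> Rabs x < 3 * l -> f x mu < x.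
Proof.
  intros H mu x Hmu Hx. pose proof (un_dl _ _ _ _ _ H).
  apply Rlt_le_trans with (f x 0); [apply (un_mono _ _ _ _ _ H); lra|].
  destruct (Req_dec x 0) as [->|Hx0]; [rewrite (un_0 _ _ _ _ _ H); lra|].
  left. now apply (un_below _ _ _ _ _ H).
Qed.

(** The extension depends monotonically on the parameter because the cutoff is
    nonnegative, strictly at the end [l] because it equals [1] there. *)
Lemma unfolding_transit n e l dl f : slack (S n) e -> unfolding n e l dl f ->
  let Fh := fun mu => ext (S n) e l (fun x => f x mu) in
  exists K : R -> R -> R,
    let T := fun mu => transit n l (Fh mu) (K mu) in
    (forall mu, Rabs mu < dl -> global_diffeo (S n) (Fh mu) (K mu)) /\
    (forall mu x, - dl < mu < 0 -> Fh mu x < x) /\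
    (forall mu, - dl < mu < 0 -> continuous T mu) /\
    (forall mu1 mu2, - dl < mu1 < mu2 -> mu2 < 0 -> T mu1 < T mu2) /\
    (forall B, exists d, 0 < d /\ forall mu, - d < mu < 0 -> B < T mu).
Proof.
  intros Hs Hu Fh. pose proof (un_dl _ _ _ _ _ Hu) as Hdl.
  assert (Ht := un_tame _ _ _ _ _ Hu).
  assert (H0 : Rabs 0 < dl) by (rewrite Rabs_R0; lra).
  assert (Hl : 0 < l) by (apply (tame_l _ _ _ _ (Ht 0 H0))).
  set (K := fun mu => epsilon (inhabits (fun x : R => x)) (fun K =>
    global_diffeo (S n) (Fh mu) K /\ forall x, Derive K x <= 2)).
  assert (HK : forall mu, Rabs mu < dl ->
    global_diffeo (S n) (Fh mu) (K mu) /\ forall x, Derive (K mu) x <= 2).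
  { intros mu Hmu. unfold K. apply epsilon_spec. apply ext_global; auto. }
  assert (HF2 : forall mu x, Rabs mu < dl -> Derive (Fh mu) x <= 2).
  { intros mu x Hmu. pose proof (ext_derive n e l _ Hs (Ht mu Hmu) x) as H.
    apply Rabs_le_between in H. unfold Fh. lra. }
  assert (Hjump : forall mu x, Rabs mu < dl -> x - Fh mu x < l).
  { intros mu x Hmu. pose proof (ext_displacement n e l _ Hs (Ht mu Hmu) x) as H.
    apply Rabs_def2 in H. unfold Fh. lra. }
  assert (Hdown : forall mu x, - dl < mu < 0 -> Fh mu x < x).
  { intros mu x Hmu. assert (Hb : Rabs mu < dl) by (rewrite Rabs_left; lra).
    destruct (Rlt_le_dec (Rabs x) l) as [Hx|Hx].
    - unfold Fh. rewrite ext_eq by lra. apply (unfolding_drift _ _ _ _ _ Hu); lra.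
    - apply ext_below; auto. }
  assert (Hcont : forall mu x, Rabs mu < dl -> continuous (fun mu => Fh mu x) mu).
  { intros mu x Hmu. destruct (Rlt_le_dec (Rabs x) (2 * l)) as [Hx|Hx].
    - unfold Fh, ext.
      apply cont_minus; [|apply continuous_const].
      apply cont_plus; [apply continuous_const|].
      apply cont_mult; [apply continuous_const|].
      apply cont_plus; [|apply continuous_const].
      apply cont_minus; [|apply continuous_const].
      apply (un_cont _ _ _ _ _ Hu); lra.
    - apply continuous_ext with (f := fun _ => x - e * l); [|apply continuous_const].
      intros t. unfold Fh. now rewrite ext_far. }
  assert (Hmono : forall mu1 mu2 x, - dl < mu1 < mu2 -> mu2 < dl -> Fh mu1 x <= Fh mu2 x).
  { intros mu1 mu2 x H1 H2. destruct (Rlt_le_dec (Rabs x) (2 * l)) as [Hx|Hx].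
    - unfold Fh, ext. pose proof (cutoff_range (S n) (x / l)).
      pose proof (un_mono _ _ _ _ _ Hu x mu1 mu2 ltac:(lra) H1 H2).
      apply Rplus_le_compat_r, Rplus_le_compat_l, Rmult_le_compat_l; lra.
    - unfold Fh. rewrite !ext_far by auto. lra. }
  assert (Hstrict : forall mu1 mu2, - dl < mu1 < mu2 -> mu2 < dl -> Fh mu1 l < Fh mu2 l).
  { intros mu1 mu2 H1 H2. assert (Hal : Rabs l = l) by (apply Rabs_right; lra).
    unfold Fh. rewrite !ext_eq by lra. apply (un_mono _ _ _ _ _ Hu); lra. }
  assert (H00 : Fh 0 0 = 0).
  { unfold Fh. rewrite ext_eq; [apply Hu|auto|rewrite Rabs_R0; lra]. }
  exists K. cbv zeta.
  assert (HKg : forall mu, Rabs mu < dl -> global_diffeo (S n) (Fh mu) (K mu)) by apply HK.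
  assert (HK2 : forall mu x, Rabs mu < dl -> Derive (K mu) x <= 2) by (intros; now apply HK).
  split; [exact HKg|]. split; [exact Hdown|]. split; [|split].
  - intros mu Hmu. eapply T_continuous with (dl := dl); eauto.
  - intros mu1 mu2 H1 H2. apply (T_strict n l dl Fh K); auto.
  - intros B. apply (T_unbounded n l dl Fh K); auto.
Qed.

(** The condition of [passage_conjugacy] on the transit times is taken as the
    definition of [nu]. *)
Lemma conjugacy_below n e l l' d1 d2 f1 f2 :
  slack (S n) e -> unfolding n e l d1 f1 -> unfolding n e l' d2 f2 ->
  exists (d : R) (nu : R -> R), 0 < d <= d1 /\
    (forall mu, - d < mu < 0 -> continuous nu mu) /\
    (forall c, 0 < c -> exists d', 0 < d' /\ forall mu, - d' < mu < 0 -> - c < nu mu < 0) /\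
    (forall mu, - d < mu < 0 -> conjugate (S n)
       (fun x => f1 x mu) (sym_itv l) (fun y => f2 y (nu mu)) (sym_itv l')).
Proof.
  intros Hs H1 H2. pose proof (un_dl _ _ _ _ _ H1) as Hd1. pose proof (un_dl _ _ _ _ _ H2) as Hd2.
  assert (Hl : 0 < l).
  { apply (tame_l (S n) e l (fun x => f1 x 0)). apply H1. rewrite Rabs_R0; lra. }
  assert (Hl' : 0 < l').
  { apply (tame_l (S n) e l' (fun x => f2 x 0)). apply H2. rewrite Rabs_R0; lra. }
  destruct (unfolding_transit n e l d1 f1 Hs H1) as [K [A1 [A2 [A3 [_ A5]]]]].
  destruct (unfolding_transit n e l' d2 f2 Hs H2) as [L [B1 [B2 [B3 [B4 B5]]]]].
  destruct (match_increasing
    (fun mu => transit n l (ext (S n) e l (fun x => f1 x mu)) (K mu))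
    (fun mu => transit n l' (ext (S n) e l' (fun x => f2 x mu)) (L mu))
    d1 d2 Hd1 Hd2 A3 A5 B3 B4 B5)
    as [d [nu [Hd [C1 [C2 C3]]]]].
  exists d, nu. split; auto. split; auto. split; auto.
  intros mu Hmu. destruct (C1 mu Hmu) as [C4 C5].
  assert (Hb1 : Rabs mu < d1) by (rewrite Rabs_left; lra).
  assert (Hb2 : Rabs (nu mu) < d2) by (rewrite Rabs_left; lra).
  assert (T1 := un_tame _ _ _ _ _ H1 mu Hb1). assert (T2 := un_tame _ _ _ _ _ H2 (nu mu) Hb2).
  destruct (passage_conjugacy n l l' _ _ _ _ Hl Hl' (A1 mu Hb1) (B1 (nu mu) Hb2))
    as [h [E1 [E2 [E3 [E4 E5]]]]].
  - intros x. apply A2. lra.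
  - intros x. now apply B2.
  - intros x. pose proof (ext_displacement n e l _ Hs T1 x) as H. apply Rabs_def2 in H. lra.
  - intros x. pose proof (ext_displacement n e l' _ Hs T2 x) as H. apply Rabs_def2 in H. lra.
  - now symmetry.
  - apply (restrict_conjugacy (S n) h _ _ (ext (S n) e l (fun x => f1 x mu))
      (ext (S n) e l' (fun y => f2 y (nu mu)))); auto.
    + intros x Hx. apply (ext_eq (S n) e l (fun x => f1 x mu)); auto.
      unfold sym_itv in Hx. apply Rabs_le; lra.
    + intros x Hx. apply (ext_eq (S n) e l' (fun y => f2 y (nu mu))); auto.
      unfold sym_itv in Hx. apply Rabs_le; lra.
Qed.

Lemma integrate_bound (J : R) (ph ph' : R -> R) C m :
  (forall t, Rabs t < J -> is_derive ph t (ph' t)) -> ph 0 = 0 -> 0 <= C ->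
  (forall t, Rabs t < J -> Rabs (ph' t) <= C * Rabs t ^ m) ->
  forall x, Rabs x < J -> Rabs (ph x) <= C * Rabs x ^ S m.
Proof.
  intros Hd H0 HC Hb x Hx.
  assert (Hcv : convex (fun x => Rabs x < J)).
  { intros a b c Ha Hc Habc. apply Rabs_def2 in Ha. apply Rabs_def2 in Hc.
    apply Rabs_def1; lra. }
  assert (Hx0 : Rabs 0 < J) by (rewrite Rabs_R0; pose proof (Rabs_pos x); lra).
  assert (Hgen : exists c, Rabs c <= Rabs x /\ Rabs c < J /\ Rabs (ph x) = Rabs (ph' c) * Rabs x).
  { destruct (Rtotal_order x 0) as [H|[H|H]].
    - destruct (MVT_on _ ph ph' x 0 Hcv Hd Hx Hx0 H) as [c [Hc E]].
      exists c. rewrite (Rabs_left c), (Rabs_left x) in * by lra.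
      split; [lra|]. split; [lra|].
      replace (ph x) with (- (ph' c * (0 - x))) by lra.
      rewrite Rabs_Ropp, Rabs_mult, (Rabs_right (0 - x)) by lra. ring.
    - subst x. exists 0. split; [lra|]. split; [exact Hx0|]. rewrite H0, !Rabs_R0. ring.
    - destruct (MVT_on _ ph ph' 0 x Hcv Hd Hx0 Hx H) as [c [Hc E]].
      exists c. rewrite (Rabs_right c), (Rabs_right x) in * by lra.
      split; [lra|]. split; [lra|].
      replace (ph x) with (ph' c * (x - 0)) by lra.
      rewrite Rabs_mult, (Rabs_right (x - 0)) by lra. ring. }
  destruct Hgen as [c [Hc [HcJ ->]]].
  replace (C * Rabs x ^ S m) with (C * Rabs x ^ m * Rabs x) by (simpl; ring).
  apply Rmult_le_compat_r; [apply Rabs_pos|].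
  apply Rle_trans with (1 := Hb c HcJ). apply Rmult_le_compat_l; auto.
  apply pow_incr. split; [apply Rabs_pos|auto].
Qed.

(** The bound on the third derivative is integrated three times, which also gives
    the expansion of the first derivative. *)
Lemma tame_quadratic_contact k e l F :
  tame (S (S (S k))) e l F -> F 0 = 0 -> Derive F 0 = 1 ->
  quadratic_contact (- Derive_n F 2 0 / 2) (ext (S (S (S k))) e l F).
Proof.
  intros HF H0 H1. pose proof (tame_l _ _ _ _ HF) as Hl.
  set (D := Derive_n F). set (al := - D 2%nat 0 / 2).
  assert (H2 : D 2%nat 0 < 0).
  { apply (tame_F'' _ _ _ _ HF). rewrite Rabs_R0. lra. }
  assert (Hd : forall j t, (j <= 2)%nat -> Rabs t < l -> is_derive (D j) t (D (S j) t)).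
  { intros j t Hj Ht. apply Derive_correct. apply Rabs_def2 in Ht.
    apply (tame_Cn _ _ _ _ HF t (S j)); [lra|lia]. }
  destruct (bounded_on_closed (D 3%nat) (- l) l) as [C [HC0 HC]]; [lra| |].
  { intros t Ht. apply (tame_Cn _ _ _ _ HF t 3%nat); [lra|lia]. }
  split; [unfold al; fold D; lra|]. exists C, l. split; auto. split; auto.
  assert (B2 : forall x, Rabs x < l -> Rabs (D 2%nat x - D 2%nat 0) <= C * Rabs x ^ 1).
  { apply (integrate_bound l (fun x => D 2%nat x - D 2%nat 0) (D 3%nat) C 0); auto.
    - intros t Ht. eapply is_derive_eq.
      + apply derive_minus; [apply (Hd 2%nat); auto|].
        apply derive_const.
      + ring.
    - ring.
    - intros t Ht. simpl. rewrite Rmult_1_r. apply HC. apply Rabs_def2 in Ht. lra. }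
  assert (B1 : forall x, Rabs x < l -> Rabs (D 1%nat x - 1 - D 2%nat 0 * x) <= C * Rabs x ^ 2).
  { apply (integrate_bound l (fun x => D 1%nat x - 1 - D 2%nat 0 * x)
      (fun x => D 2%nat x - D 2%nat 0) C 1); auto.
    - intros t Ht. eapply is_derive_eq.
      + apply derive_minus.
        * apply derive_minus; [apply (Hd 1%nat); auto|].
          apply derive_const.
        * apply (is_derive_scal (fun x => x) t (D 2%nat 0)). apply derive_id.
      + ring.
    - change (D 1%nat 0) with (Derive F 0). rewrite H1. ring. }
  assert (B0 : forall x, Rabs x < l ->
    Rabs (F x - x - D 2%nat 0 / 2 * x ^ 2) <= C * Rabs x ^ 3).
  { apply (integrate_bound l (fun x => F x - x - D 2%nat 0 / 2 * x ^ 2)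
      (fun x => D 1%nat x - 1 - D 2%nat 0 * x) C 2); auto.
    - intros t Ht. eapply is_derive_eq.
      + apply derive_minus.
        * apply derive_minus; [apply (Hd 0%nat); auto; lia|].
          apply derive_id.
        * apply (is_derive_scal (fun x => x ^ 2) t (D 2%nat 0 / 2)).
          apply is_derive_pow. apply derive_id.
      + simpl. field.
    - rewrite H0. simpl. ring. }
  intros x Hx. split.
  - rewrite ext_eq by lra.
    replace (F x - x + al * x ^ 2) with (F x - x - D 2%nat 0 / 2 * x ^ 2)
      by (unfold al, D; field).
    now apply B0.
  - rewrite ext_derive_eq by auto.
    replace (Derive F x - 1 + 2 * al * x) with (D 1%nat x - 1 - D 2%nat 0 * x)
      by (unfold al; change (D 1%nat x) with (Derive F x); unfold D; field).
    now apply B1.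
Qed.

Lemma conjugacy_at_bifurcation k e l l' F G :
  slack (S (S (S k))) e -> tame (S (S (S k))) e l F -> tame (S (S (S k))) e l' G ->
  F 0 = 0 -> G 0 = 0 -> Derive F 0 = 1 -> Derive G 0 = 1 ->
  (forall x, Rabs x < 3 * l -> x <> 0 -> F x < x) ->
  (forall x, Rabs x < 3 * l' -> x <> 0 -> G x < x) ->
  conjugate 1 F (sym_itv l) G (sym_itv l').
Proof.
  intros Hs HF HG HF0 HG0 HF1 HG1 HFd HGd.
  pose proof (tame_l _ _ _ _ HF) as Hl. pose proof (tame_l _ _ _ _ HG) as Hl'.
  destruct (ext_global (S (S k)) e l F Hs HF) as [K [HK _]].
  destruct (ext_global (S (S k)) e l' G Hs HG) as [L [HL _]].
  assert (Hdown : forall l H, tame (S (S (S k))) e l H ->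
    (forall x, Rabs x < 3 * l -> x <> 0 -> H x < x) ->
    forall x, x <> 0 -> ext (S (S (S k))) e l H x < x).
  { intros m H HH Hd x Hx. pose proof (tame_l _ _ _ _ HH).
    destruct (Rlt_le_dec (Rabs x) m) as [Hm|Hm].
    - rewrite ext_eq by lra. apply Hd; auto. lra.
    - apply ext_below; auto. }
  assert (Hr0 : Rabs 0 = 0) by apply Rabs_R0.
  destruct (parabolic_conjugacy (S (S k)) _ K _ L (- Derive_n F 2 0 / 2) (- Derive_n G 2 0 / 2)
    (- l) l (- l') l' HK HL) as [h [E1 [E2 [E3 [E4 E5]]]]]; try lra.
  - rewrite ext_eq by lra. exact HF0.
  - rewrite ext_eq by lra. exact HG0.
  - now apply Hdown.
  - now apply Hdown.
  - now apply tame_quadratic_contact.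
  - now apply tame_quadratic_contact.
  - apply (restrict_conjugacy 1 h F G (ext (S (S (S k))) e l F) (ext (S (S (S k))) e l' G)); auto.
    + intros x Hx. apply ext_eq; auto. unfold sym_itv in Hx. apply Rabs_le; lra.
    + intros x Hx. apply ext_eq; auto. unfold sym_itv in Hx. apply Rabs_le; lra.
Qed.
Lemma g_below B l y nu a : 0 <= B -> B * l <= / 27 -> Rabs a <= B -> nu = 0 ->
  Rabs y < 3 * l -> y <> 0 -> g y nu a < y.
Proof.
  intros HB HBl Ha -> Hy Hy0. unfold g.
  replace (y + 0 - y ^ 2 + a * y ^ 3) with (y - y * y * (1 - a * y)) by ring.
  assert (Hay : Rabs (a * y) <= / 9).
  { rewrite Rabs_mult. apply Rle_trans with (B * (3 * l)); [|lra].
    apply Rmult_le_compat; try apply Rabs_pos; lra. }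
  apply Rabs_le_between in Hay.
  assert (0 < y * y * (1 - a * y)).
  { apply Rmult_lt_0_compat; [|lra]. now apply Rsqr_pos_lt. }
  lra.
Qed.

Lemma g_unfolding n e B l nu0 a : 0 < nu0 -> 0 <= B -> B * l <= / 27 -> Rabs a <= B ->
  (forall nu, Rabs nu < nu0 -> tame (S n) e l (fun y => g y nu a)) ->
  unfolding n e l nu0 (fun y nu => g y nu a).
Proof.
  intros Hnu0 HB HBl Ha Ht. constructor; auto.
  - intros x mu _ _. apply (ex_derive_continuous (fun m => g x m a)).
    unfold g. auto_derive. exact Logic.I.
  - intros x m1 m2 _ H1 H2. unfold g. lra.
  - unfold g. ring.
  - intros x Hx Hx0. now apply (g_below B l).
Qed.

Theorem theorem3p1 (r : nat) (U : R * R -> Prop) (f : R -> R -> R)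
  (hr : (4 <= r)%nat)
  (hU : open U) (hU0 : U (0, 0))
  (hf : Cn2_on r U f)
  (hf0 : f 0 0 = 0)
  (hfx : partial_derive 1 0 f 0 0 = 1)
  (hfmu : 0 < partial_derive 0 1 f 0 0)
  (hfxx : partial_derive 2 0 f 0 0 < 0) :
  exists (N : R -> Prop) (mu0 : R),
    interval_nbhd 0 N /\ 0 < mu0 /\
    (forall x mu : R, N x -> - mu0 < mu < mu0 -> U (x, mu)) /\
    (forall mu : R, - mu0 < mu < 0 ->
       forall x : R, ~ fixed_in (fun x => f x mu) N x) /\
    (forall mu : R, 0 < mu < mu0 ->
       exists x1 x2 : R, x1 <> x2 /\
         forall x : R, fixed_in (fun x => f x mu) N x <-> x = x1 \/ x = x2) /\
    exists (M : R -> Prop) (nu a : R -> R),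
      interval_nbhd 0 M /\
      (forall mu : R, - mu0 < mu < mu0 -> continuous nu mu /\ continuous a mu) /\
      nu 0 = 0 /\
      (forall mu : R, 0 < mu < mu0 -> ex_derive nu mu) /\
      filterlim (Derive nu) (at_right 0)
        (locally (- (partial_derive 0 1 f 0 0 * partial_derive 2 0 f 0 0 / 2))) /\
      a 0 = 2 * partial_derive 3 0 f 0 0 / (3 * partial_derive 2 0 f 0 0 ^ 2) /\
      let gt := fun mu y => g y (nu mu) (a mu) in
      (forall mu : R, - mu0 < mu < 0 ->
         conjugate r (fun x => f x mu) N (gt mu) M) /\
      conjugate 1 (fun x => f x 0) N (gt 0) M /\
      (forall mu : R, 0 < mu < mu0 ->
         forall p : R, fixed_in (fun x => f x mu) N p ->
         exists (q : R) (h : R -> R),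
           fixed_in (gt mu) M q /\ h p = q /\
           ((stable (fun x => f x mu) p /\ stable (gt mu) q /\
             conjugacy (r - 1)
               (fun x => f x mu) (basin_attraction (fun x => f x mu) N p)
               (gt mu) (basin_attraction (gt mu) M q) h) \/
            (~ stable (fun x => f x mu) p /\ ~ stable (gt mu) q /\
             conjugacy (r - 1)
               (fun x => f x mu) (basin_repulsion (fun x => f x mu) N p)
               (gt mu) (basin_repulsion (gt mu) M q) h))).
Proof.
  destruct r as [|[|[|k]]]; try lia.
  change (partial_derive 1 0 f 0 0) with (DX f 1 0 0) in hfx.
  change (partial_derive 0 1 f 0 0) with (Dmu f 0 0) in hfmu |- *.
  change (partial_derive 2 0 f 0 0) with (DX f 2 0 0) in hfxx |- *.
  change (partial_derive 3 0 f 0 0) with (DX f 3 0 0).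
  set (P := Dmu f 0 0 * DX f 2 0 0).
  set (a0 := 2 * DX f 3 0 0 / (3 * DX f 2 0 0 ^ 2)).
  destruct (Cn2_smooth_rect k U f hU hU0 hf) as [rho [Hsr HU]].
  pose proof (sr_rho _ _ _ Hsr) as Hrho.
  destruct (slack_exists (S (S k))) as [e Hs].
  assert (He : 0 < e <= / 10) by apply Hs.
  destruct (family_tame k rho f Hsr hf0 hfx hfmu hfxx e He)
    as [l [dl [Hl [Hdl [Hlr [Hdr [Htame [Hmono Hbelow]]]]]]]].
  (* [M] has to be fixed before [a]: since [a mu] will tend to [a0], the bound
     [|a0| + 1] covers all small [mu]. *)
  set (B := Rabs a0 + 1).
  assert (HB : 0 <= B) by (unfold B; pose proof (Rabs_pos a0); lra).
  destruct (g_tame (S (S (S k))) e B He HB) as [l' [nu0 [Hl' [Hnu0 [_ [HBl Hgt]]]]]].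
  assert (Ha0 : Rabs a0 <= B) by (unfold B; lra).
  assert (Huf : unfolding (S (S k)) e l dl f).
  { constructor; auto. intros x mu Hx Hmu. apply (f_mu_continuous k rho f Hsr); lra. }
  assert (Hug : unfolding (S (S k)) e l' nu0 (fun y nu => g y nu a0))
    by (apply (g_unfolding _ _ B); auto).
  destruct (conjugacy_below (S (S k)) e l l' dl nu0 f (fun y nu => g y nu a0) Hs Huf Hug)
    as [dn [num [Hdn [Hnum1 [Hnum2 Hnum3]]]]].
  assert (Hpairs : forall mu, exists p : R * R, 0 < mu < dl ->
    fst p < 0 < snd p /\ fixed_pair l (fun x => f x mu) (fst p) (snd p)).
  { intros mu. destruct (Rlt_dec 0 mu) as [H1|H1]; [|exists (0, 0); lra].
    destruct (Rlt_dec mu dl) as [H2|H2]; [|exists (0, 0); lra].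
    destruct (tame_fixed_pair (S k) e l (fun x => f x mu)) as [p1 [p2 [Hp Hfp]]].
    - apply Htame. rewrite Rabs_right; lra.
    - apply Rle_lt_trans with (f 0 0); [lra|].
      apply Hmono; [rewrite Rabs_R0|..]; lra.
    - exists (p1, p2). auto. }
  set (pr := fun mu => epsilon (inhabits (0, 0)) (fun p : R * R => 0 < mu < dl ->
    fst p < 0 < snd p /\ fixed_pair l (fun x => f x mu) (fst p) (snd p))).
  assert (Hpr : forall mu, 0 < mu < dl ->
    fst (pr mu) < 0 < snd (pr mu) /\ fixed_pair l (fun x => f x mu) (fst (pr mu)) (snd (pr mu))).
  { intros mu. exact (epsilon_spec (inhabits (0, 0)) _ (Hpairs mu)). }
  set (x1 := fun mu => fst (pr mu)). set (x2 := fun mu => snd (pr mu)).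
  assert (Hsign : forall mu, 0 < mu < dl -> x1 mu < 0 < x2 mu) by (intros; now apply Hpr).
  assert (Hfix : forall mu, 0 < mu < dl -> fixed_pair l (fun x => f x mu) (x1 mu) (x2 mu))
    by (intros; now apply Hpr).
  clearbody x1 x2. clear Hpr pr Hpairs.
  set (e1 := fun mu => DX f 1 (x1 mu) mu - 1). set (e2 := fun mu => DX f 1 (x2 mu) mu - 1).
  assert (He1 : forall mu, 0 < mu < dl -> 0 < e1 mu)
    by exact (e1_pos l dl f x1 x2 Hfix).
  assert (He2 : forall mu, 0 < mu < dl -> e2 mu < 0)
    by exact (e2_neg l dl f x1 x2 Hfix).
  destruct (e1_limits k rho l dl f x1 x2) as [Hd1 [L1 L11]]; auto.
  destruct (e2_limits k rho l dl f x1 x2) as [Hd2 [_ L22]]; auto.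
  fold e1 in Hd1, L1, L11. fold e2 in Hd2, L22. fold P in L11, L22.
  assert (Lr : lim0 (fun mu => e2 mu / e1 mu) (-1))
    by now apply (ratio_limit k rho l dl f x1 x2).
  assert (La : lim0 (nf_a e1 e2) a0)
    by now apply (cubic_coefficient_limit k rho l dl f x1 x2).
  destruct (kp_near dl e1 e2 Hdl He1 He2 Lr) as [c1 [Hc1 Hkp]].
  destruct (nf_nu_pos dl e1 e2 Hdl He1 Lr) as [c2 [Hc2 Hnupos]].
  destruct (nf_points_small dl e1 e2 Hdl L1 Lr l' Hl') as [c3 [Hc3 Hsmall]].
  destruct (proj1 (lim0_eps _ _) (nf_nu_limit e1 e2 L1 Lr) nu0 Hnu0) as [c4 [Hc4 Hnusmall]].
  destruct (proj1 (lim0_eps _ _) La 1 Rlt_0_1) as [c5 [Hc5 Hasmall]].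
  set (mu0 := Rmin dn (Rmin c1 (Rmin c2 (Rmin c3 (Rmin c4 c5))))).
  assert (Hmu0 : 0 < mu0 /\ mu0 <= dn /\ mu0 <= c1 /\ mu0 <= c2 /\ mu0 <= c3 /\ mu0 <= c4
                 /\ mu0 <= c5).
  { unfold mu0. solve_min. }
  clearbody mu0.
  exists (sym_itv l), mu0.
  split. { exists (- l), l. split; [lra|]. intros x. reflexivity. }
  split; [lra|]. split.
  { intros x mu Hx Hmu. unfold sym_itv in Hx. apply HU; apply Rabs_def1; lra. }
  split.
  { intros mu Hmu x [Hx HFx]. unfold sym_itv in Hx.
    pose proof (unfolding_drift _ _ _ _ _ Huf mu x ltac:(lra) ltac:(apply Rabs_def1; lra)). lra. }
  split.
  { intros mu Hmu. exists (x1 mu), (x2 mu). assert (Hf := Hfix mu ltac:(lra)). split.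
    - pose proof (fp_12 _ _ _ _ Hf). lra.
    - intros x. now apply fixed_pair_iff. }
  set (nu := fun mu => if Rlt_dec 0 mu then nf_nu e1 e2 mu
                       else if Rlt_dec mu 0 then num mu else 0).
  set (a := fun mu => if Rlt_dec 0 mu then nf_a e1 e2 mu else a0).
  assert (nup : forall mu, 0 < mu -> nu mu = nf_nu e1 e2 mu).
  { intros mu H. unfold nu. destruct (Rlt_dec 0 mu); [reflexivity|lra]. }
  assert (nun : forall mu, mu < 0 -> nu mu = num mu).
  { intros mu H. unfold nu. destruct (Rlt_dec 0 mu); [lra|].
    destruct (Rlt_dec mu 0); [reflexivity|lra]. }
  assert (nuz : nu 0 = 0).
  { unfold nu. destruct (Rlt_dec 0 0); [lra|reflexivity]. }
  assert (ap : forall mu, 0 < mu -> a mu = nf_a e1 e2 mu).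
  { intros mu H. unfold a. destruct (Rlt_dec 0 mu); [reflexivity|lra]. }
  assert (an : forall mu, mu <= 0 -> a mu = a0).
  { intros mu H. unfold a. destruct (Rlt_dec 0 mu); [lra|reflexivity]. }
  clearbody nu a.
  assert (Hnud : forall mu, 0 < mu < mu0 -> is_derive nu mu (Derive (nf_nu e1 e2) mu)).
  { intros mu Hmu. apply is_derive_ext_loc with (f := nf_nu e1 e2).
    - apply filter_imp with (2 := open_gt 0 mu (proj1 Hmu)). intros t Ht. now rewrite nup.
    - apply Derive_correct. eexists.
      apply (nf_nu_derive dl e1 e2 He1 He2 Hd1 Hd2); [lra|apply Hkp; lra]. }
  exists (sym_itv l'), nu, a.
  split. { exists (- l'), l'. split; [lra|]. intros x. reflexivity. }
  split.
  { intros mu Hmu. destruct (Rtotal_order mu 0) as [Hm|[Hm|Hm]].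
    - split.
      + apply continuous_ext_loc with (g := num); [|apply Hnum1; lra].
        apply filter_imp with (2 := open_lt 0 mu Hm). intros t Ht. now rewrite nun.
      + apply continuous_ext_loc with (g := fun _ => a0); [|apply continuous_const].
        apply filter_imp with (2 := open_lt 0 mu Hm). intros t Ht. rewrite an; [reflexivity|lra].
    - subst mu. split; apply continuous_eps; intros eps Heps.
      + destruct (proj1 (lim0_eps _ _) (nf_nu_limit e1 e2 L1 Lr) eps Heps) as [q1 [Hq1 Q1]].
        destruct (Hnum2 eps Heps) as [q2 [Hq2 Q2]].
        exists (Rmin q1 q2). split; [now apply Rmin_pos|]. intros t Ht.
        rewrite Rminus_0_r in Ht. rewrite nuz.
        pose proof (Rmin_l q1 q2). pose proof (Rmin_r q1 q2). apply Rabs_def2 in Ht.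
        destruct (Rtotal_order t 0) as [H'|[H'|H']].
        * rewrite nun by auto. specialize (Q2 t ltac:(lra)). apply Rabs_def1; lra.
        * subst t. rewrite nuz, Rminus_diag, Rabs_R0. exact Heps.
        * rewrite nup by auto. apply Q1. lra.
      + destruct (proj1 (lim0_eps _ _) La eps Heps) as [q1 [Hq1 Q1]].
        exists q1. split; [exact Hq1|]. intros t Ht. rewrite Rminus_0_r in Ht.
        rewrite (an 0) by lra. apply Rabs_def2 in Ht.
        destruct (Rlt_le_dec 0 t) as [H'|H'].
        * rewrite ap by auto. apply Q1. lra.
        * rewrite an, Rminus_diag, Rabs_R0 by auto. exact Heps.
    - split.
      + apply (ex_derive_continuous nu). eexists. apply Hnud. lra.
      + apply continuous_ext_loc with (g := nf_a e1 e2).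
        * apply filter_imp with (2 := open_gt 0 mu Hm). intros t Ht. now rewrite ap.
        * apply (nf_a_continuous dl e1 e2 He1 He2 Hd1 Hd2). lra. }
  split; [exact nuz|].
  split. { intros mu Hmu. eexists. now apply Hnud. }
  split.
  { change (lim0 (Derive nu) (- (P / 2))).
    apply lim0_ext with (d := mu0) (A := Derive (nf_nu e1 e2)); [lra| |].
    - intros mu Hmu. symmetry. apply is_derive_unique. now apply Hnud.
    - now apply (nf_nu'_limit dl P e1 e2). }
  split. { apply an. lra. }
  intros gt. split; [|split].
  - intros mu Hmu. unfold gt. rewrite nun, an by lra. apply Hnum3. lra.
  - unfold gt. rewrite nuz, an by lra.
    assert (Hr0 : Rabs 0 < dl) by (rewrite Rabs_R0; lra).
    apply (conjugacy_at_bifurcation k e l l'); auto.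
    + apply Hgt; [rewrite Rabs_R0; lra|auto].
    + unfold g. ring.
    + rewrite Derive_g. ring.
    + intros x Hx Hx0. now apply (g_below B l').
  - intros mu Hmu p Hp. unfold gt. rewrite nup, ap by lra.
    assert (Hmd : 0 < mu < dl) by lra.
    destruct (nf_fixed dl e1 e2 He1 He2 mu Hmd) as [Hy [Hg1 [Hg2 [HD1 HD2]]]].
    destruct (Hsmall mu ltac:(lra)) as [S1 S2].
    set (y1 := e1 mu * lower (e2 mu / e1 mu)) in *.
    set (y2 := e1 mu * upper (e2 mu / e1 mu)) in *.
    set (G := fun y => g y (nf_nu e1 e2 mu) (nf_a e1 e2 mu)) in *.
    assert (HtG : tame (S (S (S k))) e l' G).
    { apply Hgt.
      - specialize (Hnusmall mu ltac:(lra)). now rewrite Rminus_0_r in Hnusmall.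
      - specialize (Hasmall mu ltac:(lra)). unfold B.
        replace (nf_a e1 e2 mu) with ((nf_a e1 e2 mu - a0) + a0) by ring.
        eapply Rle_trans; [apply Rabs_triang|]. lra. }
    assert (HG0 : 0 < G 0).
    { unfold G, g. specialize (Hnupos mu ltac:(lra)). lra. }
    destruct (tame_fixed_pair (S k) e l' G HtG HG0) as [z1 [z2 [_ Hz]]].
    (* The points with the prescribed multipliers are fixed points in [M], where
       there are only two. *)
    assert (Ez : z1 = y1 /\ z2 = y2).
    { destruct (proj1 (fixed_pair_iff l' G z1 z2 y1 Hz)) as [E1|E1];
        [split; [unfold sym_itv; lra|exact Hg1]|..];
      destruct (proj1 (fixed_pair_iff l' G z1 z2 y2 Hz)) as [E2|E2];
        try (split; [unfold sym_itv; lra|exact Hg2]);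
        pose proof (fp_12 _ _ _ _ Hz); lra. }
    destruct Ez as [-> ->].
    assert (Hf := Hfix mu Hmd).
    assert (HtF : tame (S (S (S k))) e l (fun x => f x mu))
      by (apply Htame; rewrite Rabs_right; lra).
    destruct (proj1 (fixed_pair_iff l _ _ _ p Hf) Hp) as [-> | ->].
    + destruct (repelling_conjugacy (S k) e l l' (fun x => f x mu) G _ _ _ _ Hs HtF HtG Hf Hz
        (S (S (S k)) - 1)) as [h [Hh1 [Hh2 [Hh3 Hh4]]]]; [lia| |].
      * change (DX f 1 (x1 mu) mu = Derive G y1). unfold e1 in HD1. lra.
      * exists y1, h. split; [apply (fixed_pair_iff l' G y1 y2); auto|].
        split; [exact Hh1|right]. split; [exact Hh2|]. split; [exact Hh3|exact Hh4].
    + destruct (attracting_conjugacy (S k) e l l' (fun x => f x mu) G _ _ _ _ Hs HtF HtG Hf Hz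
        (S (S (S k)) - 1)) as [h [Hh1 [Hh2 [Hh3 Hh4]]]]; [lia| |].
      * change (DX f 1 (x2 mu) mu = Derive G y2). unfold e2 in HD2. lra.
      * exists y2, h. split; [apply (fixed_pair_iff l' G y1 y2); auto|].
        split; [exact Hh1|left]. split; [exact Hh2|]. split; [exact Hh3|exact Hh4].
Qed.
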